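(* All solutions of the Onsager free-energy functional (with the Onsager kernel) are uniaxial in a neighbourhood of the trivial solution $\phi=0$ and locally around $\lambda=\lambda_2=\frac{\pi}{32}$. That is, there is a neighbourhood of $(0,\lambda_2)$ in $H^2(\mathbb{S}^2)\times\mathbb{R}$ such that every $(\phi,\lambda)$ in it with $$\lambda\phi(p)-\frac{1}{Z(\phi)}\int_{\mathbb{S}^2}k(p\cdot q)e^{-\phi(q)}\,dq=0\quad\text{for all }p\in\mathbb{S}^2$$ is axially symmetric, i.e. $\phi$ is invariant under all rotations about some axis.
   Context: $\mathbb{S}^2\subset\mathbb{R}^3$ is the unit sphere with surface measure $dq$ and $Z(\phi)=\int_{\mathbb{S}^2}e^{-\phi(q)}\,dq$. The Onsager functional with parameter $\lambda=k_B\tau$ is $\mathcal{F}(\rho)=\lambda\int_{\mathbb{S}^2}\rho\ln\rho\,dp+\frac12\int_{\mathbb{S}^2\times\mathbb{S}^2}K(p,q)\rho(p)\rho(q)\,dp\,dq$ on probability densities $\rho$, with Onsager kernel $K(p,q)=\sqrt{1-(p\cdot q)^2}$. Since adding a constant to the kernel does not change the critical points, it is normalised to mean zero: $k(p\cdot q)=\sqrt{1-(p\cdot q)^2}-\frac{\pi}{4}$, so $\int_{\mathbb{S}^2}k(p\cdot q)\,dq=0$. Critical points $\rho$ correspond to solutions $\phi$ of the displayed Euler-Lagrange equation through $\rho=e^{-\phi}/Z(\phi)$; $\phi=0$ corresponds to the trivial solution $\rho=\frac{1}{4\pi}$. $\lambda_2=-\mu_2/(4\pi)=\frac{\pi}{32}$,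 where $\mu_2$ is the eigenvalue of the operator $\eta\mapsto\int_{\mathbb{S}^2}k(p\cdot q)\eta(q)\,dq$ on spherical harmonics of degree $2$. *)

(* Defs.v *)
From HB Require Import structures.
From mathcomp Require Import all_boot all_order all_algebra.
From mathcomp Require Import all_classical all_reals all_analysis.
From mathcomp Require Import measurable_realfun.
Set Implicit Arguments.
Unset Strict Implicit.
Unset Printing Implicit Defensive.
Import Order.TTheory GRing.Theory Num.Theory.
Import numFieldNormedType.Exports.
Local Open Scope classical_set_scope.
Local Open Scope ring_scope.

Section sphere.
Variable R : realType.
Implicit Types x y : 'rV[R]_3.

Definition dot x y : R := \sum_(i < 3) x 0 i * y 0 i.

Definition S2 : Type := set_type [set x : 'rV[R]_3 | dot x x = 1].

Definition coords (p : S2) : 'rV[R]_3 := set_val p.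

Definition spherical_coords (z : R * R) : 'rV[R]_3 :=
  \row_(i < 3) [:: sin z.1 * cos z.2; sin z.1 * sin z.2; cos z.1]`_i.

Lemma dot_spherical_coords z :
  dot (spherical_coords z) (spherical_coords z) = 1.
Proof.
rewrite /dot !big_ord_recl big_ord0 !mxE /=.
rewrite -!expr2 !exprMn addr0 addrA -mulrDr cos2Dsin2 mulr1.
by rewrite addrC cos2Dsin2.
Qed.

Definition spherical (z : R * R) : S2 :=
  exist _ (spherical_coords z) (mem_set (dot_spherical_coords z)).

HB.instance Definition _ :=
  Topological.copy S2 (set_type [set x : 'rV[R]_3 | dot x x = 1]).
HB.instance Definition _ := isPointed.Build S2 (spherical (0, 0)).

(* The Borel sigma-algebra of the topology induced from R^3. *)
HB.instance Definition _ := @isMeasurable.Build (sigma_display (@open S2)) S2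
  <<s (@open S2) >> (@sigma_algebra0 _ setT _) (@sigma_algebraC _ _)
  (@sigma_algebra_bigcup _ setT _).

Let continuous_spherical : continuous spherical.
Proof.
apply: continuous_comp_initial => z U [P Pz sPU].
have c0 (g : R -> R) (h : R * R -> R) : continuous g ->
    {for z, continuous h} -> {for z, continuous (g \o h)}.
  by move=> cg ch; apply: continuous_comp => //; exact: cg.
have cs := @continuous_sin R; have cc := @continuous_cos R.
have cf : {for z, continuous (fst : R * R -> R)} by exact: cvg_fst.
have cn : {for z, continuous (snd : R * R -> R)} by exact: cvg_snd.
have c1 : {for z, continuous (fun w : R * R => sin w.1 * cos w.2)}.
  by apply: cvgM; [exact: (c0 _ _ cs cf)|exact: (c0 _ _ cc cn)].
have c2 : {for z, continuous (fun w : R * R => sin w.1 * sin w.2)}.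
  by apply: cvgM; [exact: (c0 _ _ cs cf)|exact: (c0 _ _ cs cn)].
have c3 : {for z, continuous (fun w : R * R => cos w.1)}.
  exact: (c0 _ _ cc cf).
have cP j : \forall w \near z, P 0 j (spherical_coords w 0 j).
  have := Pz 0 j; rewrite /= set_valE /= mxE.
  case: j => -[|[|[|//]]] j3 /= Pj.
  - by near=> w; rewrite mxE /=; near: w; exact: c1.
  - by near=> w; rewrite mxE /=; near: w; exact: c2.
  - by near=> w; rewrite mxE /=; near: w; exact: c3.
suff : \forall w \near z, forall j, P 0 j (spherical_coords w 0 j).
  by apply: filterS => w Pw; apply: sPU => i j; rewrite ord1; exact: Pw.
exact: (@filter_forall _ _ (fun j w => P 0 j (spherical_coords w 0 j)) (nbhs z) _ cP).
Unshelve. all: by end_near. Qed.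

Let measurable_open (U : set (R * R)) : open U -> measurable U.
Proof.
move=> oU.
pose B (i : (rat * rat) * (rat * rat)) : set (R * R) :=
  ball (ratr i.1.1 : R) (ratr i.1.2) `*` ball (ratr i.2.1 : R) (ratr i.2.2).
have -> : U = \bigcup_(i in [set i | B i `<=` U]) B i.
  apply/seteqP; split=> [z Uz|z [i /= + Bz]]; last exact.
  have [[A1 A2] /= [A1z A2z] AU] : nbhs z U by exact: open_nbhs_nbhs.
  have rb (x : R) (A : set R) : nbhs x A ->
      exists c : rat * rat, ball (ratr c.1 : R) (ratr c.2) x /\
        ball (ratr c.1 : R) (ratr c.2) `<=` A.
    rewrite nbhsE => -[V [oV Vx] VA].
    have [c [r [/set_mem cx cV]]] := open_subball_rat oV (mem_set Vx).
    by exists (c, r); split => //; exact: subset_trans VA.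
  have [i1 [i1z i1A]] := rb _ _ A1z.
  have [i2 [i2z i2A]] := rb _ _ A2z.
  exists (i1, i2) => //= w [w1 w2]; apply: AU.
  by split; [exact: i1A|exact: i2A].
rewrite bigcup_mkcond; apply: countable_bigcupT_measurable.
  exact: countableP.
move=> i; case: ifPn => // _.
by apply: measurableX; exact: measurable_ball.
Qed.

Lemma measurable_spherical : measurable_fun setT spherical.
Proof.
apply: (measurability (@open S2)) => // _ [U oU <-].
rewrite setTI; apply: measurable_open.
by move/continuousP: continuous_spherical; exact.
Qed.

Definition polar_rectangle : set (R * R) := `[0, pi] `*` `[0, 2 * pi].

(* The area element in spherical coordinates is sin theta dtheta dphi, with
   z = (theta, phi). *)
Definition surface_measure (A : set S2) : \bar R :=
  (\int[lebesgue_measure \x lebesgue_measure]_(z in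
     polar_rectangle `&` spherical @^-1` A) (sin z.1)%:E)%E.

Let sin_ge0_polar z : polar_rectangle z -> 0 <= sin z.1.
Proof.
case=> /=; rewrite in_itv /= => /andP[z0 zpi] _.
by apply: sin_ge0_pi; rewrite z0.
Qed.

Let measurable_polar_rectangle : measurable polar_rectangle.
Proof. by apply: measurableX; exact: measurable_itv. Qed.

Let surface_measure0 : surface_measure set0 = 0%E.
Proof. by rewrite /surface_measure preimage_set0 setI0 integral_set0. Qed.

Let surface_measure_ge0 A : (0 <= surface_measure A)%E.
Proof.
by apply: integral_ge0 => z [/sin_ge0_polar s0 _]; rewrite lee_fin.
Qed.

Let measurable_fun_sin1 (D : set (R * R)) :
  measurable_fun D (fun z : R * R => (sin z.1)%:E).
Proof.
apply/measurable_EFinP; apply: measurable_funTS.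
apply: measurableT_comp; last exact: measurable_fst.
by apply: continuous_measurable_fun; exact: continuous_sin.
Qed.

Let surface_measure_sigma_additive : semi_sigma_additive surface_measure.
Proof.
move=> F mF tF mUF; rewrite /surface_measure preimage_bigcup setI_bigcupr.
rewrite ge0_integral_bigcup //=.
- apply: is_cvg_ereal_nneg_natsum_cond => n _ _.
  exact: surface_measure_ge0.
- move=> k; apply: measurableI => //.
  by rewrite -[X in measurable X]setTI; exact: measurable_spherical.
- exact: measurable_fun_sin1.
- by move=> z [k _ [/sin_ge0_polar s0 _]]; rewrite lee_fin.
- apply/trivIsetP => i j _ _ ij; rewrite setIACA -preimage_setI.
  by move/trivIsetP : tF => ->//; rewrite preimage_set0 setI0.
Qed.

HB.instance Definition _ := isMeasure.Build _ _ _ surface_measure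
  surface_measure0 surface_measure_ge0 surface_measure_sigma_additive.

Definition iter_derive (vs : seq 'rV[R]_3) (F : 'rV[R]_3 -> R) :
    'rV[R]_3 -> R :=
  foldr (fun v G => 'D_v G) F vs.

(* C^infinity on R^3. Since the sphere is closed, the smooth functions on it are
   exactly the restrictions of these. *)
Definition smooth (F : 'rV[R]_3 -> R) : Prop := forall vs : seq 'rV[R]_3,
  continuous (iter_derive vs F) /\
  forall x v, derivable (iter_derive vs F) x v.

(* The generator x_i d_j - x_j d_i of the rotations in the (i, j)-plane, for
   a = (i, j). At each point of the sphere these fields span the tangent space,
   and they are divergence-free on the sphere, so the formal adjoint of the
   derivation along such a field is its opposite. *)
Definition rotation_field (a : 'I_3 * 'I_3) x : 'rV[R]_3 :=
  x 0 a.1 *: delta_mx 0 a.2 - x 0 a.2 *: delta_mx 0 a.1.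

Definition is_weak_derivative (a : 'I_3 * 'I_3) (f g : S2 -> R) : Prop :=
  g \in Lfun surface_measure 2%:E /\
  forall F : 'rV[R]_3 -> R, smooth F ->
    \int[surface_measure]_p
       (f p * 'D_(rotation_field a (coords p)) F (coords p)) =
    - \int[surface_measure]_p (g p * F (coords p)).

(* Unique up to a null set; only meaningful when a weak derivative exists. *)
Definition weak_derivative (a : 'I_3 * 'I_3) (f : S2 -> R) : S2 -> R :=
  get (is_weak_derivative a f).

(* The Sobolev space H^2 of the sphere: the weak derivatives of order at most 2
   along the rotation fields exist and are square-integrable. Writing
   L_ij for these derivations, the sum over i < j of |L_ij f|^2 is |grad f|^2 and
   the sum over i < j of L_ij^2 is the Laplace-Beltrami operator. *)
Definition H2 (f : S2 -> R) : Prop :=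
  [/\ f \in Lfun surface_measure 2%:E,
      forall a, is_weak_derivative a f (weak_derivative a f) &
      forall a b, is_weak_derivative b (weak_derivative a f)
                    (weak_derivative b (weak_derivative a f))].

Definition L2normsq (f : S2 -> R) : R := \int[surface_measure]_p (f p ^+ 2).

Definition H2norm (f : S2 -> R) : R :=
  Num.sqrt (L2normsq f
    + \sum_(a : 'I_3 * 'I_3 | (a.1 < a.2)%N) L2normsq (weak_derivative a f)
    + \sum_(a : 'I_3 * 'I_3 | (a.1 < a.2)%N)
        \sum_(b : 'I_3 * 'I_3 | (b.1 < b.2)%N)
          L2normsq (weak_derivative b (weak_derivative a f))).

Definition partition_function (phi : S2 -> R) : R :=
  \int[surface_measure]_q expR (- phi q).

Definition onsager_kernel (t : R) : R := Num.sqrt (1 - t ^+ 2) - pi / 4.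

Definition euler_lagrange (lambda : R) (phi : S2 -> R) : Prop := forall p,
  lambda * phi p - (partition_function phi)^-1 *
    \int[surface_measure]_q
      (onsager_kernel (dot (coords p) (coords q)) * expR (- phi q)) = 0.

(* Vectors are rows, so A acts by x |-> x *m A. *)
Definition rotation (A : 'M[R]_3) : Prop := A *m A^T = 1%:M /\ \det A = 1.

Definition axially_symmetric (phi : S2 -> R) : Prop :=
  exists n : S2, forall A : 'M[R]_3, rotation A -> coords n *m A = coords n ->
    forall p q : S2, coords q = coords p *m A -> phi q = phi p.

End sphere.

(* Main.v *)
Require Import Defs.
From HB Require Import structures.
From mathcomp Require Import all_boot all_order all_algebra.
From mathcomp Require Import all_classical all_reals all_analysis.
From mathcomp Require Import measurable_realfun ring lra.
Set Implicit Arguments.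
Unset Strict Implicit.
Unset Printing Implicit Defensive.
Import Order.TTheory GRing.Theory Num.Theory.
Import numFieldNormedType.Exports.
Local Open Scope classical_set_scope.
Local Open Scope ring_scope.

(** Write E for the mean over the sphere, 4 pi rho = exp (- phi) / E exp (- phi)
    for the relative density of a solution phi, and t = p . q.

    Continuity. The equation itself bounds phi, then bounds its sup-norm by its
    L2 norm, and extends it to a continuous function F on the whole space
    ([solution_extends]). So only solutions of small sup-norm d, on the
    sphere, have to be studied, and rotations act on them by composition
    ([small_solution], [solution_rot]). That the surface measure, defined in
    polar coordinates, is invariant under the orthogonal group
    ([orthogonal_surf_inv]) rests on the chart (x, z) of a hemisphere, in which
    x and z can be exchanged.

    Splitting. The kernel is - c (t^2 - 1/3) + r(t), where c = 15 pi / 64 and r is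
    orthogonal to the constants and to the quadratic forms. The operator with
    kernel r has sup-norm at most 0.0482 ([E_abs_rem]), less than half of
    pi / 32. Hence lam phi is the quadratic form of the second moments of the
    density, up to a factor and a constant, plus a term on which the equation is
    contracting: near pi / 32 a small solution is determined by the form
    E[(x . q)^2 4 pi rho(q)] ([solution_unique]). If this form is invariant
    under the isometries fixing an axis, then so is phi. It remains to show that,
    once diagonalised, the form cannot have three distinct eigenvalues s0, s1,
    s2.

    Secants. Exchanging the coordinates x and z changes the form by
    (s0 - s2) h, where h = x^2 - z^2. The quotients v of the change of phi, and
    G of the change of the density, by s0 - s2 satisfy
    lam v = - c h + E[r G], G = - m v with m close to 1, and E[h G] = 2. The
    exchange of x and y, conjugated by the exchange of y and z, provides vh and
    Gh with the same three properties and another coefficient mh. Both v and vh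
    are - (c / lam) h up to O(d) ([secant_bound]), and
    (m - mh) / (s1 - s2) is (c / (2 lam)) (3 y^2 - 1) up to O(d)
    ([chord_difference]). Subtract the two equations, divide by s1 - s2, and
    test against h: since h is orthogonal to r, the difference of v and vh
    drops out and there remains
    0 = (c / lam)^2 / 2 * E[h^2 (3 y^2 - 1)] + O(d). The moment is - 16 / 105
    ([E_cubic_moment]), which is impossible for small d ([secants_absurd]).
    So two eigenvalues coincide ([two_moments_equal]) and the third one has the
    axis of symmetry as its eigenline ([solution_axis]). *)

(** * Integration on the sphere in polar coordinates *)
Section polar.
Variable R : realType.
Local Notation mu := (@lebesgue_measure R).
Local Notation sigma := (@surface_measure R).

Lemma polar_rectangle_sin (z : R * R) : polar_rectangle z -> 0 <= sin z.1.
Proof.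
case=> /=; rewrite in_itv /= => /andP[z0 zpi] _.
by apply: sin_ge0_pi; rewrite z0.
Qed.

Lemma measurable_polar_rectangle : measurable (@polar_rectangle R).
Proof. by apply: measurableX; exact: measurable_itv. Qed.

Lemma measurable_sin_fst (D : set (R * R)) :
  measurable_fun D (fun z : R * R => (sin z.1)%:E).
Proof.
apply/measurable_EFinP; apply: measurable_funTS.
apply: measurableT_comp; last exact: measurable_fst.
by apply: continuous_measurable_fun; exact: continuous_sin.
Qed.

Let surface_indic (A : set (S2 R)) : measurable A ->
  (\int[sigma]_p (\1_A p)%:E =
   \int[mu \x mu]_(z in @polar_rectangle R)
     ((\1_A (spherical z))%:E * (sin z.1)%:E))%E.
Proof.
move=> mA; rewrite integral_indic// setIT /= /surface_measure.
rewrite integral_mkcondr; apply: eq_integral => z _.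
rewrite patchE; case: ifPn.
  by rewrite inE /= => Az; rewrite indicE mem_set// mul1e.
by rewrite notin_setE /= => Az; rewrite indicE memNset// mul0e.
Qed.

Import HBNNSimple.

Let surface_nnsfun (f : {nnsfun S2 R >-> R}) :
  (\int[sigma]_p (f p)%:E =
   \int[mu \x mu]_(z in @polar_rectangle R)
     ((f (spherical z))%:E * (sin z.1)%:E))%E.
Proof.
under [LHS]eq_integral do rewrite fimfunE -fsumEFin//.
rewrite [LHS]ge0_integral_fsum//; last 2 first.
  - by move=> r; exact/measurable_EFinP/measurableT_comp.
  - by move=> n x _; rewrite EFinM nnfun_muleindic_ge0.
under [RHS]eq_integral.
  move=> z zD; rewrite fimfunE -fsumEFin// ge0_mule_fsuml; last first.
    by move=> r; rewrite EFinM nnfun_muleindic_ge0.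
  over.
have mD := measurable_polar_rectangle.
have mi (r : R) : measurable_fun (@polar_rectangle R)
   (fun z => (\1_(f @^-1` [set r]) (spherical z))%:E).
  apply/measurable_EFinP; apply: measurable_funTS.
  by apply: measurableT_comp => //; exact: measurable_spherical.
rewrite [RHS]ge0_integral_fsum//; last 2 first.
  - move=> r; apply: emeasurable_funM; last exact: measurable_sin_fst.
    under eq_fun do rewrite EFinM.
    by apply: emeasurable_funM => //; exact: mi.
  - move=> n z /polar_rectangle_sin s0; rewrite mule_ge0 ?lee_fin//.
    by rewrite -lee_fin EFinM nnfun_muleindic_ge0.
apply: eq_fsbigr => r _.
rewrite integralZl_indic_nnsfun//= surface_indic//.
have [r0|r0] := leP 0 r.
  rewrite -ge0_integralZl//=.
  - by apply: eq_integral => z _; rewrite EFinM muleA.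
  - by apply: emeasurable_funM; [exact: mi|exact: measurable_sin_fst].
  - by move=> z /polar_rectangle_sin s0; rewrite mule_ge0 ?lee_fin.
have -> : f @^-1` [set r] = set0.
  by apply/seteqP; split => // x /= fxr; have : 0 <= f x by []; rewrite fxr leNgt r0.
under eq_integral do rewrite indic0 mul0e.
by rewrite integral0 mule0; under eq_integral do rewrite indic0 mulr0 mul0e; rewrite integral0.
Qed.

(** The surface measure is defined on sets only; the formula for functions
    follows from it for indicators, then for simple functions by linearity, and
    then for all nonnegative functions by monotone convergence. *)
Lemma ge0_integral_surface (f : S2 R -> \bar R) :
  measurable_fun setT f -> (forall p, 0 <= f p)%E ->
  (\int[sigma]_p f p = \int[mu \x mu]_(z in @polar_rectangle R)
     (f (spherical z) * (sin z.1)%:E))%E.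
Proof.
move=> mf f0.
have mD := measurable_polar_rectangle.
pose f_ := nnsfun_approx measurableT mf.
transitivity (lim (\int[sigma]_p (f_ n p)%:E @[n --> \oo])%E).
  rewrite -monotone_convergence//=.
  - apply: eq_integral => ? /[!inE] xD; apply/esym/cvg_lim => //=.
    exact: cvg_nnsfun_approx.
  - by move=> n; exact/measurable_EFinP/measurable_funTS.
  - by move=> n ? _; rewrite lee_fin.
  - by move=> ? _ ? ? mn; rewrite lee_fin; exact/lefP/nd_nnsfun_approx.
transitivity (lim (\int[mu \x mu]_(z in @polar_rectangle R)
     ((f_ n (spherical z))%:E * (sin z.1)%:E) @[n --> \oo])%E).
  by apply: congr_lim; apply/funext => n /=; exact: surface_nnsfun.
rewrite -monotone_convergence//=.
- apply: eq_integral => z /[!inE] /polar_rectangle_sin s0.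
  apply/cvg_lim => //; apply: cvgeZr => //; exact: cvg_nnsfun_approx.
- move=> n; apply: emeasurable_funM; last exact: measurable_sin_fst.
  apply/measurable_EFinP/measurable_funTS; apply: measurableT_comp => //.
  exact: measurable_spherical.
- by move=> n z /polar_rectangle_sin s0; rewrite mule_ge0 ?lee_fin.
- move=> z /polar_rectangle_sin s0 m n mn; rewrite lee_wpmul2r ?lee_fin//.
  exact/lefP/nd_nnsfun_approx.
Qed.

End polar.

(** * Continuity and coordinates *)
Section cts_toolkit.
Variables (R : realType) (T : topologicalType).
Implicit Types f g : T -> R.

Lemma ctsC (c : R) : continuous (fun _ : T => c).
Proof. by move=> x; exact: cvg_cst. Qed.

Lemma ctsD f g : continuous f -> continuous g -> continuous (fun x => f x + g x).
Proof. by move=> cf cg x; apply: cvgD; [exact: cf|exact: cg]. Qed.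

Lemma ctsN f : continuous f -> continuous (fun x => - f x).
Proof. by move=> cf x; apply: cvgN; exact: cf. Qed.

Lemma ctsB f g : continuous f -> continuous g -> continuous (fun x => f x - g x).
Proof. by move=> cf cg x; apply: cvgB; [exact: cf|exact: cg]. Qed.

Lemma ctsM f g : continuous f -> continuous g -> continuous (fun x => f x * g x).
Proof. by move=> cf cg x; apply: cvgM; [exact: cf|exact: cg]. Qed.

Lemma ctsX f n : continuous f -> continuous (fun x => f x ^+ n).
Proof.
move=> cf; elim: n => [|n IH]; first exact: ctsC.
by under eq_fun do rewrite exprS; exact: ctsM.
Qed.

Lemma cts_comp (U V : topologicalType) (f : T -> U) (g : U -> V) :
  continuous f -> continuous g -> continuous (fun x => g (f x)).
Proof. by move=> cf cg x; apply: (@continuous_comp _ _ _ f g); [exact: cf|exact: cg]. Qed.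

Lemma cts_coord n (f : T -> 'rV[R]_n) i : continuous f ->
  continuous (fun x => f x 0 i).
Proof. by move=> cf; apply: (@cts_comp _ _ f (fun M : 'rV[R]_n => M 0 i)) => // M; exact: (@coord_continuous R 1 n 0 i). Qed.

Lemma cts_rV n (f : T -> 'rV[R]_n) :
  (forall i, continuous (fun x => f x 0 i)) -> continuous f.
Proof.
move=> cf t U [P Pz sPU].
have cP j : \forall w \near t, P 0 j (f w 0 j) by exact: (cf j _ _ (Pz 0 j)).
suff : \forall w \near t, forall j, P 0 j (f w 0 j).
  by apply: filterS => w Pw; apply: sPU => i j; rewrite ord1; exact: Pw.
exact: (@filter_forall _ _ (fun j w => P 0 j (f w 0 j)) (nbhs t) _ cP).
Qed.

Lemma cts_mulmxr n (f : T -> 'rV[R]_n) (A : 'M[R]_n) : continuous f ->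
  continuous (fun x => f x *m A).
Proof.
move=> cf; apply: cts_rV => i; under eq_fun do rewrite mxE.
apply: continuous_big => [|j _]; first exact: add_continuous.
by apply: ctsM; [exact: cts_coord|exact: ctsC].
Qed.

End cts_toolkit.

Lemma cts_id (T : topologicalType) : continuous (fun x : T => x).
Proof. by move=> x; exact: cvg_id. Qed.

Section Vec.
Variable R : realType.
Local Notation mu := (@lebesgue_measure R).
Local Notation sigma := (@surface_measure R).

Definition vec (x y z : R) : 'rV[R]_3 := \row_(i < 3) [:: x; y; z]`_i.

Lemma vec_eta (v : 'rV[R]_3) : v = vec (v 0 0) (v 0 1) (v 0 2%:R).
Proof.
apply/rowP => -[[|[|[|//]]] i3]; rewrite mxE /=; congr (v _ _); exact: val_inj.
Qed.

Lemma cts_vec (T : topologicalType) (f g h : T -> R) :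
  continuous f -> continuous g -> continuous h ->
  continuous (fun x => vec (f x) (g x) (h x)).
Proof.
by move=> cf cg ch; apply: cts_rV => -[[|[|[|//]]] i3]; under eq_fun do rewrite mxE.
Qed.

Lemma dotE (x y : 'rV[R]_3) :
  dot x y = x 0 0 * y 0 0 + x 0 1 * y 0 1 + x 0 2%:R * y 0 2%:R.
Proof.
rewrite /dot !big_ord_recl big_ord0 addr0 addrA.
by congr (_ * _ + _ * _ + _ * _); congr (_ _ _); apply: val_inj.
Qed.

Lemma dot_mulmx (x y : 'rV[R]_3) : dot x y = (x *m y^T) 0 0.
Proof. by rewrite mxE; apply: eq_bigr => i _; rewrite mxE. Qed.

Lemma cts_dot (T : topologicalType) (f g : T -> 'rV[R]_3) :
  continuous f -> continuous g -> continuous (fun x => dot (f x) (g x)).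
Proof.
move=> cf cg; under eq_fun do rewrite dotE.
by apply: ctsD; [apply: ctsD|]; apply: ctsM; exact: cts_coord.
Qed.

Lemma continuous_coords : continuous (@coords R).
Proof. exact: initial_continuous. Qed.

Lemma measurable_fun_S2 (f : S2 R -> R) : continuous f -> measurable_fun setT f.
Proof.
move=> /continuousP cf.
apply: (measurability _ (RGenOpens.measurableE R)).
move=> _ [_ [a [b ->] <-]]; rewrite setTI; apply: sub_sigma_algebra; apply: cf.
exact: interval_open.
Qed.

Lemma measurable_coords_comp (F : 'rV[R]_3 -> R) : continuous F ->
  measurable_fun setT (fun p : S2 R => F (coords p)).
Proof.
by move=> cF; apply: measurable_fun_S2; exact: (cts_comp continuous_coords).
Qed.

Section tonelli_rect.
Variables (A B : set R) (f : R * R -> \bar R).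
Hypotheses (mA : measurable A) (mB : measurable B).
Hypothesis mf : measurable_fun setT f.
Hypothesis f0 : forall z, (A `*` B) z -> (0 <= f z)%E.

Let g := f \_ (A `*` B).
Let mg : measurable_fun setT g.
Proof.
apply/(measurable_restrictT f) => //; first exact: measurableX.
exact: measurable_funTS.
Qed.
Let g0 z : (0 <= g z)%E. Proof. exact: erestrict_ge0. Qed.

Lemma tonelli_rect1 : (\int[mu \x mu]_(z in A `*` B) f z =
  \int[mu]_(x in A) \int[mu]_(y in B) f (x, y))%E.
Proof.
rewrite integral_mkcond.
transitivity (\int[mu]_x fubini_F mu g x)%E; first exact: fubini_tonelli1.
rewrite [RHS]integral_mkcond.
apply: eq_integral => x _; rewrite patchE /fubini_F; case: ifPn => xA.
  rewrite [RHS]integral_mkcond; apply: eq_integral => y _.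
  by rewrite /g !patchE in_setX /= xA.
by apply: integral0_eq => y _; rewrite /g patchE in_setX /= (negbTE xA).
Qed.

Lemma tonelli_rect2 : (\int[mu \x mu]_(z in A `*` B) f z =
  \int[mu]_(y in B) \int[mu]_(x in A) f (x, y))%E.
Proof.
rewrite integral_mkcond.
transitivity (\int[mu]_x fubini_G mu g x)%E; first exact: fubini_tonelli2.
rewrite [RHS]integral_mkcond.
apply: eq_integral => x _; rewrite patchE /fubini_G; case: ifPn => xA.
  rewrite [RHS]integral_mkcond; apply: eq_integral => y _.
  by rewrite /g !patchE in_setX /= xA andbT.
by apply: integral0_eq => y _; rewrite /g patchE in_setX /= (negbTE xA) andbF.
Qed.
End tonelli_rect.

(** The plane has a countable base of products of balls with rational data, so
    its open sets belong to the product sigma-algebra. *)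
Lemma open_plane_measurable (U : set (R * R)) : open U -> measurable U.
Proof.
move=> oU.
pose B (i : (rat * rat) * (rat * rat)) : set (R * R) :=
  ball (ratr i.1.1 : R) (ratr i.1.2) `*` ball (ratr i.2.1 : R) (ratr i.2.2).
have -> : U = \bigcup_(i in [set i | B i `<=` U]) B i.
  apply/seteqP; split=> [z Uz|z [i /= + Bz]]; last exact.
  have [[A1 A2] /= [A1z A2z] AU] : nbhs z U by exact: open_nbhs_nbhs.
  have rb (x : R) (A : set R) : nbhs x A ->
      exists c : rat * rat, ball (ratr c.1 : R) (ratr c.2) x /\
        ball (ratr c.1 : R) (ratr c.2) `<=` A.
    rewrite nbhsE => -[V [oV Vx] VA].
    have [c [r [/set_mem cx cV]]] := open_subball_rat oV (mem_set Vx).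
    by exists (c, r); split => //; exact: subset_trans VA.
  have [i1 [i1z i1A]] := rb _ _ A1z.
  have [i2 [i2z i2A]] := rb _ _ A2z.
  exists (i1, i2) => //= w [w1 w2]; apply: AU.
  by split; [exact: i1A|exact: i2A].
rewrite bigcup_mkcond; apply: countable_bigcupT_measurable.
  exact: countableP.
move=> i; case: ifPn => // _.
by apply: measurableX; exact: measurable_ball.
Qed.

Lemma continuous_plane_measurable (f : R * R -> R) :
  continuous f -> measurable_fun setT f.
Proof.
move=> /continuousP cf.
apply: (measurability _ (RGenOpens.measurableE R)).
move=> _ [_ [a [b ->] <-]]; rewrite setTI; apply: open_plane_measurable; apply: cf.
exact: interval_open.
Qed.

Lemma spherical_coordsE (z : R * R) :
  spherical_coords z = vec (sin z.1 * cos z.2) (sin z.1 * sin z.2) (cos z.1).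
Proof. by []. Qed.

Lemma integral_surface_iterated (F : 'rV[R]_3 -> R) :
  continuous F -> (forall x, 0 <= F x) ->
  (\int[sigma]_p (F (coords p))%:E =
   \int[mu]_(t in `[0%R, pi]) \int[mu]_(f in `[0%R, (2 * pi)%R])
     ((F (vec (sin t * cos f) (sin t * sin f) (cos t)) * sin t)%R)%:E)%E.
Proof.
move=> cF F0; rewrite ge0_integral_surface//; last 2 first.
- by apply/measurable_EFinP; exact: measurable_coords_comp.
- by move=> p; rewrite lee_fin.
rewrite /polar_rectangle tonelli_rect1//.
- apply: emeasurable_funM; last exact: measurable_sin_fst.
  apply/measurable_EFinP.
  apply: (@measurableT_comp _ _ _ _ _ _ (fun p : S2 R => F (coords p))).
    exact: measurable_coords_comp.
  exact: measurable_spherical.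
- by move=> z /polar_rectangle_sin z0; rewrite mule_ge0 ?lee_fin.
Qed.

End Vec.

(** * Integrals on the line *)
Section line.
Variable R : realType.
Local Notation mu := (@lebesgue_measure R).

Lemma is_derive_continuous (F F' : R -> R) :
  (forall x : R, is_derive x 1 F (F' x)) -> continuous F.
Proof.
by move=> dF x; apply: differentiable_continuous; apply/derivable1_diffP; exact: ex_derive.
Qed.

Lemma is_derive_LR (F F' : R -> R) a b :
  (forall x : R, is_derive x 1 F (F' x)) -> derivable_oo_LRcontinuous F a b.
Proof.
move=> dF; have cF := is_derive_continuous dF; split.
- by move=> x _; exact: ex_derive.
- by apply: cvg_at_right_filter; exact: cF.
- by apply: cvg_at_left_filter; exact: cF.
Qed.

Lemma derive1_funE (F F' : R -> R) :
  (forall x : R, is_derive x 1 F (F' x)) -> derive1 F = F'.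
Proof. by move=> dF; apply/funext => x; rewrite derive1E derive_val. Qed.

Lemma integral_subst_decr (F F' G : R -> R) (a b : R) : a <= b ->
  {in `[a, b] &, {homo F : x y /~ x < y}} ->
  (forall x : R, is_derive x 1 F (F' x)) -> continuous F' -> continuous G ->
  (\int[mu]_(x in `[F b, F a]) (G x)%:E =
   \int[mu]_(x in `[a, b]) (G (F x) * - F' x)%:E)%E.
Proof.
move=> ab hF dF cF' cG; rewrite (integration_by_substitution_decreasing ab)//.
- by rewrite (derive1_funE dF).
- by rewrite (derive1_funE dF) => x _; exact: cF'.
- rewrite (derive1_funE dF); apply/cvg_ex; exists (F' a).
  by apply: cvg_at_right_filter; exact: cF'.
- rewrite (derive1_funE dF); apply/cvg_ex; exists (F' b).
  by apply: cvg_at_left_filter; exact: cF'.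
- exact: is_derive_LR dF.
- exact: continuous_subspaceT.
Qed.

Lemma integral_subst_incr (F F' G : R -> R) (a b : R) : a <= b ->
  {in `[a, b] &, {homo F : x y / x < y}} ->
  (forall x : R, is_derive x 1 F (F' x)) -> continuous F' -> continuous G ->
  (\int[mu]_(x in `[F a, F b]) (G x)%:E =
   \int[mu]_(x in `[a, b]) (G (F x) * F' x)%:E)%E.
Proof.
move=> ab hF dF cF' cG; rewrite (integration_by_substitution_increasing ab)//.
- by rewrite (derive1_funE dF).
- by rewrite (derive1_funE dF) => x _; exact: cF'.
- rewrite (derive1_funE dF); apply/cvg_ex; exists (F' a).
  by apply: cvg_at_right_filter; exact: cF'.
- rewrite (derive1_funE dF); apply/cvg_ex; exists (F' b).
  by apply: cvg_at_left_filter; exact: cF'.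
- exact: is_derive_LR dF.
- exact: continuous_subspaceT.
Qed.

Lemma integral_shift (f : R -> R) (a b c : R) : a <= b -> continuous f ->
  (\int[mu]_(x in `[(a + c)%R, (b + c)%R]) (f x)%:E =
   \int[mu]_(x in `[a, b]) (f (x + c)%R)%:E)%E.
Proof.
move=> ab cf.
have dF (x : R) : is_derive x 1 (fun x : R => x + c) (cst 1 x).
  by apply: is_derive_eq; rewrite addr0.
rewrite (integral_subst_incr ab _ dF)//.
- by apply: eq_integral => x _; rewrite mulr1.
- by move=> x y _ _ xy; rewrite ltrD2r.
- exact: ctsC.
Qed.

Lemma integral_cat (f : R -> R) (a b c : R) : a <= b -> b <= c -> continuous f ->
  (forall x, 0 <= f x) ->
  (\int[mu]_(x in `[a, c]) (f x)%:E =
   \int[mu]_(x in `[a, b]) (f x)%:E + \int[mu]_(x in `[b, c]) (f x)%:E)%E.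
Proof.
move=> ab bc cf f0.
have mf (D : set R) : measurable_fun D (EFin \o f).
  by apply/measurable_EFinP; apply: measurable_funTS; exact: continuous_measurable_fun.
rewrite (@itv_bndbnd_setU _ _ _ (BRight b)) ?bnd_simp//.
rewrite ge0_integral_setU//=; last 2 first.
- by move=> x _; rewrite lee_fin.
- apply/disj_setPS => x [] /=; rewrite !in_itv /= => /andP[_ xb] /andP[bx _].
  by move: (le_lt_trans xb bx); rewrite ltxx.
- by rewrite integral_itv_obnd_cbnd.
- exact: mf.
Qed.

Lemma integral_periodic (f : R -> R) (c : R) : 0 <= c <= 2 * pi -> continuous f ->
  (forall x, 0 <= f x) -> (forall x, f (x + 2 * pi) = f x) ->
  (\int[mu]_(x in `[0%R, (2 * pi)%R]) (f (x + c)%R)%:E =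
   \int[mu]_(x in `[0%R, (2 * pi)%R]) (f x)%:E)%E.
Proof.
move=> /andP[c0 cpi] cf f0 fp.
have p0 : 0 <= 2 * pi :> R by rewrite mulr_ge0// pi_ge0.
rewrite -integral_shift// add0r.
rewrite (@integral_cat f c (2 * pi)) ?ler_wpDr// [RHS](@integral_cat f 0 c)//.
rewrite addeC; congr (_ + _)%E.
have -> : `[(2 * pi), (2 * pi + c)] = `[(0 + 2 * pi), (c + 2 * pi)] :> interval R.
  by rewrite add0r addrC.
by rewrite integral_shift//; apply: eq_integral => x _; rewrite fp.
Qed.

Lemma integral_reflect (f : R -> R) : continuous f ->
  (\int[mu]_(x in `[pi, (2 * pi)%R]) (f x)%:E =
   \int[mu]_(x in `[0%R, pi]) (f (2 * pi - x)%R)%:E)%E.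
Proof.
move=> cf.
have e1 : 2 * pi - pi = pi :> R by ring.
rewrite -[X in `[X, _]]e1 -[X in `[_, X]]subr0.
have dF (x : R) : is_derive x 1 (fun x : R => 2 * pi - x) (cst (-1) x).
  by apply: is_derive_eq; rewrite add0r mul1r.
rewrite (integral_subst_decr (pi_ge0 R) _ dF)//.
- by apply: eq_integral => x _; rewrite opprK mulr1.
- by move=> x y _ _ xy; rewrite /= ltrD2l ltrN2.
- exact: ctsC.
Qed.

Lemma cos_sin_surj (a b : R) : a ^+ 2 + b ^+ 2 = 1 ->
  exists2 t, 0 <= t <= 2 * pi & a = cos t /\ b = sin t.
Proof.
move=> ab1.
have a1 : -1 <= a <= 1.
  by rewrite -ler_norml -(@ler_pXn2r _ 2)// ?nnegrE// expr1n real_normK ?num_real// -ab1 lerDl sqr_ge0.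
have s2 : sin (acos a) ^+ 2 = b ^+ 2.
  by rewrite sin2cos2 acosK ?in_itv//= -ab1 addrC addKr.
have s0 : 0 <= sin (acos a) by rewrite sin_ge0_pi// acos_ge0//= acos_lepi.
have [b0|b0] := leP 0 b.
  exists (acos a).
    by rewrite acos_ge0//= (le_trans (acos_lepi a1))// ler_peMl ?pi_ge0// ler1n.
  by rewrite acosK ?in_itv//; split=> //; apply/esym/eqP; rewrite -(@eqrXn2 _ 2)// s2.
exists (2 * pi - acos a).
  rewrite subr_ge0 lerBlDr lerDl acos_ge0// andbT.
  by rewrite (le_trans (acos_lepi a1))// ler_peMl ?pi_ge0// ler1n.
have e : 2 * pi - acos a = - acos a + pi *+ 2 by rewrite addrC mulr_natl.
rewrite e cosD2pi sinD2pi cosN sinN acosK ?in_itv//; split=> //.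
apply/eqP; rewrite -eqr_oppLR -(@eqrXn2 _ 2)// ?sqrrN ?s2//.
by rewrite oppr_ge0 ltW.
Qed.

End line.

(** * The hemisphere as a graph *)
Section hemisphere.
Variable R : realType.
Local Notation mu := (@lebesgue_measure R).
Local Notation sigma := (@surface_measure R).
Implicit Types F G H : 'rV[R]_3 -> R.

Definition surf F : \bar R := (\int[sigma]_p (F (coords p))%:E)%E.

(** The integral over the open hemisphere y > 0. *)
Definition hem F : \bar R :=
  (\int[mu \x mu]_(z in `[0%R, pi] `*` `]0%R, pi[)
     ((F (spherical_coords z) * sin z.1)%R)%:E)%E.

(** The hemisphere is the graph of sqrt (1 - x^2 - z^2), over which the area
    element is dx dz / y. Integrating over the whole square instead of the disc
    is harmless for functions that vanish on the plane y = 0: outside the disc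
    the square root is 0. *)
Definition chart G : \bar R :=
  (\int[mu]_(x in `[(-1)%R, 1%R]) \int[mu]_(z in `[(-1)%R, 1%R])
     (G (vec x (Num.sqrt (1 - x ^+ 2 - z ^+ 2)) z))%:E)%E.

Definition reflY (v : 'rV[R]_3) := vec (v 0 0) (- v 0 1) (v 0 2%:R).
Definition swapXZ (v : 'rV[R]_3) := vec (v 0 2%:R) (v 0 1) (v 0 0).

Lemma vec0 (x y z : R) : vec x y z 0 0 = x. Proof. by rewrite mxE. Qed.
Lemma vec1 (x y z : R) : vec x y z 0 1 = y. Proof. by rewrite mxE. Qed.
Lemma vec2 (x y z : R) : vec x y z 0 2%:R = z. Proof. by rewrite mxE. Qed.

Lemma cts_reflY : continuous reflY.
Proof. by apply: cts_vec; [|apply: ctsN|]; apply: cts_coord; exact: cts_id. Qed.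

Lemma cts_swapXZ : continuous swapXZ.
Proof. by apply: cts_vec; apply: cts_coord; exact: cts_id. Qed.

Lemma cts_fst : continuous (fst : R * R -> R).
Proof. by move=> z; exact: cvg_fst. Qed.
Lemma cts_snd : continuous (snd : R * R -> R).
Proof. by move=> z; exact: cvg_snd. Qed.

Lemma cts_pair (T U V : topologicalType) (f : T -> U) (g : T -> V) :
  continuous f -> continuous g -> continuous (fun x => (f x, g x)).
Proof. by move=> cf cg x; apply: cvg_pair; [exact: cf|exact: cg]. Qed.

Lemma cts_spherical_coords : continuous (@spherical_coords R).
Proof.
have s1 := cts_comp cts_fst (@continuous_sin R).
have s2 := cts_comp cts_snd (@continuous_sin R).
have c1 := cts_comp cts_fst (@continuous_cos R).
have c2 := cts_comp cts_snd (@continuous_cos R).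
by apply: cts_vec => //; apply: ctsM.
Qed.

Lemma measurable_hem F : continuous F ->
  measurable_fun setT (fun z => ((F (spherical_coords z) * sin z.1)%R)%:E).
Proof.
move=> cF; apply/measurable_EFinP; apply: continuous_plane_measurable.
apply: ctsM; first exact: (cts_comp cts_spherical_coords cF).
exact: (cts_comp cts_fst (@continuous_sin R)).
Qed.

Lemma sin_ge0_itv (t : R) : t \in `[0, pi] -> 0 <= sin t.
Proof. by rewrite in_itv /=; exact: sin_ge0_pi. Qed.

Lemma surf_hem F : continuous F -> (forall x, 0 <= F x) ->
  surf F = hem (fun x => F x + F (reflY x)).
Proof.
move=> cF F0; rewrite /surf integral_surface_iterated// /hem.
have cFr : continuous (fun x => F x + F (reflY x)).
  by apply: ctsD => //; exact: (cts_comp cts_reflY cF).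
have h0 z : (`[0%R, pi] `*` `]0%R, pi[)%classic z ->
    (0 <= ((F (spherical_coords z) + F (reflY (spherical_coords z))) * sin z.1)%:E)%E.
  by move=> [/sin_ge0_itv z0 _]; rewrite lee_fin mulr_ge0// addr_ge0.
rewrite (tonelli_rect1 (measurable_itv _) (measurable_itv _) (measurable_hem cFr) h0).
apply: eq_integral => t; rewrite inE => /sin_ge0_itv t0.
pose f a := F (vec (sin t * cos a) (sin t * sin a) (cos t)) * sin t.
have cf : continuous f.
  apply: ctsM; last exact: ctsC.
  apply: (@cts_comp _ _ _ (fun a => vec _ _ _)) => //.
  apply: cts_vec; last exact: ctsC.
    by apply: ctsM; [exact: ctsC|exact: continuous_cos].
  by apply: ctsM; [exact: ctsC|exact: continuous_sin].
have f0 a : 0 <= f a by rewrite mulr_ge0.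
have p0 := pi_ge0 R.
rewrite (@integral_cat _ f _ pi)//; last by rewrite ler_peMl// ler1n.
rewrite integral_reflect// -ge0_integralD//=; last 4 first.
- by move=> x _; rewrite lee_fin.
- by apply/measurable_EFinP; apply: measurable_funTS; exact: continuous_measurable_fun.
- by move=> x _; rewrite lee_fin.
- apply/measurable_EFinP; apply: measurable_funTS; apply: continuous_measurable_fun.
  apply: (@cts_comp _ _ _ (fun x => 2 * pi - x)) => //.
  by apply: ctsB; [exact: ctsC|exact: cts_id].
rewrite [LHS]integral_itv_bndoo/=; last first.
  apply/measurable_EFinP; apply: measurable_funTS; apply: continuous_measurable_fun.
  apply: ctsD => //; apply: (@cts_comp _ _ _ (fun x => 2 * pi - x)) => //.
  by apply: ctsB; [exact: ctsC|exact: cts_id].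
apply: eq_integral => a _; rewrite -EFinD /f spherical_coordsE /= /reflY vec0 vec1 vec2.
have e : 2 * pi - a = - a + pi *+ 2 by rewrite addrC mulr_natl.
by rewrite e cosD2pi sinD2pi cosN sinN mulrN mulrDl.
Qed.

Lemma cts_chart G : continuous G ->
  continuous (fun w : R * R => G (vec w.1 (Num.sqrt (1 - w.1 ^+ 2 - w.2 ^+ 2)) w.2)).
Proof.
move=> cG; apply: (@cts_comp _ _ _ (fun w => vec _ _ _) G) => //.
apply: cts_vec; [exact: cts_fst| |exact: cts_snd].
apply: (@cts_comp _ _ _ (fun w : R * R => 1 - w.1 ^+ 2 - w.2 ^+ 2) Num.sqrt).
  by apply: ctsB; [apply: ctsB; [exact: ctsC|]|]; apply: ctsX;
    [exact: cts_fst|exact: cts_snd].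
exact: sqrt_continuous.
Qed.

(** At fixed polar angle [t] the substitution x = sin t cos a flattens the
    slice of the hemisphere onto [-sin t, sin t]; beyond this segment the
    integrand on the right is 0. *)
Lemma chart_slice G (t : R) : continuous G -> (forall x, 0 <= G x) ->
  (forall x z, G (vec x 0 z) = 0) -> t \in `[0, pi] ->
  (\int[mu]_(a in `]0%R, pi[)
     ((sin t * sin a * G (vec (sin t * cos a) (sin t * sin a) (cos t)) * sin t)%R)%:E =
   \int[mu]_(x in `[(-1)%R, 1%R])
     ((G (vec x (Num.sqrt (1 - x ^+ 2 - cos t ^+ 2)) (cos t)) * sin t)%R)%:E)%E.
Proof.
move=> cG G0 Gy t0; have := sin_ge0_itv t0; rewrite le_eqVlt => /predU1P[<-|s0].
  by rewrite !integral0_eq// => x _; rewrite ?mulr0.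
set s := sin t in s0 *; set z := cos t.
have sz : 1 - z ^+ 2 = s ^+ 2 by rewrite /s sin2cos2.
pose g x := G (vec x (Num.sqrt (1 - x ^+ 2 - z ^+ 2)) z) * s.
have cg : continuous g.
  apply: ctsM; last exact: ctsC.
  exact: (cts_comp (cts_pair (@cts_id R) (@ctsC R R z)) (cts_chart cG)).
have dF (x : R) : is_derive x 1 (fun x : R => s * cos x) (- (s * sin x)).
  by apply: is_derive_eq; rewrite -mulrN.
have decrF : {in `[0, pi] &, {homo (fun x : R => s * cos x) : x y /~ x < y}}.
  by move=> x y x0 y0 xy /=; rewrite ltr_pM2l// ltr_cos.
have cF' : continuous (fun x : R => - (s * sin x)).
  by apply: ctsN; apply: ctsM; [exact: ctsC|exact: continuous_sin].
have := integral_subst_decr (pi_ge0 R) decrF dF cF' cg.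
rewrite cospi cos0 mulr1 mulrN1 => e.
transitivity (\int[mu]_(x in `[(- s)%R, s]) (g x)%:E)%E.
  rewrite e [RHS]integral_itv_bndoo/=; last first.
    apply/measurable_EFinP; apply: measurable_funTS; apply: continuous_measurable_fun.
    apply: ctsM; last by apply: ctsN.
    apply: (@cts_comp _ _ _ (fun x => s * cos x) g) => //.
    exact: is_derive_continuous dF.
  apply: eq_integral => a; rewrite inE /= in_itv /= => /andP[a0 api].
  have sa : 0 <= sin a by rewrite sin_ge0_pi// (ltW a0) (ltW api).
  rewrite /g.
  have -> : 1 - (s * cos a) ^+ 2 - z ^+ 2 = (s * sin a) ^+ 2.
    by rewrite !exprMn (sin2cos2 a) -sz; ring.
  rewrite sqrtr_sqr ger0_norm ?mulr_ge0 ?(ltW s0)// opprK; congr (_%:E); ring.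
have s1 : s <= 1 by rewrite sin_le1.
transitivity (\int[mu]_(x in `[(-1)%R, 1%R] `&` `[(- s)%R, s]) (g x)%:E)%E.
  congr (integral _ _ _); apply/seteqP; split => x /=; last by case.
  by rewrite !in_itv /= => /andP[a b]; rewrite a b; split => //; lra.
rewrite integral_mkcondr; apply: eq_integral => x _.
rewrite patchE; case: ifPn => //; rewrite notin_setE /= in_itv /= => xs.
rewrite [X in vec _ X _]ler0_sqrtr ?Gy ?mul0r//.
have -> : 1 - x ^+ 2 - z ^+ 2 = s ^+ 2 - x ^+ 2 by rewrite -sz; ring.
rewrite subr_le0 -[leLHS]ger0_norm ?sqr_ge0// -[leRHS]ger0_norm ?sqr_ge0//.
rewrite !normrX (ger0_norm (ltW s0)) ler_pXn2r ?nnegrE// ?ltW//.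
by rewrite ltNge ler_norml; exact/negP.
Qed.

(** The factor y cancels the singular density 1 / y of the graph; the second
    substitution is z = cos t. *)
Lemma hem_chart G : continuous G -> (forall x, 0 <= G x) ->
  (forall x z, G (vec x 0 z) = 0) ->
  hem (fun v => v 0 1 * G v) = chart G.
Proof.
move=> cG G0 Gy.
have c1 : continuous (fun v : 'rV[R]_3 => v 0 1 * G v).
  by apply: ctsM => //; apply: cts_coord; exact: cts_id.
have k0 z : (`[0%R, pi] `*` `]0%R, pi[)%classic z ->
    (0 <= (spherical_coords z 0 1 * G (spherical_coords z) * sin z.1)%:E)%E.
  move: z => [t a] [/= t0 a0]; rewrite lee_fin spherical_coordsE /= vec1.
  have st := sin_ge0_itv t0; rewrite !mulr_ge0//.
  by apply: sin_ge0_pi; move: a0; rewrite in_itv /= => /andP[/ltW-> /ltW->].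
have mi (i : interval R) : measurable [set` i] by exact: measurable_itv.
rewrite /hem (tonelli_rect1 (mi _) (mi _) (measurable_hem c1) k0).
pose h (w : R * R) := ((G (vec w.2 (Num.sqrt (1 - w.2 ^+ 2 - cos w.1 ^+ 2)) (cos w.1)) * sin w.1)%R)%:E.
have mh : measurable_fun setT h.
  apply/measurable_EFinP; apply: continuous_plane_measurable.
  apply: ctsM; last exact: (cts_comp cts_fst (@continuous_sin R)).
  have cc := cts_comp cts_fst (@continuous_cos R).
  exact: (cts_comp (cts_pair cts_snd cc) (cts_chart cG)).
have h0 z : (`[0, pi] `*` `[-1, 1]) z -> (0 <= h z)%E.
  by move=> [/sin_ge0_itv z0 _]; rewrite lee_fin mulr_ge0.
transitivity (\int[mu]_(t in `[0%R, pi]) \int[mu]_(x in `[(-1)%R, 1%R]) h (t, x))%E.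
  apply: eq_integral => t; rewrite inE => t0.
  by rewrite -chart_slice//; apply: eq_integral => a _; rewrite spherical_coordsE /= vec1.
rewrite -(tonelli_rect1 (mi _) (mi _) mh h0) (tonelli_rect2 (mi _) (mi _) mh h0).
apply: eq_integral => x _.
rewrite /h /=.
have dF (y : R) : is_derive y 1 (@cos R) (- sin y) by exact: is_derive_cos.
have decrF : {in `[0, pi] &, {homo (@cos R) : x y /~ x < y}}.
  by move=> y z y0 z0 yz; rewrite ltr_cos.
have cF' : continuous (fun x : R => - sin x) by apply: ctsN; exact: continuous_sin.
have cg : continuous (fun z : R => G (vec x (Num.sqrt (1 - x ^+ 2 - z ^+ 2)) z)).
  exact: (cts_comp (cts_pair (@ctsC R R x) (@cts_id R)) (cts_chart cG)).
have := integral_subst_decr (pi_ge0 R) decrF dF cF' cg.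
by rewrite cospi cos0 => ->; apply: eq_integral => t _; rewrite opprK.
Qed.

(** In the graph chart x and z play the same part, so exchanging them is
    Tonelli's theorem. *)
Lemma chart_swap G : continuous G -> (forall x, 0 <= G x) ->
  chart (fun v => G (swapXZ v)) = chart G.
Proof.
move=> cG G0.
have mc : measurable_fun setT (fun w : R * R =>
    (G (vec w.1 (Num.sqrt (1 - w.1 ^+ 2 - w.2 ^+ 2)) w.2))%:E).
  by apply/measurable_EFinP; apply: continuous_plane_measurable; exact: cts_chart.
have h0 w : (`[(-1)%R, 1%R] `*` `[(-1)%R, 1%R])%classic w ->
    (0 <= (G (vec w.1 (Num.sqrt (1 - w.1 ^+ 2 - w.2 ^+ 2)) w.2))%:E)%E.
  by rewrite lee_fin.
have mi (i : interval R) : measurable [set` i] by exact: measurable_itv.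
rewrite [RHS]/chart -(tonelli_rect1 (mi _) (mi _) mc h0) (tonelli_rect2 (mi _) (mi _) mc h0).
apply: eq_integral => x _; apply: eq_integral => z _ /=.
by rewrite /swapXZ vec0 vec1 vec2 addrAC.
Qed.

End hemisphere.

Section hemisphere_swap.
Variable R : realType.
Local Notation mu := (@lebesgue_measure R).
Local Notation sigma := (@surface_measure R).
Implicit Types F G H : 'rV[R]_3 -> R.
(** A substitute for 1 / y that is continuous and vanishes at 0, and for which
    y * [cut] n y increases to 1 where y > 0. *)
Definition cut (n : nat) (y : R) : R := n.+1%:R * y / (1 + n.+1%:R * y ^+ 2).

Lemma cut_den (n : nat) (y : R) : 0 < 1 + n.+1%:R * y ^+ 2.
Proof. by rewrite ltr_wpDr// mulr_ge0// sqr_ge0. Qed.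

Lemma cts_cut n : continuous (cut n).
Proof.
apply: ctsM; first by apply: ctsM; [exact: ctsC|exact: cts_id].
move=> y; apply: cvgV; first by rewrite gt_eqF// cut_den.
suff : continuous (fun y : R => 1 + n.+1%:R * y ^+ 2) by exact.
apply: ctsD; first exact: ctsC.
by apply: ctsM; [exact: ctsC|apply: ctsX; exact: cts_id].
Qed.

Lemma mul_cutE n (y : R) : y * cut n y = 1 - (1 + n.+1%:R * y ^+ 2)^-1.
Proof.
rewrite /cut; move: (cut_den n y); move: (n.+1%:R : R) => N d.
by field; rewrite lt0r_neq0.
Qed.

Lemma cut_ge0 n (y : R) : 0 <= y -> 0 <= cut n y.
Proof. by move=> y0; rewrite /cut divr_ge0 ?mulr_ge0// ltW// cut_den. Qed.

Lemma nondecreasing_mul_cut (y : R) m n : (m <= n)%N ->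
  y * cut m y <= y * cut n y.
Proof.
move=> mn; rewrite !mul_cutE lerD2l lerN2 lef_pV2 ?posrE ?cut_den//.
by rewrite lerD2l ler_wpM2r ?sqr_ge0// ler_nat.
Qed.

Lemma cvg_mul_cut (y : R) : 0 < y -> (y * cut n y) @[n --> \oo] --> (1 : R).
Proof.
move=> y0; under eq_fun do rewrite mul_cutE.
suff h : (1 + n.+1%:R * y ^+ 2)^-1 @[n --> \oo] --> (0 : R).
  have : (1 - (1 + n.+1%:R * y ^+ 2)^-1) @[n --> \oo] --> (1 - 0 : R).
    by apply: cvgB => //; exact: cvg_cst.
  by rewrite subr0.
apply: (@squeeze_cvgr _ _ _ _ (cst 0) (fun n => y ^- 2 * harmonic n)).
- near=> n; rewrite invr_ge0 ltW ?cut_den//= /harmonic /=.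
  rewrite -invfM lef_pV2 ?posrE ?cut_den ?mulr_gt0 ?exprn_gt0//.
  by rewrite mulrC lerDr.
- exact: cvg_cst.
- have : (y ^- 2 * harmonic n) @[n --> \oo] --> (y ^- 2 * 0 : R).
    by apply: cvgM; [exact: cvg_cst|exact: cvg_harmonic].
  by rewrite mulr0.
Unshelve. all: by end_near. Qed.

(** Every integrand is an increasing limit of integrands of the form y * G with
    G vanishing on the equator, to which the chart applies. *)
Lemma hem_cut H : continuous H -> (forall x, 0 <= H x) ->
  hem H = limn (fun n => hem (fun v => v 0 1 * (H v * `|cut n (v 0 1)|))).
Proof.
move=> cH H0.
have cHn n : continuous (fun v : 'rV[R]_3 => v 0 1 * (H v * `|cut n (v 0 1)|)).
  have c1 : continuous (fun v : 'rV[R]_3 => v 0 1) by apply: cts_coord; exact: cts_id.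
  apply: ctsM => //; apply: ctsM => //.
  apply: (@cts_comp _ _ _ (fun v : 'rV[R]_3 => cut n (v 0 1)) Num.norm); last exact: norm_continuous.
  exact: (cts_comp c1 (@cts_cut n)).
have D0 z : (`[0, pi] `*` `]0, pi[) z -> 0 <= sin z.1 /\ 0 < sin z.2.
  case=> /sin_ge0_itv z1 /=; rewrite in_itv /= => z2; split => //.
  exact: sin_gt0_pi.
rewrite /hem -monotone_convergence//=.
- apply: eq_integral => z; rewrite inE => /D0[z1 z2].
  apply/esym/cvg_lim => //; apply: cvg_EFin; first exact: nearW.
  rewrite spherical_coordsE vec1; set v := vec _ _ _; set y := sin z.1 * sin z.2.
  rewrite (_ : fine \o _ = (fun n => H v * sin z.1 * (y * `|cut n y|))); last first.
    by apply/funext => n /=; ring.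
  move: z1; rewrite le_eqVlt => /predU1P[<-|z1].
    by rewrite mulr0; under eq_fun do rewrite mul0r; exact: cvg_cst.
  have y0 : 0 < y by rewrite mulr_gt0.
  under eq_fun do rewrite ger0_norm ?cut_ge0 ?(ltW y0)//.
  have : (H v * sin z.1 * (y * cut n y)) @[n --> \oo] --> H v * sin z.1 * 1.
    by apply: cvgM; [exact: cvg_cst|exact: cvg_mul_cut].
  by rewrite mulr1.
- by apply: measurableX; exact: measurable_itv.
- by move=> n; apply: measurable_funTS; exact: (measurable_hem (cHn n)).
- move=> n z /D0[z1 z2]; rewrite lee_fin spherical_coordsE vec1.
  by rewrite !mulr_ge0// ltW.
- move=> z /D0[z1 z2] m n mn; rewrite lee_fin spherical_coordsE vec1.
  set v := vec _ _ _; set y := sin z.1 * sin z.2.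
  have y0 : 0 <= y by rewrite mulr_ge0// ltW.
  rewrite ler_wpM2r// !(mulrCA y) ler_wpM2l//.
  by rewrite !ger0_norm ?cut_ge0// nondecreasing_mul_cut.
Qed.

Lemma hem_swap H : continuous H -> (forall x, 0 <= H x) ->
  hem (fun v => H (swapXZ v)) = hem H.
Proof.
move=> cH H0.
have cHs : continuous (fun v => H (swapXZ v)) := cts_comp (@cts_swapXZ R) cH.
rewrite (hem_cut cHs (fun v => H0 _)) (hem_cut cH H0).
apply: congr_lim; apply/funext => n.
have c1 : continuous (fun v : 'rV[R]_3 => `|cut n (v 0 1)|).
  apply: (@cts_comp _ _ _ (fun v : 'rV[R]_3 => cut n (v 0 1)) Num.norm); last exact: norm_continuous.
  have c1 : continuous (fun v : 'rV[R]_3 => v 0 1) by apply: cts_coord; exact: cts_id.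
  exact: (cts_comp c1 (@cts_cut n)).
have cut0 : cut n 0 = 0 by rewrite /cut mulr0 mul0r.
pose G v := H v * `|cut n (v 0 1)|.
have cG : continuous G by apply: ctsM.
have cGs : continuous (fun v => G (swapXZ v)) := cts_comp (@cts_swapXZ R) cG.
have G0 v : 0 <= G v by rewrite mulr_ge0.
have Gy x z : G (vec x 0 z) = 0 by rewrite /G vec1 cut0 normr0 mulr0.
have Gsy x z : G (swapXZ (vec x 0 z)) = 0 by rewrite /swapXZ vec1 Gy.
transitivity (hem (fun v => v 0 1 * G (swapXZ v))).
  by congr hem; apply/funext => v; rewrite /G /swapXZ vec1.
by rewrite (hem_chart cGs (fun v => G0 _) Gsy) (hem_chart cG G0 Gy) (chart_swap cG G0).
Qed.

End hemisphere_swap.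

(** * Invariance of the surface measure under the orthogonal group *)
Section invariance.
Variable R : realType.
Local Notation mu := (@lebesgue_measure R).
Local Notation sigma := (@surface_measure R).
Implicit Types F : 'rV[R]_3 -> R.

Definition mx3 (u v w : 'rV[R]_3) : 'M[R]_3 := \matrix_(i < 3) [:: u; v; w]`_i.

Lemma mx3_eta (A : 'M[R]_3) : A = mx3 (row 0 A) (row 1 A) (row 2%:R A).
Proof.
apply/row_matrixP => -[[|[|[|//]]] i3]; rewrite rowK /=; congr (row _ _); exact: val_inj.
Qed.

Lemma vecM (a b c : R) u v w :
  vec a b c *m mx3 u v w = a *: u + b *: v + c *: w.
Proof.
apply/rowP => j; rewrite !mxE !big_ord_recl big_ord0 addr0 addrA.
by rewrite !mxE /=.
Qed.

Lemma scale_vec (k a b c : R) : k *: vec a b c = vec (k * a) (k * b) (k * c).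
Proof. by apply/rowP => -[[|[|[|//]]] i3]; rewrite !mxE. Qed.

Lemma add_vec (a b c a' b' c' : R) :
  vec a b c + vec a' b' c' = vec (a + a') (b + b') (c + c').
Proof. by apply/rowP => -[[|[|[|//]]] i3]; rewrite !mxE. Qed.

Lemma mx3M u v w B : mx3 u v w *m B = mx3 (u *m B) (v *m B) (w *m B).
Proof. by apply/row_matrixP => -[[|[|[|//]]] i3]; rewrite row_mul !rowK. Qed.

Lemma mx3_1 : 1%:M = mx3 (vec 1 0 0) (vec 0 1 0) (vec 0 0 1).
Proof.
apply/matrixP => -[[|[|[|//]]] i3] -[[|[|[|//]]] j3]; by rewrite !mxE.
Qed.

Lemma vec_dot (a b c a' b' c' : R) :
  dot (vec a b c) (vec a' b' c') = a * a' + b * b' + c * c'.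
Proof. by rewrite dotE !mxE. Qed.

Lemma mulmx_trP (A : 'M[R]_3) i j : (A *m A^T) i j = dot (row i A) (row j A).
Proof. by rewrite mxE; apply: eq_bigr => k _; rewrite !mxE. Qed.

(** For nonnegative functions the integral is an extended real and needs no
    integrability, which makes these matrices stable under products. *)
Definition surf_inv (A : 'M[R]_3) := forall F, continuous F -> (forall x, 0 <= F x) ->
  surf (fun x => F (x *m A)) = surf F.

Lemma cts_actmx F (A : 'M[R]_3) : continuous F -> continuous (fun x : 'rV[R]_3 => F (x *m A)).
Proof.
move=> cF; apply: (@cts_comp _ _ _ (fun x : 'rV[R]_3 => x *m A) F) => //.
by apply: cts_mulmxr; exact: cts_id.
Qed.

Lemma surf_invM A B : surf_inv A -> surf_inv B -> surf_inv (A *m B).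
Proof.
move=> iA iB F cF F0; under [X in surf X]eq_fun do rewrite mulmxA.
rewrite (iA (fun x => F (x *m B)))// ?iB//.
exact: cts_actmx.
Qed.

Lemma surf_inv_inv A B : surf_inv A -> A *m B = 1%:M -> surf_inv B.
Proof.
move=> iA AB F cF F0; rewrite -(iA (fun x => F (x *m B)))//.
  by congr surf; apply/funext => x; rewrite -mulmxA AB mulmx1.
exact: cts_actmx.
Qed.

Definition rotZ (c s : R) := mx3 (vec c s 0) (vec (- s) c 0) (vec 0 0 1).
Definition swpXZ := mx3 (vec 0 0 1) (vec 0 1 0) (vec 1 0 0).
Definition rflY := mx3 (vec 1 0 0) (vec 0 (-1) 0) (vec 0 0 1).

Lemma mul_swpXZ (x : 'rV[R]_3) : x *m swpXZ = vec (x 0 2%:R) (x 0 1) (x 0 0).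
Proof. by rewrite [in LHS](vec_eta x) vecM !scale_vec !add_vec; congr vec; ring. Qed.

(** A rotation about the z-axis translates the azimuth, over a full period. *)
Lemma surf_inv_rotZ (c s : R) : c ^+ 2 + s ^+ 2 = 1 -> surf_inv (rotZ c s).
Proof.
move=> /cos_sin_surj[t t0 [-> ->]] F cF F0.
have cFt : continuous (fun x : 'rV[R]_3 => F (x *m rotZ (cos t) (sin t))).
  exact: cts_actmx.
rewrite /surf (integral_surface_iterated cFt (fun x => F0 _)).
rewrite (integral_surface_iterated cF F0); apply: eq_integral => a.
rewrite inE => /sin_ge0_itv a0.
pose f b := F (vec (sin a * cos b) (sin a * sin b) (cos a)) * sin a.
have cf : continuous f.
  apply: ctsM; last exact: ctsC.
  apply: (@cts_comp _ _ _ (fun a => vec _ _ _)) => //.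
  apply: cts_vec; last exact: ctsC.
    by apply: ctsM; [exact: ctsC|exact: continuous_cos].
  by apply: ctsM; [exact: ctsC|exact: continuous_sin].
rewrite -[RHS](@integral_periodic _ f t)//.
- apply: eq_integral => b _; rewrite /f vecM !scale_vec !add_vec cosD sinD.
  by congr ((F (vec _ _ _) * _)%:E); ring.
- by move=> b; rewrite mulr_ge0.
- by move=> b; rewrite /f mulr_natl sinD2pi cosD2pi.
Qed.

Lemma surf_inv_rflY : surf_inv rflY.
Proof.
move=> F cF F0.
have e x : x *m rflY = reflY x.
  rewrite [in LHS](vec_eta x) vecM !scale_vec !add_vec /reflY.
  by congr vec; ring.
have cFt : continuous (fun x : 'rV[R]_3 => F (x *m rflY)).
  exact: cts_actmx.
rewrite (surf_hem cFt (fun x => F0 _)) (surf_hem cF F0); congr hem; apply/funext => x.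
by rewrite !e addrC; congr (F _ + F _); rewrite /reflY !vec0 !vec1 !vec2 opprK -vec_eta.
Qed.

Lemma surf_inv_swpXZ : surf_inv swpXZ.
Proof.
move=> F cF F0.
have cFt : continuous (fun x : 'rV[R]_3 => F (x *m swpXZ)).
  exact: cts_actmx.
have cFr : continuous (fun x => F x + F (reflY x)).
  by apply: ctsD => //; exact: (cts_comp (@cts_reflY R) cF).
rewrite (surf_hem cFt (fun x => F0 _)) (surf_hem cF F0) -[RHS]hem_swap//; last by move=> x; rewrite addr_ge0.
congr hem; apply/funext => x; rewrite !mul_swpXZ; congr (F _ + F _).
by rewrite /swapXZ /reflY !vec0 !vec1 !vec2.
Qed.

Definition swpXY := mx3 (vec 0 1 0) (vec 1 0 0) (vec 0 0 1).
Definition swpYZ := mx3 (vec 1 0 0) (vec 0 0 1) (vec 0 1 0).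

Lemma mul_swpXY (x : 'rV[R]_3) : x *m swpXY = vec (x 0 1) (x 0 0) (x 0 2%:R).
Proof. by rewrite [in LHS](vec_eta x) vecM !scale_vec !add_vec; congr vec; ring. Qed.

Lemma mul_swpYZ (x : 'rV[R]_3) : x *m swpYZ = vec (x 0 0) (x 0 2%:R) (x 0 1).
Proof. by rewrite [in LHS](vec_eta x) vecM !scale_vec !add_vec; congr vec; ring. Qed.

Lemma surf_inv_swpXY : surf_inv swpXY.
Proof.
have -> : swpXY = rflY *m rotZ 0 1.
  by rewrite mx3M !vecM !scale_vec !add_vec; congr (mx3 (vec _ _ _) (vec _ _ _) (vec _ _ _)); ring.
apply: surf_invM; first exact: surf_inv_rflY.
by apply: surf_inv_rotZ; rewrite expr0n expr1n add0r.
Qed.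

Lemma surf_inv_swpYZ : surf_inv swpYZ.
Proof.
have -> : swpYZ = swpXY *m (swpXZ *m swpXY).
  rewrite mulmxA; rewrite !mx3M !vecM !scale_vec !add_vec !vecM !scale_vec !add_vec.
  by congr (mx3 (vec _ _ _) (vec _ _ _) (vec _ _ _)); ring.
do 2 (apply: surf_invM; first by [exact: surf_inv_swpXY|exact: surf_inv_swpXZ]).
exact: surf_inv_swpXY.
Qed.

Definition orthogonal_mx (A : 'M[R]_3) := A *m A^T = 1%:M.

Lemma orthogonal_mxM A B : orthogonal_mx A -> orthogonal_mx B -> orthogonal_mx (A *m B).
Proof.
by move=> oA oB; rewrite /orthogonal_mx trmx_mul -mulmxA (mulmxA B) oB mul1mx.
Qed.

Lemma orthogonal_mx3 u v w : dot u u = 1 -> dot v v = 1 -> dot w w = 1 ->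
  dot u v = 0 -> dot u w = 0 -> dot v w = 0 -> orthogonal_mx (mx3 u v w).
Proof.
have dC (x y : 'rV[R]_3) : dot x y = dot y x by apply: eq_bigr => i _; rewrite mulrC.
move=> uu vv ww uv uw vw; apply/matrixP => i j; rewrite mulmx_trP !rowK mxE.
by case: i => -[|[|[|//]]] i3; case: j => -[|[|[|//]]] j3 //=; rewrite dC.
Qed.

Definition rotY c s := swpYZ *m (rotZ c s *m swpYZ).
Definition rotX c s := swpXZ *m (rotZ c s *m swpXZ).

Lemma vec_rotZ a b z c s : vec a b z *m rotZ c s = vec (a * c - b * s) (a * s + b * c) z.
Proof. by rewrite vecM !scale_vec !add_vec; congr vec; ring. Qed.

Lemma vec_rotY a b z c s : vec a b z *m rotY c s = vec (a * c - z * s) b (a * s + z * c).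
Proof. by rewrite /rotY !mulmxA; do 3 (rewrite vecM !scale_vec !add_vec); congr vec; ring. Qed.

Lemma vec_rotX a b z c s : vec a b z *m rotX c s = vec a (z * s + b * c) (z * c - b * s).
Proof. by rewrite /rotX !mulmxA; do 3 (rewrite vecM !scale_vec !add_vec); congr vec; ring. Qed.

Lemma orthogonal_rotZ c s : c ^+ 2 + s ^+ 2 = 1 -> orthogonal_mx (rotZ c s).
Proof.
move=> cs; apply: orthogonal_mx3; rewrite vec_dot; first [by rewrite -cs; ring|by ring].
Qed.

Lemma orthogonal_swp : [/\ orthogonal_mx swpYZ, orthogonal_mx swpXZ & orthogonal_mx swpXY].
Proof. by split; apply: orthogonal_mx3; rewrite vec_dot; ring. Qed.

Lemma rotY_inv_orthogonal c s : c ^+ 2 + s ^+ 2 = 1 -> surf_inv (rotY c s) /\ orthogonal_mx (rotY c s).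
Proof.
move=> cs; have [? ? ?] := orthogonal_swp; split.
  do 2 (apply: surf_invM; first by [exact: surf_inv_swpYZ|exact: surf_inv_rotZ]).
  exact: surf_inv_swpYZ.
by do 2 (apply: orthogonal_mxM => //); exact: orthogonal_rotZ.
Qed.

Lemma rotX_inv_orthogonal c s : c ^+ 2 + s ^+ 2 = 1 -> surf_inv (rotX c s) /\ orthogonal_mx (rotX c s).
Proof.
move=> cs; have [? ? ?] := orthogonal_swp; split.
  do 2 (apply: surf_invM; first by [exact: surf_inv_swpXZ|exact: surf_inv_rotZ]).
  exact: surf_inv_swpXZ.
by do 2 (apply: orthogonal_mxM => //); exact: orthogonal_rotZ.
Qed.

Lemma givens (a b : R) : exists c s, c ^+ 2 + s ^+ 2 = 1 /\
  a * c - b * s = Num.sqrt (a ^+ 2 + b ^+ 2) /\ a * s + b * c = 0.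
Proof.
have n0 : 0 <= a ^+ 2 + b ^+ 2 by rewrite addr_ge0// sqr_ge0.
have [r0|r0] := eqVneq (a ^+ 2 + b ^+ 2) 0.
  exists 1, 0; rewrite r0 sqrtr0 expr1n expr0n addr0 !mulr0 !mulr1 subr0 add0r.
  by move/eqP: r0; rewrite paddr_eq0 ?sqr_ge0// !sqrf_eq0 => /andP[/eqP-> /eqP->].
have rr : Num.sqrt (a ^+ 2 + b ^+ 2) ^+ 2 = a ^+ 2 + b ^+ 2 by rewrite sqr_sqrtr.
set r := Num.sqrt _ in rr *.
have rn0 : r != 0 by rewrite -sqrf_eq0 rr.
exists (a / r), (- b / r); split; [|split].
- by apply: (mulIf (x := r ^+ 2)); rewrite ?expf_neq0// mul1r {2}rr; field.
- by apply: (mulIf rn0); rewrite -expr2 rr; field.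
- by field.
Qed.

(** Two plane rotations suffice: about z to cancel y, then about y to cancel z. *)
Lemma to_pole (u : 'rV[R]_3) : dot u u = 1 ->
  exists B, [/\ surf_inv B, orthogonal_mx B & u *m B = vec 1 0 0].
Proof.
rewrite (vec_eta u) vec_dot; move: (u 0 0) (u 0 1) (u 0 2%:R) => a b z abz.
have [c [s [cs [e1 e2]]]] := givens a b.
set r := Num.sqrt _ in e1.
have rz : r ^+ 2 + z ^+ 2 = 1 by rewrite sqr_sqrtr ?addr_ge0 ?sqr_ge0// -abz; ring.
have rz' : r ^+ 2 + (- z) ^+ 2 = 1 by rewrite sqrrN.
have [i1 o1] := rotY_inv_orthogonal rz'.
exists (rotZ c s *m rotY r (- z)); split.
- by apply: surf_invM => //; exact: surf_inv_rotZ.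
- by apply: orthogonal_mxM => //; exact: orthogonal_rotZ.
- by rewrite mulmxA vec_rotZ e1 e2 vec_rotY; congr vec; rewrite -?rz; ring.
Qed.

Lemma orthogonal_dot A u v : orthogonal_mx A -> dot (u *m A) (v *m A) = dot u v.
Proof. by move=> oA; rewrite !dot_mulmx trmx_mul mulmxA -(mulmxA u) oA mulmx1. Qed.

Lemma surf_inv_cancel A B : surf_inv B -> orthogonal_mx B ->
  surf_inv (A *m B) -> surf_inv A.
Proof.
move=> iB oB iAB; rewrite -[A]mulmx1 -oB mulmxA.
by apply: surf_invM => //; exact: surf_inv_inv iB oB.
Qed.

Lemma row_dot A i j : orthogonal_mx A -> dot (row i A) (row j A) = (i == j)%:R.
Proof. by move=> oA; rewrite -mulmx_trP oA mxE. Qed.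

Lemma surf_inv_sign (e : R) : e ^+ 2 = 1 ->
  surf_inv (mx3 (vec 1 0 0) (vec 0 1 0) (vec 0 0 e)).
Proof.
move/eqP; rewrite sqrf_eq1 => /orP[]/eqP->.
  by rewrite -mx3_1 => F cF F0; congr surf; apply/funext => x; rewrite mulmx1.
rewrite (_ : mx3 _ _ _ = swpYZ *m (rflY *m swpYZ)).
  do 2 (apply: surf_invM; first by [exact: surf_inv_swpYZ|exact: surf_inv_rflY]).
  exact: surf_inv_swpYZ.
rewrite mulmxA; rewrite !mx3M !vecM !scale_vec !add_vec !vecM !scale_vec !add_vec.
by congr (mx3 (vec _ _ _) (vec _ _ _) (vec _ _ _)); ring.
Qed.

(** The rotations about the axes and the reflections in the coordinate planes
    preserve the measure, and they generate the orthogonal group: moving the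
    first row of [A] to the pole leaves an orthogonal 2 x 2 block, which a
    rotation about x reduces to a sign. *)
Lemma orthogonal_surf_inv A : orthogonal_mx A -> surf_inv A.
Proof.
move=> oA; have [B [iB oB AB]] := to_pole (row_dot 0 0 oA).
apply: (surf_inv_cancel iB oB).
have := orthogonal_mxM oA oB; set C := A *m B => oC.
have C0 : row 0 C = vec 1 0 0 by rewrite row_mul.
have := row_dot 0 1 oC; have := row_dot 0 2%:R oC.
have := row_dot 1 1 oC; have := row_dot 1 2%:R oC; have := row_dot 2%:R 2%:R oC.
rewrite (mx3_eta C) C0 !rowK /=.
rewrite (vec_eta (row 1 C)) (vec_eta (row 2%:R C)) !vec_dot.
move: (row 1 C 0 0) (row 1 C 0 1) (row 1 C 0 2%:R) => v p q.
move: (row 2%:R C 0 0) (row 2%:R C 0 1) (row 2%:R C 0 2%:R) => w r s.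
rewrite !mul1r !mul0r !addr0 => ww vw vv w0 v0.
move: vv vw ww; rewrite v0 !mul0r !add0r => vv vw ww.
have {}vv : p * p + q * q = 1 := vv.
have {}ww : r * r + s * s = 1.
  have {}w0 : w = 0 := w0.
  by have : w * w + r * r + s * s = 1 := ww; rewrite w0 mul0r add0r.
have {}vw : p * r + q * s = 0 := vw.
have [iX oX] := rotX_inv_orthogonal (etrans (congr2 +%R (expr2 p) (expr2 q)) vv).
apply: (surf_inv_cancel iX oX).
rewrite !mx3M !vec_rotX !mul0r !addr0 !subr0.
rewrite [q * q + p * p]addrC vv (mulrC q p) subrr.
have -> : s * q + r * p = 0 by rewrite -vw; ring.
rewrite w0; apply: surf_inv_sign.
have -> : (s * p - r * q) ^+ 2 =
  (r * r + s * s) * (p * p + q * q) - (p * r + q * s) ^+ 2 by ring.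
by rewrite vv vw ww; ring.
Qed.

End invariance.

(** * Means over the sphere *)
Section mean.
Variable R : realType.
Local Notation mu := (@lebesgue_measure R).
Local Notation sigma := (@surface_measure R).
Implicit Types F G : 'rV[R]_3 -> R.

Definition on_sphere (x : 'rV[R]_3) := dot x x = 1.

Lemma coords_on_sphere (p : S2 R) : on_sphere (coords p).
Proof. by have := set_valP p. Qed.

Definition sphere_point (x : 'rV[R]_3) (sx : on_sphere x) : S2 R := exist _ x (mem_set sx).

Lemma coords_sphere_point x (sx : on_sphere x) : coords (sphere_point sx) = x.
Proof. by []. Qed.

Lemma compact_sphere : compact on_sphere.
Proof.
apply: bounded_closed_compact.
  exists 1; split; first exact: num_real.
  move=> M M1 x /= sx; apply: le_trans (ltW M1).
  rewrite [`|x|]mx_normrE; apply/bigmax_leP; split => // -[i j] _ /=.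
  rewrite ord1 -(@ler_pXn2r _ 2)// ?nnegrE// expr1n real_normK ?num_real//.
  have : \sum_(i < 3) x 0 i * x 0 i = 1 := sx.
  rewrite (bigD1 j)//= => <-; rewrite expr2 lerDl.
  by apply: sumr_ge0 => k _; rewrite -expr2 sqr_ge0.
have cd : continuous (fun x : 'rV[R]_3 => dot x x).
  by apply: cts_dot; exact: cts_id.
have -> : on_sphere = (fun x : 'rV[R]_3 => dot x x) @^-1` [set 1].
  by [].
by apply: preimage_closed => //; exact: closed_eq.
Qed.

Lemma cts_sphere_bounded F : continuous F ->
  exists M, 0 < M /\ forall x, on_sphere x -> `|F x| <= M.
Proof.
move=> cF.
have : compact (F @` on_sphere).
  by apply: continuous_compact; [exact: continuous_subspaceT|exact: compact_sphere].
move=> /compact_bounded[M [_ bM]]; exists (`|M| + 1); split; first by rewrite ltr_wpDl.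
by move=> x sx; apply: bM; [rewrite (le_lt_trans (ler_norm _))// ltrDl|exists x].
Qed.

(** Under the substitution z = cos t the integral of a function of z becomes an
    elementary one; the antiderivative [H] is passed in so that each moment
    only has to supply it. *)
Lemma surface_zonal (f g H : R -> R) : continuous f -> (forall t, 0 <= f t) ->
  continuous g -> (forall t : R, is_derive t 1 H (g t)) ->
  (forall t, t \in `[0, pi] -> f (cos t) * sin t = g t) ->
  surf (fun x => f (x 0 2%:R)) = (2 * pi * (H pi - H 0))%:E.
Proof.
move=> cf f0 cg dH fg.
have c2 : continuous (fun x : 'rV[R]_3 => f (x 0 2%:R)).
  by apply: (@cts_comp _ _ _ (fun x : 'rV[R]_3 => x 0 2%:R) f) => //;
    apply: cts_coord; exact: cts_id.
rewrite /surf (integral_surface_iterated c2)//.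
have pi0 := pi_gt0 R.
transitivity (\int[mu]_(t in `[0%R, pi]) ((2 * pi)%:E * (g t)%:E))%E.
  apply: eq_integral => t; rewrite inE => /fg <-.
  under eq_integral => a _ do rewrite vec2.
  rewrite integral_cst//= lebesgue_measure_itv/= lte_fin mulr_gt0//.
  by rewrite sube0 muleC.
rewrite integralZl//; last first.
  apply: continuous_compact_integrable; first exact: segment_compact.
  exact: continuous_subspaceT.
rewrite (continuous_FTC2 pi0 (continuous_subspaceT cg) (is_derive_LR _ _ dH)).
  by rewrite -EFinD -EFinM.
by move=> t _; rewrite (derive1_funE dH).
Qed.

Lemma surface_measureT : sigma setT = (4 * pi)%:E.
Proof.
have dH (t : R) : is_derive t 1 (fun t => - cos t) (sin t).
  by apply: is_derive_eq; rewrite opprK.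
have e : (\int[sigma]_(_ in setT) 1%:E = sigma setT)%E.
  by rewrite integral_cst// mul1e.
have := @surface_zonal (cst 1) _ _ (@ctsC R R 1) (fun=> ler01) (@continuous_sin R) dH.
rewrite /surf -e => -> //.
- by rewrite cospi cos0; congr (_%:E); ring.
- by move=> t _; rewrite mul1r.
Qed.

Lemma bounded_integrable (f : S2 R -> R) (M : R) : measurable_fun setT f ->
  (forall p, `|f p| <= M) -> sigma.-integrable setT (EFin \o f).
Proof.
move=> mf fM; apply: measurable_bounded_integrable => //.
  by have := surface_measureT; rewrite /= => ->; rewrite ltry.
exists M; split; first exact: num_real.
by move=> x Mx p _ /=; rewrite (le_trans (fM p))// ltW.
Qed.

Lemma cts_integrable F : continuous F ->
  sigma.-integrable setT (EFin \o (F \o @coords R)).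
Proof.
move=> cF; have [M [_ FM]] := cts_sphere_bounded cF.
apply: (@bounded_integrable _ M); first exact: measurable_coords_comp.
by move=> p; apply: FM; exact: coords_on_sphere.
Qed.

Definition E F : R := (4 * pi)^-1 * \int[sigma]_p F (coords p).

Let pi4 : 0 < 4 * pi :> R. Proof. by rewrite mulr_gt0 ?pi_gt0. Qed.

Lemma eq_E F G : (forall x, on_sphere x -> F x = G x) -> E F = E G.
Proof.
move=> FG; congr (_ * _); apply: eq_Rintegral => p _; exact/FG/coords_on_sphere.
Qed.

Lemma E_cst (c : R) : E (fun=> c) = c.
Proof.
rewrite /E Rintegral_cst//= [sigma setT]surface_measureT /= mulrCA mulVf ?mulr1//.
by rewrite gt_eqF.
Qed.

Lemma ED F G : continuous F -> continuous G -> E (fun x => F x + G x) = E F + E G.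
Proof.
by move=> cF cG; rewrite /E RintegralD ?mulrDr//; exact: cts_integrable.
Qed.

Lemma EZ (c : R) F : continuous F -> E (fun x => c * F x) = c * E F.
Proof.
by move=> cF; rewrite /E RintegralZl// 1?mulrCA//; exact: cts_integrable.
Qed.

Lemma EN F : continuous F -> E (fun x => - F x) = - E F.
Proof.
move=> cF; rewrite -mulN1r -EZ//; apply: eq_E => x _; by rewrite mulN1r.
Qed.

Lemma EB F G : continuous F -> continuous G -> E (fun x => F x - G x) = E F - E G.
Proof. by move=> cF cG; rewrite ED ?EN//; exact: ctsN. Qed.

Lemma E_le F G : continuous F -> continuous G ->
  (forall x, on_sphere x -> F x <= G x) -> E F <= E G.
Proof.
move=> cF cG FG; rewrite /E ler_pM2l ?invr_gt0//.
apply: le_Rintegral => //; [exact: cts_integrable|exact: cts_integrable|].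
by move=> p _; apply: FG; exact: coords_on_sphere.
Qed.

Lemma E_abs F : continuous F -> `|E F| <= E (fun x => `|F x|).
Proof.
move=> cF; have cnF : continuous (fun x => `|F x|).
  exact: (cts_comp cF (@norm_continuous _ R)).
rewrite ler_norml; apply/andP; split.
  rewrite -EN//; apply: E_le => //; first exact: ctsN.
  by move=> x _; rewrite lerNl -normrN ler_norm.
by apply: E_le => // x _; exact: ler_norm.
Qed.

Lemma E_bound F (c : R) : continuous F -> (forall x, on_sphere x -> `|F x| <= c) ->
  `|E F| <= c.
Proof.
move=> cF Fc; apply: (le_trans (E_abs cF)); rewrite -[leRHS]E_cst.
by apply: E_le => //; [exact: (cts_comp cF (@norm_continuous _ R))|exact: ctsC].
Qed.

Lemma surf_E F : continuous F -> (forall x, 0 <= F x) -> surf F = (4 * pi * E F)%:E.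
Proof.
move=> cF F0; rewrite /E mulrA mulfV ?gt_eqF// mul1r /surf fineK//.
by apply: integrable_fin_num => //; exact: cts_integrable.
Qed.

(** From nonnegative to arbitrary continuous functions, by positive and negative
    parts. *)
Lemma E_rot F A : orthogonal_mx A -> continuous F -> E (fun x => F (x *m A)) = E F.
Proof.
move=> oA cF.
suff H (G : 'rV[R]_3 -> R) : continuous G -> (forall x, 0 <= G x) ->
    E (fun x => G (x *m A)) = E G.
  pose P (G : 'rV[R]_3 -> R) x := 2^-1 * (`|G x| + G x).
  have cp (G : 'rV[R]_3 -> R) : continuous G -> continuous (P G).
    move=> cG; apply: ctsM; first exact: ctsC.
    by apply: ctsD => //; exact: (cts_comp cG (@norm_continuous _ R)).
  have P0 (G : 'rV[R]_3 -> R) x : 0 <= P G x.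
    by rewrite mulr_ge0// -lerBlDr sub0r -normrN ler_norm.
  have FE : F = fun x => P F x - P (fun x => - F x) x.
    by apply: funext => x; rewrite /P normrN; field.
  have c1 := cp _ cF; have c2 := cp _ (ctsN cF).
  rewrite FE EB; try exact: cts_actmx.
  by rewrite EB// (H _ c1 (P0 _)) (H _ c2 (P0 _)).
move=> cG G0; have := orthogonal_surf_inv oA cG G0.
rewrite !surf_E//; first by case=> /(mulfI (lt0r_neq0 pi4)).
exact: cts_actmx.
Qed.

Lemma E_zonal (f g H : R -> R) : continuous f -> (forall t, 0 <= f t) ->
  continuous g -> (forall t : R, is_derive t 1 H (g t)) ->
  (forall t, t \in `[0, pi] -> f (cos t) * sin t = g t) ->
  E (fun x => f (x 0 2%:R)) = (H pi - H 0) / 2.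
Proof.
move=> cf f0 cg dH fg; have := surface_zonal cf f0 cg dH fg.
rewrite surf_E//; last first.
  by apply: (@cts_comp _ _ _ (fun x : 'rV[R]_3 => x 0 2%:R) f) => //;
    apply: cts_coord; exact: cts_id.
case=> e; apply: (mulfI (lt0r_neq0 pi4)); rewrite e; by field.
Qed.

End mean.

(** * A lower bound for pi *)
Section pi_bound.
Variable R : realType.

Lemma derive_ge0 (f g : R -> R) : (forall x : R, is_derive x 1 f (g x)) ->
  f 0 = 0 -> (forall x, 0 <= x -> 0 <= g x) -> forall x, 0 <= x -> 0 <= f x.
Proof.
move=> df f0 g0 x; rewrite le_eqVlt => /predU1P[<-|x0]; first by rewrite f0.
have cf : {within `[0, x], continuous f}.
  exact: (continuous_subspaceT (is_derive_continuous df)).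
have [c] := MVT x0 (fun y _ => df y) cf.
rewrite in_itv /= => /andP[c0 _]; rewrite f0 !subr0 => ->.
by rewrite mulr_ge0 ?g0// ltW.
Qed.

(** Integrating cos <= 1 five times from 0. *)
Lemma sin_le5 (x : R) : 0 <= x -> sin x <= x - x ^+ 3 / 6 + x ^+ 5 / 120.
Proof.
have s1 : forall x : R, 0 <= x -> 0 <= x - sin x.
  have d (y : R) : is_derive y 1 (fun x => x - sin x) (1 - cos y).
    by apply: is_derive_eq.
  apply: (derive_ge0 d); first by rewrite sin0 subr0.
  by move=> y _; rewrite subr_ge0 cos_le1.
have c2 : forall x : R, 0 <= x -> 0 <= cos x - 1 + 2^-1 * x ^+ 2.
  have d (y : R) : is_derive y 1 (fun x => cos x - 1 + 2^-1 * x ^+ 2) (y - sin y).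
    by apply: is_derive_eq; rewrite /GRing.scale /=; field.
  by apply: (derive_ge0 d) => //; rewrite cos0 expr0n mulr0 subrr addr0.
have s3 : forall x : R, 0 <= x -> 0 <= sin x - x + 6^-1 * x ^+ 3.
  have d (y : R) : is_derive y 1 (fun x => sin x - x + 6^-1 * x ^+ 3)
      (cos y - 1 + 2^-1 * y ^+ 2).
    by apply: is_derive_eq; rewrite /GRing.scale /=; field.
  by apply: (derive_ge0 d) => //; rewrite sin0 expr0n mulr0 subrr addr0.
have c4 : forall x : R, 0 <= x -> 0 <= 1 - 2^-1 * x ^+ 2 + 24^-1 * x ^+ 4 - cos x.
  have d (y : R) : is_derive y 1 (fun x => 1 - 2^-1 * x ^+ 2 + 24^-1 * x ^+ 4 - cos x)
      (sin y - y + 6^-1 * y ^+ 3).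
    by apply: is_derive_eq; rewrite /GRing.scale /=; field.
  by apply: (derive_ge0 d) => //; rewrite cos0 !expr0n /=; ring.
have s5 : forall x : R, 0 <= x -> 0 <= x - 6^-1 * x ^+ 3 + 120^-1 * x ^+ 5 - sin x.
  have d (y : R) : is_derive y 1 (fun x => x - 6^-1 * x ^+ 3 + 120^-1 * x ^+ 5 - sin x)
      (1 - 2^-1 * y ^+ 2 + 24^-1 * y ^+ 4 - cos y).
    by apply: is_derive_eq; rewrite /GRing.scale /=; field.
  by apply: (derive_ge0 d) => //; rewrite sin0 !expr0n /=; ring.
by move=> x0; have := s5 _ x0; rewrite subr_ge0 (mulrC 6^-1) (mulrC 120^-1).
Qed.

Lemma sin_pi6 : sin (pi / 6) = 2^-1 :> R.
Proof.
have p0 := pi_gt0 R.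
have s0 : 0 <= sin (pi / 6) :> R.
  by apply: sin_ge0_pi; apply/andP; split; lra.
have := @sin_pihalf R.
have -> : pi / 2 = pi / 6 + (pi / 6 + pi / 6) :> R by field.
rewrite sinD cosD sinD.
have := cos2Dsin2 (pi / 6 : R); move: (cos _) (sin _) s0 => c s s0 cs e.
have : (s + 1) * (2 * s - 1) ^+ 2 = 0.
  have -> : (s + 1) * (2 * s - 1) ^+ 2 = 1 - (s * (c * c - s * s) + c * (s * c + c * s))
     + 3 * s * (c ^+ 2 + s ^+ 2 - 1) by ring.
  by rewrite cs e; ring.
move/eqP; rewrite mulf_eq0 sqrf_eq0 => /orP[]/eqP; lra.
Qed.

(** Compare sin (pi / 6) = 1 / 2 with the quintic bound at 157 / 300, where the
    quintic is still below 1 / 2. *)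
Lemma pi_gt314 : 314 / 100 < pi :> R.
Proof.
rewrite ltNge; apply/negP => ple.
have p0 := pi_gt0 R.
have x0 : 0 <= pi / 6 :> R by lra.
have := sin_le5 x0; rewrite sin_pi6.
have x1 : pi / 6 <= 157 / 300 :> R by lra.
move: (pi / 6) x0 x1 => x x0 x1.
(* The quintic increases on [0, 157 / 300]. *)
suff : x - x ^+ 3 / 6 + x ^+ 5 / 120 <= 157 / 300 - (157 / 300) ^+ 3 / 6 + (157 / 300) ^+ 5 / 120 by lra.
have x5 : x ^+ 5 <= (157 / 300) ^+ 5 by rewrite lerXn2r ?nnegrE; lra.
have x2 : x ^+ 2 <= 1 by rewrite -(expr1n _ 2) lerXn2r ?nnegrE//; lra.
have : 0 <= (157 / 300 - x) * (1 - ((157 / 300) ^+ 2 + 157 / 300 * x + x ^+ 2) / 6).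
  by rewrite mulr_ge0; lra.
have -> : (157 / 300 - x) * (1 - ((157 / 300) ^+ 2 + 157 / 300 * x + x ^+ 2) / 6) =
   (157 / 300 - x) - ((157 / 300) ^+ 3 - x ^+ 3) / 6 by field.
by move: x5; lra.
Qed.
End pi_bound.

(** * Moments and the splitting of the kernel *)
Section moments.
Variable R : realType.
Implicit Types F G : 'rV[R]_3 -> R.

Lemma cts_crd i : continuous (fun x : 'rV[R]_3 => x 0 i).
Proof. by apply: cts_coord; exact: cts_id. Qed.

Ltac cts := lazymatch goal with
  | |- forall x, continuous_at x (fun y => @Algebra.add _ (@?f y) (@Algebra.opp _ (@?g y))) => apply: ctsB; cts
  | |- forall x, continuous_at x (fun y => @Algebra.add _ (@?f y) (@?g y)) => apply: ctsD; cts
  | |- forall x, continuous_at x (fun y => @Algebra.opp _ (@?f y)) => apply: ctsN; cts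
  | |- forall x, continuous_at x (fun y => @GRing.mul _ (@?f y) (@?g y)) => apply: ctsM; cts
  | |- forall x, continuous_at x (fun y => @GRing.exp _ (@?f y) ?n) => apply: ctsX; cts
  | |- forall x, continuous_at x (fun y => fun_of_matrix y _ _) => exact: cts_crd
  | |- forall x, continuous_at x (fun y => y) => exact: cts_id
  | |- forall x, continuous_at x (fun y => ?c) => first [exact: ctsC | exact: cts_id | assumption]
  | |- _ => try assumption
  end.

Lemma E_zonal_pow n : E (fun x : 'rV[R]_3 => x 0 2%:R ^+ (2 * n)) = (2 * n).+1%:R^-1.
Proof.
have dc (t : R) : is_derive t 1 (@cos R ^+ (2 * n).+1)
    (((2 * n).+1%:R * cos t ^+ (2 * n)) * - sin t).
  by apply: is_derive_eq.
have dH (t : R) : is_derive t 1 (fun t => - (2 * n).+1%:R^-1 * (@cos R ^+ (2 * n).+1) t)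
    (cos t ^+ (2 * n) * sin t).
  have := dc t => ?; apply: is_derive_eq; rewrite /GRing.scale /=.
  by rewrite !mulrN mulNr opprK !mulrA mulVf// mul1r.
rewrite (@E_zonal _ (fun t => t ^+ (2 * n)) _ _ _ _ _ dH)//.
- rewrite /= !fctE cospi cos0 expr1n exprS -signr_odd oddM /= expr0; field.
  by rewrite gt_eqF// ltr_wpDr// mulr_ge0.
- by cts; exact: cts_id.
- by move=> t; rewrite exprn_even_ge0// oddM.
- apply: ctsM; last exact: continuous_sin.
  by apply: ctsX; exact: continuous_cos.
Qed.

Lemma E_swpYZ F : continuous F -> E (fun x => F (vec (x 0 0) (x 0 2%:R) (x 0 1))) = E F.
Proof.
move=> cF; have [ort _ _] := orthogonal_swp R; rewrite -(E_rot ort cF).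
by apply: eq_E => x _; rewrite mul_swpYZ.
Qed.

Lemma E_swpXY F : continuous F -> E (fun x => F (vec (x 0 1) (x 0 0) (x 0 2%:R))) = E F.
Proof.
move=> cF; have [_ _ ort] := orthogonal_swp R; rewrite -(E_rot ort cF).
by apply: eq_E => x _; rewrite mul_swpXY.
Qed.

Lemma E_rfl F (a b c : R) : a ^+ 2 = 1 -> b ^+ 2 = 1 -> c ^+ 2 = 1 -> continuous F ->
  E (fun x => F (vec (a * x 0 0) (b * x 0 1) (c * x 0 2%:R))) = E F.
Proof.
move=> a1 b1 c1 cF.
have ort : orthogonal_mx (mx3 (vec a 0 0) (vec 0 b 0) (vec 0 0 c)).
  by apply: orthogonal_mx3; rewrite vec_dot ?mulr0 ?mul0r ?addr0 ?add0r -?expr2.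
rewrite -(E_rot ort cF).
apply: eq_E => x _; congr F; rewrite [in RHS](vec_eta x) vecM !scale_vec !add_vec.
by congr vec; ring.
Qed.

Lemma on_sphereE (x : 'rV[R]_3) : on_sphere x ->
  x 0 0 ^+ 2 + x 0 1 ^+ 2 + x 0 2%:R ^+ 2 = 1.
Proof. by rewrite /on_sphere dotE !expr2. Qed.

(** The moment that obstructs three distinct eigenvalues. The rotation by an
    eighth of a turn about the y-axis maps x^2 - z^2 to -2 x z, and
    the squares of these two functions add up to (1 - y^2)^2, so that the sum of
    the integrand and its rotate is a polynomial in y. *)
Lemma E_cubic_moment :
  E (fun x : 'rV[R]_3 => (x 0 0 ^+ 2 - x 0 2%:R ^+ 2) ^+ 2 * (3 * x 0 1 ^+ 2 - 1)) = - (16 / 105).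
Proof.
set G := fun x : 'rV[R]_3 => _.
have cG : continuous G by rewrite /G; cts.
have s0 : 0 <= 2^-1 :> R by [].
have s2 : Num.sqrt 2^-1 ^+ 2 = 2^-1 :> R by rewrite sqr_sqrtr.
have cs : Num.sqrt 2^-1 ^+ 2 + Num.sqrt 2^-1 ^+ 2 = 1 :> R by rewrite s2; field.
have [_ ort] := rotY_inv_orthogonal cs.
have e1 := E_rot ort cG.
pose P n (x : 'rV[R]_3) := x 0 1 ^+ (2 * n).
have cP n : continuous (P n) by rewrite /P; cts.
have eP n : E (P n) = (2 * n).+1%:R^-1.
  by rewrite -E_zonal_pow -E_swpYZ//; apply: eq_E => x _; rewrite /P vec1.
have : E (fun x => G x + G (x *m rotY (Num.sqrt 2^-1) (Num.sqrt 2^-1))) = - (32 / 105).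
  rewrite (@eq_E _ _ (fun x => (3 * P 3 x - 7 * P 2 x) + (5 * P 1 x - P 0 x))).
    have cPZ (c : R) n : continuous (fun x => c * P n x) by apply: ctsM => //; exact: ctsC.
    rewrite ED; [|exact: ctsB|exact: ctsB].
    by rewrite EB// [X in _ + X]EB// !EZ// !eP; field.
  move=> x /on_sphereE sx; rewrite {2}(vec_eta x) vec_rotY /G !vec0 !vec1 !vec2 /P.
  move: s2; move: (Num.sqrt 2^-1) => s s2; rewrite expr0.
  move: (x 0 0) (x 0 1) (x 0 2%:R) sx => a b c sx.
  have -> : ((a * s - c * s) ^+ 2 - (a * s + c * s) ^+ 2) ^+ 2 =
     (s ^+ 2) ^+ 2 * (4 * a * c) ^+ 2 by ring.
  rewrite s2.
  have -> : ((a ^+ 2 - c ^+ 2) ^+ 2 * (3 * b ^+ 2 - 1) + 2^-1 ^+ 2 * (4 * a * c) ^+ 2 * (3 * b ^+ 2 - 1)) =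
     (a ^+ 2 + b ^+ 2 + c ^+ 2 - b ^+ 2) ^+ 2 * (3 * b ^+ 2 - 1) by field.
  by rewrite sx; ring.
rewrite ED//; last exact: cts_actmx.
rewrite e1 => e; lra.
Qed.

(** The coefficient that makes the remainder below orthogonal to t^2, hence to
    all spherical harmonics of degree 2. *)
Definition quad_coef : R := 15 * pi / 64.
Definition remker (t : R) : R := Num.sqrt (1 - t ^+ 2) - pi / 4 + quad_coef * (t ^+ 2 - 3^-1).

Lemma kernelE t : onsager_kernel t = - quad_coef * (t ^+ 2 - 3^-1) + remker t.
Proof. by rewrite /onsager_kernel /remker; ring. Qed.

Lemma cts_sqrt1 : continuous (fun t : R => Num.sqrt (1 - t ^+ 2)).
Proof.
apply: (@cts_comp _ _ _ (fun t : R => 1 - t ^+ 2)); last exact: sqrt_continuous.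
by cts; exact: cts_id.
Qed.

Lemma cts_rem : continuous remker.
Proof. by have c := cts_sqrt1; rewrite /remker; cts. Qed.

Lemma cts_kernel : continuous (@onsager_kernel R).
Proof. by have := cts_sqrt1 => c; rewrite /onsager_kernel; cts. Qed.

(** The constant that gives the kernel mean 0. *)
Lemma E_sqrt : E (fun x : 'rV[R]_3 => Num.sqrt (1 - x 0 2%:R ^+ 2)) = pi / 4.
Proof.
have dH (t : R) : is_derive t 1 (fun t => 2^-1 * (t - sin t * cos t)) (sin t ^+ 2).
  apply: is_derive_eq; rewrite /GRing.scale /=.
  have := cos2Dsin2 t; move: (sin t) (cos t) => s c e.
  have -> : 2^-1 * (1 - (s * - s + c * c)) = 2^-1 * (1 - (c ^+ 2 + s ^+ 2)) + s ^+ 2 by field.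
  by rewrite e subrr mulr0 add0r.
rewrite (@E_zonal _ (fun t => Num.sqrt (1 - t ^+ 2)) _ _ _ _ _ dH)//.
- by rewrite sinpi sin0; field.
- exact: cts_sqrt1.
- by apply: ctsX; exact: continuous_sin.
- move=> t /sin_ge0_itv t0.
  by rewrite -sin2cos2 sqrtr_sqr ger0_norm.
Qed.

Lemma E_sqrt2 : E (fun x : 'rV[R]_3 => x 0 2%:R ^+ 2 * Num.sqrt (1 - x 0 2%:R ^+ 2)) = pi / 16.
Proof.
have dH (t : R) : is_derive t 1 (fun t => 8^-1 * (t - sin t * cos t * (cos t ^+ 2 - sin t ^+ 2)))
    (cos t ^+ 2 * sin t ^+ 2).
  apply: is_derive_eq; rewrite /GRing.scale /=.
  have := cos2Dsin2 t; move: (sin t) (cos t) => s c e.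
  have -> : 8^-1 * (1 - (s * c * (c * - s + c * - s - (s * c + s * c)) +
      (c ^+ 2 - s ^+ 2) * (s * - s + c * c))) =
    8^-1 * (1 - (c ^+ 2 + s ^+ 2) ^+ 2) + c ^+ 2 * s ^+ 2 by field.
  by rewrite e expr1n subrr mulr0 add0r.
rewrite (@E_zonal _ (fun t => t ^+ 2 * Num.sqrt (1 - t ^+ 2)) _ _ _ _ _ dH)//.
- by rewrite sinpi sin0; field.
- by have := cts_sqrt1 => c; cts; exact: cts_id.
- by move=> t; rewrite mulr_ge0// sqr_ge0.
- by apply: ctsM; apply: ctsX; [exact: continuous_cos|exact: continuous_sin].
- move=> t /sin_ge0_itv t0.
  by rewrite -sin2cos2 sqrtr_sqr ger0_norm// -mulrA -expr2.
Qed.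

Lemma orthogonal_to_z (p : 'rV[R]_3) : on_sphere p ->
  exists B, [/\ orthogonal_mx B, orthogonal_mx B^T & forall x, dot p (x *m B^T) = x 0 2%:R].
Proof.
move=> /to_pole[B [_ oB pB]]; have [_ oxz _] := orthogonal_swp R.
have oC := orthogonal_mxM oB oxz.
exists (B *m swpXZ R); split => //.
  by rewrite /orthogonal_mx trmxK; exact: mulmx1C.
move=> x; rewrite dot_mulmx trmx_mul trmxK !mulmxA.
rewrite pB vecM !scale_vec !add_vec -dot_mulmx dotE !mxE /=; ring.
Qed.

Lemma cts_dot_r (p : 'rV[R]_3) : continuous (fun x : 'rV[R]_3 => dot p x).
Proof. by apply: cts_dot; [exact: cst_continuous|exact: cts_id]. Qed.

Lemma cts_dot_comp (k : R -> R) p : continuous k ->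
  continuous (fun x : 'rV[R]_3 => k (dot p x)).
Proof. by move=> ck; exact: (cts_comp (@cts_dot_r p) ck). Qed.

(** Moving [p] to the north pole. *)
Lemma E_dot (k : R -> R) p : on_sphere p -> continuous k ->
  E (fun x => k (dot p x)) = E (fun x : 'rV[R]_3 => k (x 0 2%:R)).
Proof.
move=> /orthogonal_to_z[B [_ oBt pB]] ck.
rewrite -(E_rot oBt); last exact: cts_dot_comp.
by apply: eq_E => x _; rewrite pB.
Qed.

(** With [p] at the pole, x_i^2 becomes a quadratic form in the coordinates:
    its mixed terms are killed by reflections, and x^2 and y^2 contribute
    equally, hence as (1 - z^2) / 2. *)
Lemma E_dot_coord2 (k : R -> R) p i : on_sphere p -> continuous k ->
  E (fun x : 'rV[R]_3 => k (x 0 2%:R)) = 0 ->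
  E (fun x : 'rV[R]_3 => k (x 0 2%:R) * x 0 2%:R ^+ 2) = 0 ->
  E (fun x : 'rV[R]_3 => k (dot p x) * x 0 i ^+ 2) = 0.
Proof.
move=> /orthogonal_to_z[B [oB oBt pB]] ck k0 k2.
have ck2 : continuous (fun x : 'rV[R]_3 => k (x 0 2%:R)).
  exact: (cts_comp (@cts_crd 2%:R) ck).
have ckp := @cts_dot_comp _ p ck.
rewrite -(E_rot oBt); last by cts.
pose a := B i 0; pose b := B i 1; pose c := B i 2%:R.
rewrite (@eq_E _ _ (fun x => a ^+ 2 * (k (x 0 2%:R) * x 0 0 ^+ 2) +
   b ^+ 2 * (k (x 0 2%:R) * x 0 1 ^+ 2) + c ^+ 2 * (k (x 0 2%:R) * x 0 2%:R ^+ 2) +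
   (2 * a * b) * (k (x 0 2%:R) * x 0 0 * x 0 1) +
   (2 * a * c) * (k (x 0 2%:R) * x 0 0 * x 0 2%:R) +
   (2 * b * c) * (k (x 0 2%:R) * x 0 1 * x 0 2%:R))); last first.
  move=> x _; rewrite pB.
  have -> : (x *m B^T) 0 i = x 0 0 * a + x 0 1 * b + x 0 2%:R * c.
    rewrite mxE !big_ord_recl big_ord0 addr0 addrA !mxE.
    by congr (_ * _ + _ * _ + _ * _); congr (_ _ _); apply: val_inj.
  ring.
rewrite 5?ED ?(EZ (a ^+ 2)) ?(EZ (b ^+ 2)) ?(EZ (c ^+ 2)) ?(EZ (2 * a * b))
  ?(EZ (2 * a * c)) ?(EZ (2 * b * c)); try by cts.
have odd0 (e0 e1 e2 : R) F : e0 ^+ 2 = 1 -> e1 ^+ 2 = 1 -> e2 ^+ 2 = 1 -> continuous F ->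
    (forall x : 'rV[R]_3, F (vec (e0 * x 0 0) (e1 * x 0 1) (e2 * x 0 2%:R)) = - F x) -> E F = 0.
  move=> h0 h1 h2 cF FN; have := E_rfl h0 h1 h2 cF.
  rewrite (@eq_E _ _ (fun x => - F x))//; rewrite EN// => h; lra.
have sN : (- 1) ^+ 2 = 1 :> R by rewrite sqrrN expr1n.
have s1 : 1 ^+ 2 = 1 :> R by rewrite expr1n.
have -> : E (fun x => k (x 0 2%:R) * x 0 0 * x 0 1) = 0.
  by apply: (odd0 (-1) 1 1) => // [|x]; [cts|rewrite !vec0 !vec1 !vec2 !mul1r; ring].
have -> : E (fun x => k (x 0 2%:R) * x 0 0 * x 0 2%:R) = 0.
  by apply: (odd0 (-1) 1 1) => // [|x]; [cts|rewrite !vec0 !vec2 !mul1r; ring].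
have -> : E (fun x => k (x 0 2%:R) * x 0 1 * x 0 2%:R) = 0.
  by apply: (odd0 1 (-1) 1) => // [|x]; [cts|rewrite !vec1 !vec2 !mul1r; ring].
have e1 : E (fun x => k (x 0 2%:R) * x 0 1 ^+ 2) = E (fun x => k (x 0 2%:R) * x 0 0 ^+ 2).
  rewrite -E_swpXY; last by cts.
  by apply: eq_E => x _; rewrite vec1 vec2.
have : E (fun x => k (x 0 2%:R) * x 0 0 ^+ 2 + k (x 0 2%:R) * x 0 1 ^+ 2 +
    k (x 0 2%:R) * x 0 2%:R ^+ 2) = 0.
  rewrite -[RHS]k0; apply: eq_E => x /on_sphereE sx.
  by rewrite -!mulrDr sx mulr1.
rewrite !ED; try by cts.
rewrite k2 e1 => h.
have -> : E (fun x => k (x 0 2%:R) * x 0 0 ^+ 2) = 0 by lra.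
by rewrite !mulr0 !addr0.
Qed.

Lemma E_rem0 : E (fun x : 'rV[R]_3 => remker (x 0 2%:R)) = 0.
Proof.
have cs : continuous (fun x : 'rV[R]_3 => Num.sqrt (1 - x 0 2%:R ^+ 2)).
  exact: (cts_comp (@cts_crd 2%:R) cts_sqrt1).
rewrite /remker ED ?EB ?EZ ?EB ?E_sqrt ?E_cst; try by cts.
have := E_zonal_pow 1; rewrite muln1 => ->.
rewrite ?E_cst; lra.
Qed.

Lemma E_rem2 : E (fun x : 'rV[R]_3 => remker (x 0 2%:R) * x 0 2%:R ^+ 2) = 0.
Proof.
have cs : continuous (fun x : 'rV[R]_3 => Num.sqrt (1 - x 0 2%:R ^+ 2)).
  exact: (cts_comp (@cts_crd 2%:R) cts_sqrt1).
rewrite (@eq_E _ _ (fun x => x 0 2%:R ^+ 2 * Num.sqrt (1 - x 0 2%:R ^+ 2) +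
  quad_coef * x 0 2%:R ^+ (2 * 2) - (pi / 4 + quad_coef / 3) * x 0 2%:R ^+ (2 * 1))); last first.
  by move=> x _; rewrite /remker; ring.
rewrite EB ?ED ?EZ ?E_sqrt2 ?E_zonal_pow; try by cts.
by rewrite /quad_coef; field.
Qed.

Lemma E_rem_sqr : E (fun x : 'rV[R]_3 => remker (x 0 2%:R) ^+ 2) = 2 / 3 - 69 * pi ^+ 2 / 1024.
Proof.
have cs : continuous (fun x : 'rV[R]_3 => Num.sqrt (1 - x 0 2%:R ^+ 2)).
  exact: (cts_comp (@cts_crd 2%:R) cts_sqrt1).
pose r (x : 'rV[R]_3) := remker (x 0 2%:R).
have cr : continuous r := cts_comp (@cts_crd 2%:R) cts_rem.
pose f (x : 'rV[R]_3) := remker (x 0 2%:R) * x 0 2%:R ^+ 2.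
have cf : continuous f by rewrite /f; cts.
pose g (x : 'rV[R]_3) := x 0 2%:R ^+ 2 * Num.sqrt (1 - x 0 2%:R ^+ 2).
have cg : continuous g by rewrite /g; cts.
have er : E r = 0 by exact: E_rem0.
have ef : E f = 0 by exact: E_rem2.
have eg : E g = pi / 16 by exact: E_sqrt2.
rewrite (@eq_E _ _ (fun x => (1 - x 0 2%:R ^+ (2 * 1)) +
  (quad_coef * g x - (pi / 4 + quad_coef / 3) * Num.sqrt (1 - x 0 2%:R ^+ 2)) +
  (quad_coef * f x - (pi / 4 + quad_coef / 3) * r x))); last first.
  move=> x /on_sphereE sx; rewrite /f /g /r.
  have : Num.sqrt (1 - x 0 2%:R ^+ 2) ^+ 2 = 1 - x 0 2%:R ^+ 2.
    by rewrite sqr_sqrtr// -sx; nra.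
  rewrite /remker; move: (Num.sqrt _) => s es.
  rewrite muln1 -es; ring.
clearbody r f g; rewrite !(EB, ED, EZ); try by cts.
by rewrite er ef eg E_sqrt E_zonal_pow E_cst /quad_coef; field.
Qed.

Lemma E_rem_coord2 (p : 'rV[R]_3) i : on_sphere p ->
  E (fun x : 'rV[R]_3 => remker (dot p x) * x 0 i ^+ 2) = 0.
Proof.
by move=> sp; apply: E_dot_coord2 => //; [exact: cts_rem|exact: E_rem0|exact: E_rem2].
Qed.

(** By the quadratic moment of the remainder. This mean bounds the sup-norm of
    the operator with kernel [remker], and it matters that its double is
    smaller than pi / 32 (about 0.0982). *)
Lemma E_abs_rem (p : 'rV[R]_3) : on_sphere p ->
  E (fun x => `|remker (dot p x)|) <= 482 / 10000.
Proof.
move=> sp; have cr := @cts_dot_comp _ p cts_rem.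
have cn : continuous (fun x => `|remker (dot p x)|).
  exact: (cts_comp cr (@norm_continuous _ R)).
(* From (|r| - 48 / 1000)^2 >= 0, as 48 / 1000 is close to the root mean square. *)
have h : E (fun x => `|remker (dot p x)|) <= E (fun x => 1000 / 96 * remker (dot p x) ^+ 2 + 24 / 1000).
  apply: E_le => //; first by cts.
  move=> x _; rewrite -[remker _ ^+ 2]real_normK ?num_real//.
  have := sqr_ge0 (`|remker (dot p x)| - 48 / 1000); lra.
apply: (le_trans h); rewrite ED ?EZ; try by cts.
rewrite E_cst.
rewrite (@E_dot (fun t => remker t ^+ 2))//; last first.
  by apply: ctsX; exact: cts_rem.
rewrite E_rem_sqr; have := pi_gt314 R; nra.
Qed.

End moments.

(** * Exchanging means *)
Section finite.
Variable R : realType.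
Lemma surface_fin_num_fun : fin_num_fun (@surface_measure R).
Proof.
move=> A mA; rewrite ge0_fin_numE//.
apply: (@le_lt_trans _ _ (@surface_measure R setT)).
  by apply: le_measure; rewrite ?inE.
by rewrite -[X in (X < _)%E]/(@surface_measure R setT) surface_measureT ltry.
Qed.
HB.instance Definition _ := @Measure_isFinite.Build _ _ _ (@surface_measure R)
  surface_fin_num_fun.
End finite.

Section fubini.
Variable R : realType.
Local Notation sigma := (@surface_measure R).
Implicit Types F G : 'rV[R]_3 -> R.

Lemma dot_le1 (x z : 'rV[R]_3) : on_sphere x -> on_sphere z -> `|dot x z| <= 1.
Proof.
move=> /on_sphereE sx /on_sphereE sz; rewrite dotE.
move: (x 0 0) (x 0 1) (x 0 2%:R) (z 0 0) (z 0 1) (z 0 2%:R) sx sz => a b c a' b' c' sx sz.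
have := sqr_ge0 (a - a'); have := sqr_ge0 (b - b'); have := sqr_ge0 (c - c').
have := sqr_ge0 (a + a'); have := sqr_ge0 (b + b'); have := sqr_ge0 (c + c').
by rewrite ler_norml => *; apply/andP; split; nra.
Qed.

Lemma cts_dot_bounded (k : R -> R) : continuous k -> exists M, 0 < M /\
  forall x z, on_sphere x -> on_sphere z -> `|k (dot x z)| <= M.
Proof.
move=> ck; have [M [M0 kM]] := cts_sphere_bounded (cts_comp (@cts_crd R 2%:R) ck).
exists M; split => // x z sx sz; have := dot_le1 sx sz; move: (dot x z) => t t1.
have := kM (vec (Num.sqrt (1 - t ^+ 2)) 0 t); rewrite vec2; apply.
rewrite /on_sphere vec_dot -expr2 sqr_sqrtr; first by ring.
by rewrite subr_ge0 -[leLHS]ger0_norm ?sqr_ge0// normrX expr_le1.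
Qed.

(** By Fubini; it moves the orthogonality of a kernel to a function onto every
    image of the integral operator with this kernel. *)
Lemma E_fubini (k : R -> R) (h y : 'rV[R]_3 -> R) :
  continuous k -> continuous h -> continuous y ->
  E (fun p => h p * E (fun q => k (dot p q) * y q)) =
  E (fun q => y q * E (fun p => k (dot p q) * h p)).
Proof.
move=> ck ch cy.
pose f (z : S2 R * S2 R) : R :=
  (4 * pi)^-1 * (h (coords z.1) * (k (dot (coords z.1) (coords z.2)) * y (coords z.2))).
have mc (F : 'rV[R]_3 -> R) : continuous F ->
    measurable_fun setT (fun z : S2 R * S2 R => F (coords z.1)) /\
    measurable_fun setT (fun z : S2 R * S2 R => F (coords z.2)).
  move=> cF; have m := measurable_coords_comp cF.
  by split; apply: (measurableT_comp m).
have mf : measurable_fun setT f.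
  apply: measurable_funM; first exact: measurable_cst.
  apply: measurable_funM; first exact: (mc h ch).1.
  apply: measurable_funM; last exact: (mc y cy).2.
  apply: (measurableT_comp (continuous_measurable_fun ck)).
  under eq_fun do rewrite dotE.
  have [m0 m0'] := mc _ (@cts_crd R 0); have [m1 m1'] := mc _ (@cts_crd R 1).
  have [m2 m2'] := mc _ (@cts_crd R 2%:R).
  by apply: measurable_funD; [apply: measurable_funD|]; apply: measurable_funM.
have [Mh [Mh0 hM]] := cts_sphere_bounded ch.
have [My [My0 yM]] := cts_sphere_bounded cy.
have [Mk [Mk0 kM]] := cts_dot_bounded ck.
have sc := @coords_on_sphere R.
have fM z : `|f z| <= `|(4 * pi)^-1| * (Mh * (Mk * My)).
  by rewrite /f !normrM ler_wpM2l//; rewrite ler_pM ?mulr_ge0 ?hM// ler_pM ?kM// yM.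
have intf : (sigma \x sigma)%E.-integrable setT (EFin \o f).
  apply: measurable_bounded_integrable => //.
    have e : ((sigma \x sigma) (setT `*` setT) = sigma setT * sigma setT)%E.
      exact: product_measure1E.
    move: e; rewrite setXTT [sigma setT]surface_measureT -EFinM => e.
    suff : ((sigma \x sigma) setT < +oo)%E by [].
    by rewrite e ltry.
  exists (`|(4 * pi)^-1| * (Mh * (Mk * My))); split; first exact: num_real.
  by move=> x Mx p _ /=; rewrite (le_trans (fM p))// ltW.
have ckd p : continuous (fun q => k (dot p q) * y q).
  by apply: ctsM => //; exact: cts_dot_comp.
have ckd' q : continuous (fun p => k (dot p q) * h p).
  apply: ctsM => //; apply: (@cts_comp _ _ _ (fun p => dot p q)) => //.
  by apply: cts_dot; [exact: cts_id|exact: cst_continuous].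
have e1 p : (\int[sigma]_q (f (p, q))%:E)%E =
    (h (coords p) * E (fun q => k (dot (coords p) q) * y q))%:E.
  rewrite /E mulrCA -RintegralZl//; last exact: (cts_integrable (ckd _)).
  rewrite -RintegralZl//; last exact: (cts_integrable (ctsM (@ctsC _ _ (h (coords p))) (ckd (coords p)))).
  rewrite /Rintegral fineK//; apply: integrable_fin_num => //.
  apply: (cts_integrable (ctsM (@ctsC _ _ (4 * pi)^-1) (ctsM (@ctsC _ _ (h (coords p))) (ckd (coords p))))).
have e2 q : (\int[sigma]_p (f (p, q))%:E)%E =
    (y (coords q) * E (fun p => k (dot p (coords q)) * h p))%:E.
  rewrite /E mulrCA -RintegralZl//; last exact: (cts_integrable (ckd' _)).
  rewrite -RintegralZl//; last exact: (cts_integrable (ctsM (@ctsC _ _ (y (coords q))) (ckd' (coords q)))).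
  rewrite /Rintegral fineK//.
    by apply: eq_integral => p _; rewrite /f /=; congr (_%:E); ring.
  apply: integrable_fin_num => //.
  apply: (cts_integrable (ctsM (@ctsC _ _ (4 * pi)^-1) (ctsM (@ctsC _ _ (y (coords q))) (ckd' (coords q))))).
rewrite [LHS]/E [RHS]/E; congr (_ * fine _).
transitivity (\int[sigma]_p \int[sigma]_q (f (p, q))%:E)%E.
  by apply: eq_integral => p _; rewrite e1.
transitivity (\int[sigma]_q \int[sigma]_p (f (p, q))%:E)%E; first exact: (Fubini intf).
by apply: eq_integral => p _; rewrite e2.
Qed.

End fubini.

(** * Solutions of small Sobolev norm are small and continuous *)
Lemma cts_near (R : realType) (T : topologicalType) (f : T -> R) :
  (forall x e, 0 < e -> \forall x' \near x, `|f x - f x'| <= e) -> continuous f.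
Proof. by move=> h x; apply/cvgrPdist_le => e; exact: h. Qed.

Section kernel_integral.
Variable R : realType.
Local Notation sigma := (@surface_measure R).

(** Uniform continuity in [q], by compactness of the sphere. *)
Lemma kernel_unif (k : R -> R) (x : 'rV[R]_3) (e : R) : continuous k -> 0 < e ->
  \forall x' \near x, forall q, on_sphere q -> `|k (dot x q) - k (dot x' q)| <= e.
Proof.
move=> ck e0.
have /compact_near_coveringP := @compact_sphere R.
move=> /(_ _ (nbhs x) (fun x' q => `|k (dot x q) - k (dot x' q)| <= e)); apply.
move=> q sq.
pose f (z : 'rV[R]_3 * 'rV[R]_3) := k (dot x z.1) - k (dot z.2 z.1).
have cf : continuous f.
  have cfst : continuous (fst : 'rV[R]_3 * 'rV[R]_3 -> 'rV[R]_3).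
    by move=> z; exact: cvg_fst.
  have csnd : continuous (snd : 'rV[R]_3 * 'rV[R]_3 -> 'rV[R]_3).
    by move=> z; exact: cvg_snd.
  apply: ctsB.
    apply: (@cts_comp _ _ _ (fun z : 'rV[R]_3 * 'rV[R]_3 => dot x z.1) k) => //.
    exact: (@cts_dot R _ (fun=> x) (fun z => z.1) (@cst_continuous _ _ x) cfst).
  apply: (@cts_comp _ _ _ (fun z : 'rV[R]_3 * 'rV[R]_3 => dot z.2 z.1) k) => //.
  exact: (@cts_dot R _ (fun z => z.2) (fun z => z.1) csnd cfst).
have f0 : f (q, x) = 0 by rewrite /f subrr.
have /cvgrPdist_le/(_ e e0) := cf (q, x); rewrite f0.
by apply: filterS => -[q' x'] /=; rewrite sub0r normrN.
Qed.

Variable k : R -> R.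
Hypothesis ck : continuous k.
Variables (w : S2 R -> R) (M : R).
Hypotheses (mw : measurable_fun setT w) (wM : forall p, `|w p| <= M).

Let intk (x : 'rV[R]_3) :
  sigma.-integrable setT (EFin \o (fun q => k (dot x (coords q)) * w q)).
Proof.
have ckx := @cts_dot_comp R k x ck.
have [N [N0 kN]] := cts_sphere_bounded ckx.
apply: (@bounded_integrable _ _ (N * M)).
  by apply: measurable_funM => //; exact: (measurable_coords_comp ckx).
by move=> p; rewrite normrM ler_pM// kN//; exact: coords_on_sphere.
Qed.

Lemma cts_kernel_integral :
  continuous (fun x : 'rV[R]_3 => \int[sigma]_q (k (dot x (coords q)) * w q)).
Proof.
have M0 : 0 <= M by exact: (le_trans (normr_ge0 _) (wM point)).
have pi0 := pi_gt0 R.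
apply: cts_near => x e e0.
have M4 : 0 < M * (4 * pi) + 1 by rewrite ltr_wpDl// mulr_ge0// mulr_ge0// ltW.
have e'0 : 0 < e / (M * (4 * pi) + 1) by rewrite divr_gt0.
have := kernel_unif x ck e'0; apply: filterS => x' hx'.
rewrite -RintegralB//; apply: le_trans (le_normr_Rintegral _ _) _ => //.
  exact: (integrableB measurableT (intk x) (intk x')).
apply: (@le_trans _ _ (\int[sigma]_q (e / (M * (4 * pi) + 1) * M))).
  apply: le_Rintegral => //.
  - by apply: integrable_norm; exact: (integrableB measurableT (intk x) (intk x')).
  - apply: (@bounded_integrable _ _ (e / (M * (4 * pi) + 1) * M)); first exact: measurable_cst.
    by move=> p; rewrite ger0_norm// mulr_ge0// ltW.
  - move=> q _; rewrite -mulrBl normrM ler_pM// hx'//; exact: coords_on_sphere.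
rewrite Rintegral_cst//= [sigma setT]surface_measureT /= -!mulrA ler_piMr ?(ltW e0)//.
by rewrite mulrC ler_pdivrMr// mul1r lerDl.
Qed.
End kernel_integral.

Section prep.
Variable R : realType.
Local Notation sigma := (@surface_measure R).

(** The Euler-Lagrange equation for a function on the whole of three-space, of
    which only the values on the sphere matter; matrices then act by plain
    composition. *)
Definition small_solution (lam d : R) (F : 'rV[R]_3 -> R) := [/\ continuous F,
  forall x, on_sphere x -> `|F x| <= d &
  forall x, on_sphere x -> lam * F x =
    (E (fun q => expR (- F q)))^-1 * E (fun q => onsager_kernel (dot x q) * expR (- F q))].

Lemma abs_kernel (t : R) : `|onsager_kernel t| <= 1.
Proof.
have h0 : 0 <= Num.sqrt (1 - t ^+ 2) by rewrite sqrtr_ge0.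
have h1 : Num.sqrt (1 - t ^+ 2) <= 1.
  by rewrite -[leRHS]sqrtr1 ler_sqrt// gerBl sqr_ge0.
have p0 := pi_gt0 R; have p1 := pihalf_lt2 R.
by rewrite /onsager_kernel ler_norml; apply/andP; split; lra.
Qed.

Lemma E_kernel0 (p : 'rV[R]_3) : on_sphere p -> E (fun q => onsager_kernel (dot p q)) = 0.
Proof.
move=> sp; rewrite E_dot//; last exact: cts_kernel.
have cs : continuous (fun x : 'rV[R]_3 => Num.sqrt (1 - x 0 2%:R ^+ 2)).
  exact: (cts_comp (@cts_crd R 2%:R) (@cts_sqrt1 R)).
rewrite /onsager_kernel EB//; last exact: ctsC.
by rewrite E_sqrt E_cst subrr.
Qed.

Lemma expR_sub1_le (B x : R) : `|x| <= B -> `|expR (- x) - 1| <= expR B * `|x|.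
Proof.
move=> xB; have e1 := expR_ge1Dx (- x); have e2 := expR_ge1Dx x.
have ep := expR_gt0 (- x).
have eB : expR (- x) <= expR B by rewrite ler_expR (le_trans _ xB)// -normrN ler_norm.
have B1 : 1 <= expR B by rewrite -[leLHS]expR0 ler_expR (le_trans _ xB).
have ee : expR x * expR (- x) = 1 by rewrite -expRD subrr expR0.
have h : (1 + x) * expR (- x) <= 1 by rewrite -[leRHS]ee ler_pM2r.
rewrite ler_norml; move: (expR (- x)) (expR B) ep eB B1 e1 h => u v u0 uv v1 e1 h.
case: (ger0P x) => x0; apply/andP; split.
- have : 0 <= (v - 1) * x by rewrite mulr_ge0// subr_ge0.
  lra.
- have := mulr_ge0 (ltW u0) x0; have : 0 <= v * x by rewrite mulr_ge0//; lra.
  lra.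
- have : 0 <= v * - x by rewrite mulr_ge0//; lra.
  lra.
- have : 0 <= (v - u) * - x by rewrite mulr_ge0//; lra.
  lra.
Qed.

Lemma Lfun_measurable (phi : S2 R -> R) : phi \in Lfun sigma 2%:E -> measurable_fun setT phi.
Proof. by move=> /sub_Lfun_mfun; rewrite inE. Qed.

Lemma L2_le_H2 (phi : S2 R -> R) (e : R) : 0 < e -> H2norm phi < e -> L2normsq phi <= e ^+ 2.
Proof.
move=> e0 h.
have L0 (f : S2 R -> R) : 0 <= L2normsq f by apply: Rintegral_ge0 => p _; rewrite sqr_ge0.
have h0 : 0 <= H2norm phi by rewrite sqrtr_ge0.
have : H2norm phi ^+ 2 <= e ^+ 2 by rewrite ler_pXn2r ?nnegrE ?(ltW e0)// ltW.
apply: le_trans; rewrite sqr_sqrtr.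
  rewrite -addrA lerDl.
  by repeat first [exact: L0 | apply: addr_ge0 | apply: sumr_ge0 => ? _].
by repeat first [exact: L0 | apply: addr_ge0 | apply: sumr_ge0 => ? _].
Qed.

Lemma small_solution0 (lam d : R) : 0 <= d -> small_solution lam d (cst 0).
Proof.
move=> d0; split; first exact: ctsC.
- by move=> x _; rewrite normr0.
- move=> x sx; rewrite mulr0; under eq_E do rewrite /= oppr0 expR0.
  rewrite E_cst; under [X in _ * E X]eq_fun do rewrite /= oppr0 expR0 mulr1.
  by rewrite E_kernel0// mulr0.
Qed.

Let pi4 : 0 < 4 * pi :> R. Proof. by rewrite mulr_gt0// pi_gt0. Qed.

(** The equation bounds [phi] by 1 / lam. With this bound, exp (- phi) - 1 is
    controlled by |phi|, and since the kernel has mean 0 the equation bounds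
    the sup-norm of [phi] by its L1 norm, hence by its L2 norm. The right-hand
    side of the equation makes sense for any [p] in three-space and is
    continuous there, which provides the extension. *)
Lemma solution_extends (d : R) : 0 < d -> exists2 eps : R, 0 < eps <= 1 / 1000 &
  forall (phi : S2 R -> R) (lam : R),
    H2 phi -> H2norm phi < eps -> `|lam - pi / 32| < eps -> euler_lagrange lam phi ->
    exists2 F : 'rV[R]_3 -> R, small_solution lam d F & forall p, phi p = F (coords p).
Proof.
move=> d0.
(* exp 24 bounds exp (- phi) / exp (- phi') when |phi| <= 12, and 12 exceeds 1 / lam. *)
have [C CE] : exists C : R, C = 12 * expR 24 by eexists.
have C0 : 0 < C by rewrite CE mulr_gt0// expR_gt0.
have m0 : 0 < 1 / 1000 :> R by lra.
have dC : 0 < d / C by exact: divr_gt0.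
exists (Num.min (1 / 1000) (d / C)); first by rewrite lt_min ge_min lexx m0 dC.
set eps := Num.min _ _.
have e0 : 0 < eps by rewrite lt_min m0 dC.
have e1 : eps <= 1 / 1000 by rewrite ge_min lexx.
have e2 : C * eps <= d by rewrite mulrC -ler_pdivlMr// ge_min lexx orbT.
clearbody eps.
move=> phi lam [/Lfun_measurable mphi _ _] /(L2_le_H2 e0) phi2 lame EL.
have pl := pi_gt314 R.
have lam0 : 9 / 100 <= lam.
  move: lame; rewrite ltr_norml => /andP[+ _].
  by lra.
have lam_gt0 : 0 < lam by lra.
have [Z ZE] : exists Z : R, Z = partition_function phi by eexists.
(* Z is 0 when exp (- phi) is not integrable; then the equation reads
   lam * phi = 0. *)
have [Z0|Z0] := eqVneq Z 0.
  exists (cst 0); first by apply: small_solution0; exact: ltW.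
  move=> p; have := EL p; rewrite -ZE Z0 invr0 mul0r subr0 => /eqP.
  by rewrite mulf_eq0 gt_eqF//= => /eqP.
have mexp : measurable_fun setT (fun q => expR (- phi q)).
  by apply: (measurableT_comp (@measurable_expR R)); exact: measurable_funN.
have ie : sigma.-integrable setT (EFin \o (fun q => expR (- phi q))).
  apply/integrableP; split; first exact/measurable_EFinP.
  under eq_integral => q _ do rewrite gee0_abs ?lee_fin ?expR_ge0//.
  rewrite ltey; apply: contra_neq Z0 => ioo.
  by rewrite ZE /partition_function /Rintegral ioo.
have Zp : 0 < Z by rewrite lt_neqAle eq_sym Z0 ZE Rintegral_ge0// => q _; exact: expR_ge0.
have mk p : measurable_fun setT (fun q : S2 R => onsager_kernel (dot (coords p) (coords q))).
  exact: (measurable_coords_comp (cts_dot_comp (cts_kernel (R := R)))).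
have lamphi p : lam * phi p = Z^-1 * \int[sigma]_q
    (onsager_kernel (dot (coords p) (coords q)) * expR (- phi q)).
  by apply/eqP; rewrite -subr_eq0 ZE; apply/eqP; exact: EL.
have ike p : sigma.-integrable setT
    (EFin \o (fun q => onsager_kernel (dot (coords p) (coords q)) * expR (- phi q))).
  apply: (le_integrable measurableT _ _ ie).
    by apply/measurable_EFinP; exact: measurable_funM.
  move=> q _; rewrite /= lee_fin normrM ler_piMl//; exact: abs_kernel.
have phi12 p : `|phi p| <= 12.
  have : lam * `|phi p| <= 1.
    rewrite -{1}(gtr0_norm lam_gt0) -normrM lamphi normrM gtr0_norm ?invr_gt0//.
    rewrite ler_pdivrMl// mulr1 ZE; apply: le_trans (le_normr_Rintegral _ (ike p)) _ => //.
    apply: le_Rintegral => //; first exact: integrable_norm (ike p).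
    move=> q _; rewrite normrM (ger0_norm (expR_ge0 _)) ler_piMl ?expR_ge0//.
    exact: abs_kernel.
  by have := normr_ge0 (phi p); nra.
have eb q : `|expR (- phi q)| <= expR 12.
  by rewrite ger0_norm ?expR_ge0// ler_expR (le_trans _ (phi12 q))// -normrN ler_norm.
have elb q : expR (- 12) <= expR (- phi q).
  by rewrite ler_expR lerN2 (le_trans _ (phi12 q))// ler_norm.
have Zlb : expR (- 12) * (4 * pi) <= Z.
  have -> : expR (- 12) * (4 * pi) = \int[sigma]_q expR (- 12).
    by rewrite Rintegral_cst//= [sigma setT]surface_measureT.
  rewrite ZE; apply: le_Rintegral => //.
  apply: (@bounded_integrable _ _ (expR (-12))); first exact: measurable_cst.
  by move=> p; rewrite ger0_norm// expR_ge0.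
have iphi2 : sigma.-integrable setT (EFin \o (fun q => phi q ^+ 2)).
  apply: (@bounded_integrable _ _ (12 ^+ 2)); first exact: measurable_funX.
  by move=> p; rewrite normrX ler_pXn2r ?nnegrE.
have iabs : sigma.-integrable setT (EFin \o (fun q => `|phi q|)).
  apply: (@bounded_integrable _ _ 12); first exact: measurableT_comp.
  by move=> p; rewrite normr_id.
have icst (c : R) : sigma.-integrable setT (EFin \o (fun=> c)).
  by apply: (@bounded_integrable _ _ `|c|); first exact: measurable_cst.
(* |phi| <= phi^2 / (2 eps) + eps / 2, integrated over the sphere. *)
have L1 : \int[sigma]_q `|phi q| <= eps * (1 / 2 + 2 * pi).
  have i1 : sigma.-integrable setT (EFin \o (fun q => (2 * eps)^-1 * phi q ^+ 2)).
    apply: (@bounded_integrable _ _ ((2 * eps)^-1 * 12 ^+ 2)).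
      by apply: measurable_funM => //; exact: measurable_funX.
    move=> p; rewrite normrM normrX gtr0_norm ?invr_gt0 ?mulr_gt0//.
    by rewrite ler_pM2l ?invr_gt0 ?mulr_gt0// ler_pXn2r ?nnegrE.
  apply: (@le_trans _ _ (\int[sigma]_q ((2 * eps)^-1 * phi q ^+ 2 + eps / 2))).
    apply: le_Rintegral => //.
      exact: (integrableD measurableT i1 (icst (eps / 2))).
    move=> q _; rewrite -[phi q ^+ 2]real_normK ?num_real//.
    have := sqr_ge0 (`|phi q| - eps); rewrite sqrrB => h.
    rewrite -(@ler_pM2l _ (2 * eps)) ?mulr_gt0// mulrDr mulVKf ?gt_eqF ?mulr_gt0//.
    lra.
  rewrite RintegralD// RintegralZl// Rintegral_cst//= [sigma setT]surface_measureT /=.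
  have : (2 * eps)^-1 * L2normsq phi <= eps / 2.
    by rewrite ler_pdivrMl ?mulr_gt0//; apply: le_trans phi2 _; rewrite expr2; lra.
  by rewrite /L2normsq; lra.
have mexp1 : measurable_fun setT (fun q => expR (- phi q) - 1).
  by apply: measurable_funB => //; exact: measurable_cst.
have small p : `|phi p| <= d.
  have b1 q : `|expR (- phi q) - 1| <= expR 12 * `|phi q| := expR_sub1_le (phi12 q).
  have b2 q : `|expR (- phi q) - 1| <= expR 12 * 12.
    by apply: le_trans (b1 q) _; rewrite ler_pM2l// expR_gt0.
  have ik : sigma.-integrable setT
      (EFin \o (fun q => onsager_kernel (dot (coords p) (coords q)) : R)).
    by apply: (@bounded_integrable _ _ 1) => // q; exact: abs_kernel.
  have ik1 : sigma.-integrable setT (EFin \o (fun q =>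
      onsager_kernel (dot (coords p) (coords q)) * (expR (- phi q) - 1))).
    apply: (@bounded_integrable _ _ (1 * (expR 12 * 12))); first exact: measurable_funM.
    by move=> q; rewrite normrM ler_pM// abs_kernel.
  have k0 : \int[sigma]_q (onsager_kernel (dot (coords p) (coords q)) : R) = 0.
    have := E_kernel0 (coords_on_sphere p); rewrite /E => /eqP.
    by rewrite mulf_eq0 invr_eq0 gt_eqF//= => /eqP.
  have : lam * `|phi p| <= Z^-1 * (expR 12 * (eps * (1 / 2 + 2 * pi))).
    rewrite -{1}(gtr0_norm lam_gt0) -normrM lamphi normrM gtr0_norm ?invr_gt0//.
    rewrite ler_pM2l ?invr_gt0//.
    have -> : \int[sigma]_q (onsager_kernel (dot (coords p) (coords q)) * expR (- phi q)) =
        \int[sigma]_q (onsager_kernel (dot (coords p) (coords q)) * (expR (- phi q) - 1)).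
      rewrite -[RHS]addr0 -k0 -RintegralD//; apply: eq_Rintegral => q _; ring.
    apply: le_trans (le_normr_Rintegral _ ik1) _ => //.
    apply: (@le_trans _ _ (\int[sigma]_q (expR 12 * `|phi q|))).
      apply: le_Rintegral => //; first exact: integrable_norm ik1.
        apply: (@bounded_integrable _ _ (expR 12 * 12)).
          by apply: measurable_funM; [exact: measurable_cst|exact: measurableT_comp].
        by move=> q; rewrite normrM normr_id ger0_norm ?expR_ge0// ler_pM2l// expR_gt0.
      by move=> q _; rewrite normrM -[leRHS]mul1r ler_pM// abs_kernel.
    by rewrite RintegralZl// ler_pM2l// expR_gt0.
  have e24 : expR 24 = expR 12 * expR 12 :> R by rewrite -expRD; congr expR; ring.
  have em : expR (- 12) = (expR 12)^-1 :> R by rewrite expRN.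
  have x0 : 0 < expR 12 :> R := expR_gt0 _.
  move: e2 Zlb; rewrite CE e24 em; move: (expR 12) x0 => u u0 e2 Zlb.
  have Zi : Z^-1 * (4 * pi) <= u.
    by rewrite mulrC ler_pdivrMr// -ler_pdivrMl.
  have : Z^-1 * (u * (eps * (1 / 2 + 2 * pi))) <= u * (u * eps).
    have -> : Z^-1 * (u * (eps * (1 / 2 + 2 * pi))) = (Z^-1 * (1 / 2 + 2 * pi)) * (u * eps) by ring.
    rewrite ler_pM2r ?mulr_gt0//; apply: le_trans Zi.
    by rewrite ler_pM2l ?invr_gt0//; lra.
  move=> h1 h2; apply: le_trans e2.
  have h3 := le_trans h2 h1; have := normr_ge0 (phi p).
  move: (`|phi p|) h3 => y h3 y0; have : 9 / 100 * y <= lam * y by rewrite ler_wpM2r.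
  rewrite -!mulrA; have := mulr_gt0 u0 (mulr_gt0 u0 e0); lra.
pose F (x : 'rV[R]_3) := (lam * Z)^-1 * \int[sigma]_q (onsager_kernel (dot x (coords q)) * expR (- phi q)).
have phiF p : phi p = F (coords p).
  rewrite /F invfM -mulrA -lamphi mulKf// gt_eqF//.
exists F => //; split.
- apply: ctsM; first exact: ctsC.
  exact: (cts_kernel_integral (cts_kernel (R := R)) mexp eb).
- by move=> x sx; rewrite -(coords_sphere_point sx) -phiF.
- move=> x sx; rewrite -(coords_sphere_point sx) -phiF lamphi /E.
  rewrite invfM invrK mulrACA mulfV ?gt_eqF// mul1r ZE /partition_function.
  congr (_^-1 * _); apply: eq_Rintegral => q _; by rewrite -phiF.
Qed.

End prep.

(** * The mean of the exponential along a segment *)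
Section expdd.
Variable R : realType.
Local Notation mu := (@lebesgue_measure R).

Let J (f : R -> R) : R := \int[mu]_(t in `[0, 1]) f t.

Let intJ (f : R -> R) : continuous f -> mu.-integrable `[0, 1] (EFin \o f).
Proof.
move=> cf; apply: continuous_compact_integrable; first exact: segment_compact.
exact: continuous_subspaceT.
Qed.

Let JD (f g : R -> R) : continuous f -> continuous g ->
  J (fun t => f t + g t) = J f + J g.
Proof. by move=> cf cg; rewrite /J RintegralD//; exact: intJ. Qed.

Let JB (f g : R -> R) : continuous f -> continuous g ->
  J (fun t => f t - g t) = J f - J g.
Proof. by move=> cf cg; rewrite /J RintegralB//; exact: intJ. Qed.

Let JZ (c : R) (f : R -> R) : continuous f -> J (fun t => c * f t) = c * J f.
Proof. by move=> cf; rewrite /J RintegralZl//; exact: intJ. Qed.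

Let J_FTC (f H : R -> R) : continuous f -> (forall t : R, is_derive t 1 H (f t)) ->
  J f = H 1 - H 0.
Proof.
move=> cf dH; rewrite /J /Rintegral.
rewrite (continuous_FTC2 ltr01 (continuous_subspaceT cf) (is_derive_LR _ _ dH))//.
by move=> t _; rewrite (derive1_funE dH).
Qed.

Let J_cst (c : R) : J (fun=> c) = c.
Proof.
have dH (t : R) : is_derive t 1 (fun t : R => c * t) c.
  by apply: is_derive_eq; rewrite /GRing.scale /= mulr1.
by rewrite (J_FTC _ dH) ?mulr1 ?mulr0 ?subr0//; exact: ctsC.
Qed.

Let J_bound (f : R -> R) (c : R) : continuous f ->
  (forall t, 0 <= t <= 1 -> `|f t| <= c) -> `|J f| <= c.
Proof.
move=> cf fc; apply: le_trans (le_normr_Rintegral _ (intJ cf)) _; first exact: measurable_itv.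
rewrite -[leRHS]J_cst /J; apply: le_Rintegral; first exact: measurable_itv.
- exact: (intJ (cts_comp cf (@norm_continuous _ R))).
- exact: (intJ (@ctsC _ _ c)).
- by move=> t /=; rewrite in_itv /= => /fc.
Qed.

(** The divided difference of exp (- x), up to sign; the integral also makes
    sense, and depends smoothly on the end points, when these coincide. *)
Definition expdd (a b : R) : R := J (fun t => expR (- (t * a + (1 - t) * b))).

Let cts_seg (a b : R) : continuous (fun t : R => t * a + (1 - t) * b).
Proof.
apply: ctsD; apply: ctsM; try exact: ctsC; first exact: cts_id.
by apply: ctsB; [exact: ctsC|exact: cts_id].
Qed.

Let cts_expseg (a b : R) : continuous (fun t : R => expR (- (t * a + (1 - t) * b))).
Proof.
apply: (@cts_comp _ _ _ (fun t : R => - (t * a + (1 - t) * b)) (@expR R)).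
  by apply: ctsN; exact: cts_seg.
exact: continuous_expR.
Qed.

Lemma expddE (a b : R) : (a - b) * expdd a b = expR (- b) - expR (- a).
Proof.
have dH (t : R) : is_derive t 1 (fun t => - expR (- (t * a + (1 - t) * b)))
    ((a - b) * expR (- (t * a + (1 - t) * b))).
  apply: is_derive_eq; rewrite /GRing.scale /=; ring.
transitivity (J (fun t => (a - b) * expR (- (t * a + (1 - t) * b)))).
  by rewrite JZ//; exact: cts_expseg.
rewrite (J_FTC _ dH).
  by rewrite opprK addrC; congr (expR _ - expR _); ring.
by apply: ctsM; [exact: ctsC|exact: cts_expseg].
Qed.

Let seg_abs (d a b t : R) : `|a| <= d -> `|b| <= d -> 0 <= t <= 1 ->
  `|t * a + (1 - t) * b| <= d.
Proof.
rewrite !ler_norml => /andP[a0 a1] /andP[b0 b1] /andP[t0 t1].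
by apply/andP; split; nra.
Qed.

Lemma expR_small (d : R) : 0 <= d <= 4^-1 -> expR d <= 1 + 2 * d.
Proof.
move=> /andP[d0 d1]; have h := expR_ge1Dx (- d).
have ee : expR d * expR (- d) = 1 by rewrite -expRD subrr expR0.
have ep := expR_gt0 d; nra.
Qed.

Lemma expR_near1 (d x : R) : d <= 4^-1 -> `|x| <= d -> `|expR (- x) - 1| <= 2 * d.
Proof.
move=> d1 xd; have d0 : 0 <= d := le_trans (normr_ge0 _) xd.
have ed : expR d <= 1 + 2 * d by apply: expR_small; rewrite d0.
have := expR_sub1_le xd; have := normr_ge0 x.
have ep := expR_gt0 d; move: (expR d) ed ep => u *.
have : u * `|x| <= u * d by rewrite ler_wpM2l// ltW.
have : u * d <= 2 * d by rewrite ler_wpM2r//; lra.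
lra.
Qed.

Lemma expdd_near1 (d a b : R) : d <= 4^-1 -> `|a| <= d -> `|b| <= d ->
  `|expdd a b - 1| <= 2 * d.
Proof.
move=> d1 ad bd; rewrite /expdd -[X in _ - X](J_cst 1) -JB//; last exact: ctsC.
apply: J_bound; first by apply: ctsB => //; exact: ctsC.
by move=> t t01; apply: expR_near1 => //; exact: seg_abs.
Qed.

Let expR_diff (d x y : R) : d <= 4^-1 -> `|x| <= d -> `|y| <= d ->
  `|expR (- x) - expR (- y) + (x - y)| <= 2 * d * `|x - y|.
Proof.
move=> d1 xd yd.
have := expR_near1 d1 xd; have := expR_near1 d1 yd.
have eb (u v : R) : - expR (- v) * (u - v) <= expR (- u) - expR (- v).
  have e1 := expR_ge1Dx (v - u); have -> : expR (- u) = expR (- v) * expR (v - u).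
    by rewrite -expRD; congr expR; ring.
  have := expR_gt0 (- v); nra.
have := eb x y; have := eb y x; move: (expR (- x)) (expR (- y)) => u v e1 e2.
rewrite !ler_norml => /andP[v1 v2] /andP[u1 u2].
have d0 : 0 <= d := le_trans (normr_ge0 _) xd.
have e3 : u * (x - y) <= v - u by move: e2; lra.
case: (ger0P (x - y)) => xy; apply/andP; split.
- have := mulr_ge0 (_ : 0 <= 2 * d - (v - 1)) xy; rewrite subr_ge0 => /(_ v2); lra.
- have := mulr_ge0 (_ : 0 <= 2 * d - (1 - u)) xy; have -> : 0 <= 2 * d - (1 - u) by lra.
  by move=> /(_ isT); lra.
- have yx : 0 <= - (x - y) by lra.
  have := mulr_ge0 (_ : 0 <= 2 * d - (1 - v)) yx; have -> : 0 <= 2 * d - (1 - v) by lra.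
  by move=> /(_ isT); lra.
- have yx : 0 <= - (x - y) by lra.
  have := mulr_ge0 (_ : 0 <= 2 * d - (u - 1)) yx; rewrite subr_ge0 => /(_ u2); lra.
Qed.

(** The second-order expansion: the derivatives of [expdd] in its two arguments
    are close to - 1 / 2. *)
Lemma expdd_diff (d a b a' b' : R) : d <= 4^-1 ->
  `|a| <= d -> `|b| <= d -> `|a'| <= d -> `|b'| <= d ->
  `|expdd a b - expdd a' b' + (a - a' + (b - b')) / 2| <=
    2 * d * (`|a - a'| + `|b - b'|).
Proof.
move=> d1 ad bd ad' bd'.
have d0 : 0 <= d := le_trans (normr_ge0 _) ad.
have dH (t : R) : is_derive t 1 (fun t => (2^-1 * (a - a')) * t ^+ 2 + (b - b') * t - (2^-1 * (b - b')) * t ^+ 2)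
    ((t * a + (1 - t) * b) - (t * a' + (1 - t) * b')).
  by apply: is_derive_eq; rewrite /GRing.scale /=; field.
have -> : (a - a' + (b - b')) / 2 =
    J (fun t => (t * a + (1 - t) * b) - (t * a' + (1 - t) * b')).
  by rewrite (J_FTC _ dH); [field|apply: ctsB].
rewrite /expdd -JB// -JD//; [|exact: ctsB|exact: ctsB].
apply: J_bound; first by apply: ctsD; exact: ctsB.
move=> t t01; apply: le_trans (expR_diff d1 (seg_abs ad bd t01) (seg_abs ad' bd' t01)) _.
apply: ler_wpM2l; first by rewrite mulr_ge0.
have -> : t * a + (1 - t) * b - (t * a' + (1 - t) * b') = t * (a - a') + (1 - t) * (b - b') by ring.
move/andP: t01 => [t0 t1]; apply: le_trans (ler_normD _ _) _; rewrite !normrM.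
have t2 : 0 <= 1 - t by rewrite subr_ge0.
rewrite (ger0_norm t0) (ger0_norm t2).
by apply: lerD; rewrite ler_piMl//; rewrite lerBlDr lerDl.
Qed.

End expdd.

(** * A solution is determined by its second moments *)
Section density.
Variable R : realType.
Implicit Types F G : 'rV[R]_3 -> R.

Lemma sphere_sup F : continuous F -> exists s, [/\ 0 <= s,
  forall x, on_sphere x -> `|F x| <= s &
  forall m, (forall x, on_sphere x -> `|F x| <= m) -> s <= m].
Proof.
move=> cF; pose A := [set `|F x| | x in @on_sphere R].
have s0 : on_sphere (vec 1 0 0 : 'rV[R]_3) by rewrite /on_sphere vec_dot; ring.
have An : A !=set0 by exists `|F (vec 1 0 0)|; exists (vec 1 0 0).
have [M [_ FM]] := cts_sphere_bounded cF.
have Ab : has_ubound A by exists M => _ [x sx <-]; exact: FM.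
have ub x : on_sphere x -> `|F x| <= sup A by move=> sx; apply: ub_le_sup => //; exists x.
exists (sup A); split => //; first exact: le_trans (normr_ge0 _) (ub _ s0).
by move=> m Fm; apply: ge_sup => // _ [x sx <-]; exact: Fm.
Qed.

Definition nrm F : R := E (fun q => expR (- F q)).
(** The density relative to the uniform probability, that is, 4 pi rho. *)
Definition dens F x : R := (nrm F)^-1 * expR (- F x).
(** The quadratic form of the second-moment matrix of the density. *)
Definition qform F x : R := E (fun q => dot x q ^+ 2 * dens F q).

Lemma cts_expN F : continuous F -> continuous (fun x => expR (- F x)).
Proof. by move=> cF; exact: (cts_comp (ctsN cF) (@continuous_expR R)). Qed.

Lemma cts_dens F : continuous F -> continuous (dens F).
Proof. by move=> cF; apply: ctsM; [exact: ctsC|exact: cts_expN]. Qed.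

Lemma cts_dotsq_dens F x : continuous F -> continuous (fun q => dot x q ^+ 2 * dens F q).
Proof.
by move=> cF; apply: ctsM; [apply: ctsX; exact: cts_dot_r|exact: cts_dens].
Qed.

Lemma cts_rem_mul x (y : 'rV[R]_3 -> R) : continuous y ->
  continuous (fun q => remker (dot x q) * y q).
Proof.
by move=> cy; apply: ctsM => //; apply: cts_dot_comp; exact: cts_rem.
Qed.

Lemma E_rem_bound x (y : 'rV[R]_3 -> R) (c : R) : on_sphere x -> continuous y -> 0 <= c ->
  (forall q, on_sphere q -> `|y q| <= c) ->
  `|E (fun q => remker (dot x q) * y q)| <= 482 / 10000 * c.
Proof.
move=> sx cy c0 yc; have cr := @cts_dot_comp R _ x (@cts_rem R).
have cn := cts_comp cr (@norm_continuous _ R).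
apply: (@le_trans _ _ (E (fun q => c * `|remker (dot x q)|))).
  apply: le_trans (E_abs _) _; first exact: cts_rem_mul.
  apply: E_le.
  - exact: (cts_comp (cts_rem_mul cy) (@norm_continuous _ R)).
  - by apply: ctsM => //; exact: ctsC.
  - by move=> q sq; rewrite normrM mulrC ler_wpM2r// yc.
by rewrite EZ// mulrC ler_wpM2r// E_abs_rem.
Qed.

Section bounds.
Variables (F : 'rV[R]_3 -> R) (d : R).
Hypotheses (cF : continuous F) (Fd : forall x, on_sphere x -> `|F x| <= d).
Hypothesis (dsm : 10 ^+ 4 * d <= 1).

Lemma sphere_bound_ge0 : 0 <= d.
Proof.
apply: le_trans (normr_ge0 _) (Fd (_ : on_sphere (vec 1 0 0))).
by rewrite /on_sphere vec_dot; ring.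
Qed.

Lemma d_small : d <= 1 / 1000. Proof. by move: dsm; lra. Qed.

Lemma nrm_near1 : `|nrm F - 1| <= 2 * d.
Proof.
rewrite /nrm -[X in _ - X](E_cst 1) -EB; [|exact: cts_expN|exact: ctsC].
apply: E_bound; first by apply: ctsB; [exact: cts_expN|exact: ctsC].
by move=> x sx; apply: expR_near1; [have := d_small; lra|exact: Fd].
Qed.

Lemma nrm_gt0 : 0 < nrm F.
Proof. have := nrm_near1; have := d_small; rewrite ler_norml => ? /andP[? _]; lra. Qed.

Lemma nrmV_near1 : `|(nrm F)^-1 - 1| <= 3 * d.
Proof.
have := nrm_near1; have n0 := nrm_gt0; have ds := d_small; have d0 := sphere_bound_ge0.
have e : nrm F * (nrm F)^-1 = 1 by rewrite mulfV// gt_eqF.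
have i0 : 0 < (nrm F)^-1 by rewrite invr_gt0.
move: (nrm F) (nrm F)^-1 e n0 i0 => n i e n0 i0.
rewrite !ler_norml => /andP[n1 n2].
have h1 : 0 <= (n - 2 / 3) * i by apply: mulr_ge0; lra.
have h2 : 0 <= d * (3 / 2 - i) by apply: mulr_ge0; lra.
have h3 : 0 <= i * (2 * d - (1 - n)) by apply: mulr_ge0; lra.
have h4 : 0 <= i * (2 * d + (1 - n)) by apply: mulr_ge0; lra.
by apply/andP; split; lra.
Qed.

Lemma E_dens : E (dens F) = 1.
Proof. by rewrite /dens EZ ?mulVf// ?gt_eqF ?nrm_gt0//; exact: cts_expN. Qed.

End bounds.

(** The quadratic part of the kernel sees the solution only through its second
    moments. *)
Lemma solution_eq F (lam d : R) x : 10 ^+ 4 * d <= 1 -> small_solution lam d F -> on_sphere x ->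
  lam * F x = - (quad_coef R) * (qform F x - 3^-1) + E (fun q => remker (dot x q) * dens F q).
Proof.
move=> dsm [cF Fd sol] sx; rewrite sol// -EZ; last first.
  by apply: ctsM; [apply: cts_dot_comp; exact: cts_kernel|exact: cts_expN].
have c1 := @cts_dotsq_dens F x cF; have c2 := cts_dens cF.
have c3 := @cts_rem_mul x _ c2.
have -> : 3^-1 = 3^-1 * E (dens F) by rewrite (E_dens cF Fd dsm) mulr1.
rewrite /qform -EZ// -EB//; last first.
  by apply: ctsM => //; exact: ctsC.
rewrite -EZ; last by apply: ctsB => //; apply: ctsM => //; exact: ctsC.
rewrite -ED//; last by apply: ctsM; [exact: ctsC|apply: ctsB => //; apply: ctsM => //; exact: ctsC].
by apply: eq_E => q _; rewrite kernelE /dens -/(nrm F); ring.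
Qed.

Lemma expR_lip (d a b : R) : `|a| <= d -> `|b| <= d -> d <= 4^-1 ->
  `|expR (- a) - expR (- b)| <= (1 + 2 * d) * `|a - b|.
Proof.
move=> ad bd d4; have d0 : 0 <= d := le_trans (normr_ge0 _) ad.
rewrite -[leLHS]normrN opprB -expddE normrM mulrC ler_wpM2r//.
have := expdd_near1 d4 ad bd; have := ler_normD (expdd a b - 1) 1.
rewrite subrK normr1; lra.
Qed.

(** The factor 2 comes from the exponential and from the normalisation, each of
    which contributes a Lipschitz constant close to 1. *)
Lemma dens_lip F G (d m : R) : 10 ^+ 4 * d <= 1 -> continuous F -> continuous G ->
  (forall x, on_sphere x -> `|F x| <= d) -> (forall x, on_sphere x -> `|G x| <= d) ->
  (forall x, on_sphere x -> `|F x - G x| <= m) ->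
  forall x, on_sphere x -> `|dens F x - dens G x| <= 2 * (1 + 20 * d) * m.
Proof.
move=> dsm cF cG Fd Gd FGm x sx.
have ds := d_small dsm; have d0 := sphere_bound_ge0 Fd; have d4 : d <= 4^-1 by lra.
have m0 : 0 <= m := le_trans (normr_ge0 _) (FGm _ sx).
have eFG y : on_sphere y -> `|expR (- F y) - expR (- G y)| <= (1 + 2 * d) * m.
  move=> sy; apply: le_trans (expR_lip (Fd _ sy) (Gd _ sy) d4) _.
  by rewrite ler_wpM2l ?FGm//; lra.
have nFG : `|nrm F - nrm G| <= (1 + 2 * d) * m.
  rewrite /nrm -EB; try exact: cts_expN.
  by apply: E_bound => //; apply: ctsB; exact: cts_expN.
have iF := nrmV_near1 cF Fd dsm; have iG := nrmV_near1 cG Gd dsm.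
have eG := expR_near1 d4 (Gd _ sx).
have nF0 := nrm_gt0 cF Fd dsm; have nG0 := nrm_gt0 cG Gd dsm.
have -> : dens F x - dens G x = (nrm F)^-1 * (expR (- F x) - expR (- G x)) -
    expR (- G x) * ((nrm F)^-1 * (nrm G)^-1) * (nrm F - nrm G).
  by rewrite /dens; field; rewrite !gt_eqF.
apply: le_trans (ler_normB _ _) _; rewrite !normrM.
have bnd (z k : R) : `|z - 1| <= k -> `|z| <= 1 + k.
  by move=> h; have := ler_normD (z - 1) 1; rewrite subrK normr1; lra.
have {}iF := bnd _ _ iF; have {}iG := bnd _ _ iG; have {}eG := bnd _ _ eG.
have {}eFG := eFG _ sx.
apply: (@le_trans _ _ ((1 + 3 * d) * ((1 + 2 * d) * m) +
   (1 + 2 * d) * ((1 + 3 * d) * (1 + 3 * d)) * ((1 + 2 * d) * m))).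
  by apply: lerD; do ?[apply: ler_pM => //; rewrite ?mulr_ge0//].
have -> : (1 + 3 * d) * ((1 + 2 * d) * m) +
   (1 + 2 * d) * ((1 + 3 * d) * (1 + 3 * d)) * ((1 + 2 * d) * m) =
   ((1 + 3 * d) * (1 + 2 * d) + (1 + 2 * d) * ((1 + 3 * d) * (1 + 3 * d)) * (1 + 2 * d)) * m by ring.
rewrite ler_wpM2r//; nra.
Qed.

(** With equal second moments the difference of the two equations only involves
    the remainder kernel, which acts as a contraction: its norm is at most
    482 / 10000, the density is Lipschitz with constant about 2, and [lam] is
    at least 97 / 1000. *)
Lemma solution_unique F G (lam d : R) : 10 ^+ 4 * d <= 1 -> 97 / 1000 <= lam ->
  small_solution lam d F -> small_solution lam d G ->
  (forall x, on_sphere x -> qform F x = qform G x) ->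
  forall x, on_sphere x -> F x = G x.
Proof.
move=> dsm lam0 sF sG qFG.
have [cF Fd _] := sF; have [cG Gd _] := sG.
have ds := d_small dsm; have d0 := sphere_bound_ge0 Fd.
have cFG : continuous (fun x => F x - G x) by exact: ctsB.
have [s [s0 FGs smin]] := sphere_sup cFG.
have cdF := cts_dens cF; have cdG := cts_dens cG.
have step x : on_sphere x -> `|F x - G x| <= 999 / 1000 * s.
  move=> sx; have := solution_eq dsm sF sx; have := solution_eq dsm sG sx.
  rewrite qFG// => e1 e2.
  have e3 : lam * (F x - G x) = E (fun q => remker (dot x q) * (dens F q - dens G q)).
    rewrite mulrBr e1 e2 (@eq_E _ (fun q => _ * (_ - _))
      (fun q => remker (dot x q) * dens F q - remker (dot x q) * dens G q)).
      by rewrite EB; [ring|exact: cts_rem_mul|exact: cts_rem_mul].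
    by move=> q _; rewrite mulrBr.
  have c0 : 0 <= 2 * (1 + 20 * d) * s by rewrite !mulr_ge0//; lra.
  have := E_rem_bound sx (ctsB cdF cdG) c0 (dens_lip dsm cF cG Fd Gd FGs).
  rewrite -e3 normrM ger0_norm; last by lra.
  have := normr_ge0 (F x - G x); nra.
have ss := smin _ step.
have {}s0 : s = 0 by apply/eqP; rewrite eq_le s0 andbT; lra.
by move=> x sx; have := FGs x sx; rewrite s0 normr_le0 subr_eq0 => /eqP.
Qed.

Lemma on_sphere_orth (A : 'M[R]_3) x : orthogonal_mx A -> on_sphere x -> on_sphere (x *m A).
Proof. by move=> oA; rewrite /on_sphere orthogonal_dot. Qed.

Lemma nrm_rot F A : orthogonal_mx A -> continuous F -> nrm (fun x => F (x *m A)) = nrm F.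
Proof. by move=> oA cF; rewrite /nrm -(E_rot oA (cts_expN cF)). Qed.

Lemma qform_rot F A x : orthogonal_mx A -> continuous F ->
  qform (fun x => F (x *m A)) x = qform F (x *m A).
Proof.
move=> oA cF; rewrite /qform -(E_rot oA (@cts_dotsq_dens _ _ cF)); apply: eq_E => q _.
by rewrite orthogonal_dot// /dens nrm_rot.
Qed.

Lemma solution_rot F A (lam d : R) : orthogonal_mx A -> small_solution lam d F ->
  small_solution lam d (fun x => F (x *m A)).
Proof.
move=> oA [cF Fd sF]; split; first exact: cts_actmx.
- by move=> x sx; apply: Fd; exact: on_sphere_orth.
- move=> x sx; rewrite sF; last exact: on_sphere_orth.
  rewrite -/(nrm F) -/(nrm (fun x => F (x *m A))) nrm_rot//; congr (_ * _).
  rewrite -(E_rot oA).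
    by apply: eq_E => q _; rewrite orthogonal_dot.
  by apply: ctsM; [apply: cts_dot_comp; exact: cts_kernel|exact: cts_expN].
Qed.

End density.

(** * Secants of a solution *)
Lemma secant_closed_bound (R : realType) (lam b W d : R) : 97 / 1000 <= lam -> b <= 97 / 10 ->
  0 <= d -> d <= 1 / 1000 -> 0 <= W ->
  lam * W <= 482 / 10000 * ((1 + 6 * d) * W + 6 * d * b) -> W <= 60 * d.
Proof.
rewrite -(subr_ge0 (97 / 1000)) -(subr_ge0 b) -(subr_ge0 d) => l0 b0 d0 d1 W0.
have p1 := mulr_ge0 l0 W0; have p2 := mulr_ge0 b0 d0; have p3 := mulr_ge0 d1 W0.
lra.
Qed.

Section secant.
Variable R : realType.
Implicit Types h v G : 'rV[R]_3 -> R.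

Variables (F : 'rV[R]_3 -> R) (lam d : R).
Hypothesis dsm : 10 ^+ 4 * d <= 1.
Hypotheses (lam_lo : 97 / 1000 <= lam) (lam_hi : lam <= 14 / 100).
Hypothesis sol : small_solution lam d F.

Let cF : continuous F. Proof. by case: sol. Qed.
Let Fd x : on_sphere x -> `|F x| <= d. Proof. by case: sol => _ + _; exact. Qed.
Let d0 : 0 <= d. Proof. exact: sphere_bound_ge0 Fd. Qed.
Let ds : d <= 1 / 1000. Proof. by move: dsm; lra. Qed.

(** To first order a solution is - slope times the traceless part of its
    second-moment form. *)
Definition slope : R := quad_coef R / lam.

(** From 3.14 < pi < 4. *)
Lemma slope_bounds : 5 <= slope <= 97 / 10.
Proof.
have p1 := pi_gt314 R; have p2 := pihalf_lt2 R; have l0 : 0 < lam by move: lam_lo; lra.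
rewrite /slope /quad_coef; apply/andP; split.
  by rewrite ler_pdivlMr//; move: lam_lo lam_hi; lra.
by rewrite (ler_pdivrMr _ (15 * pi / 64) l0); move: lam_lo lam_hi; lra.
Qed.

Lemma lam_slope : lam * slope = quad_coef R.
Proof. by rewrite mulrC divfK// gt_eqF//; move: lam_lo; lra. Qed.

(** A solution of the linear equation for [v] is nearly - slope * h: as h is
    orthogonal to the remainder, v + slope * h is the image of G - slope * h,
    which differs from - (v + slope * h) by a term of order [d], and the norm of
    the remainder is less than [lam]. *)
Lemma secant_bound v G h (m : 'rV[R]_3 -> R) :
  continuous v -> continuous G -> continuous h ->
  (forall x, on_sphere x -> lam * v x = - quad_coef R * h x + E (fun q => remker (dot x q) * G q)) ->
  (forall x, on_sphere x -> G x = - m x * v x) ->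
  (forall x, on_sphere x -> `|m x - 1| <= 6 * d) ->
  (forall x, on_sphere x -> `|h x| <= 1) ->
  (forall x, on_sphere x -> E (fun q => remker (dot x q) * h q) = 0) ->
  forall x, on_sphere x -> `|v x + slope * h x| <= 60 * d.
Proof.
move=> cv cG ch veq Geq m1 h1 hr.
have := lam_slope; have /andP[] := slope_bounds; move: slope => b b0 b1 lb.
have cbh : continuous (fun x => b * h x) by apply: ctsM => //; exact: ctsC.
have [W [W0 vW Wmin]] := sphere_sup (ctsD cv cbh).
have Gbd x : on_sphere x -> `|G x - b * h x| <= (1 + 6 * d) * W + 6 * d * b.
  move=> sx; rewrite Geq//.
  have -> : - m x * v x - b * h x =
    - (m x * (v x + b * h x)) + (m x - 1) * (b * h x) by ring.
  apply: le_trans (ler_normD _ _) _; rewrite normrN !normrM; apply: lerD.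
    apply: ler_pM => //; last exact: vW.
    have := ler_normD (m x - 1) 1; rewrite subrK normr1; have := m1 _ sx; lra.
  apply: ler_pM => //; first exact: m1.
  rewrite [`|b|]ger0_norm; last by lra.
  by rewrite -[leRHS]mulr1 ler_wpM2l ?h1//; lra.
have c0 : 0 <= (1 + 6 * d) * W + 6 * d * b.
  by rewrite addr_ge0// !mulr_ge0//; move: d0; lra.
have step x : on_sphere x -> lam * `|v x + b * h x| <= 482 / 10000 * ((1 + 6 * d) * W + 6 * d * b).
  move=> sx; have l0 : 0 <= lam by move: lam_lo; lra.
  rewrite -(ger0_norm l0) -normrM; have <- : E (fun q => remker (dot x q) * (G q - b * h q)) =
      lam * (v x + b * h x).
    rewrite mulrDr veq// mulrA lb.
    rewrite (@eq_E _ _ (fun q => remker (dot x q) * G q - b * (remker (dot x q) * h q))); last first.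
      by move=> q _; ring.
    rewrite EB ?EZ; try by [exact: cts_rem_mul|apply: ctsM; [exact: ctsC|exact: cts_rem_mul]].
    by rewrite hr//; ring.
  by apply: E_rem_bound => //; exact: ctsB.
have W1 : lam * W <= 482 / 10000 * ((1 + 6 * d) * W + 6 * d * b).
  have l0 : 0 < lam by move: lam_lo; lra.
  rewrite mulrC -ler_pdivlMr//; apply: Wmin => x sx.
  by rewrite ler_pdivlMr// mulrC step.
suff : W <= 60 * d by move=> Wd x sx; exact: le_trans (vW _ sx) Wd.
exact: (secant_closed_bound lam_lo b1 d0 ds W0 W1).
Qed.

(** Let [A] be an isometry, and let [sg] measure the difference that it makes to
    the second moments. Dividing the differences of the solution and of its
    density by [sg] keeps them of order 1, whatever the size of [sg]. *)
Variable A : 'M[R]_3.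
Hypothesis oA : orthogonal_mx A.
Variable sg : R.
Hypothesis sg0 : sg != 0.

Definition dif x : R := (F x - F (x *m A)) / sg.
Definition ddif x : R := (dens F x - dens F (x *m A)) / sg.
(** Minus the ratio of the two secants, by the mean value theorem. *)
Definition chord x : R := (nrm F)^-1 * expdd (F x) (F (x *m A)).

Lemma cts_dif : continuous dif.
Proof. by apply: ctsM; [apply: ctsB => //; exact: cts_actmx|exact: ctsC]. Qed.

Lemma cts_ddif : continuous ddif.
Proof.
have cd := cts_dens cF.
by apply: ctsM; [apply: ctsB => //; exact: cts_actmx|exact: ctsC].
Qed.

Lemma ddifE x : ddif x = - chord x * dif x.
Proof.
rewrite /ddif /chord /dif /dens -mulrBr.
have -> : expR (- F x) - expR (- F (x *m A)) = - ((F x - F (x *m A)) * expdd (F x) (F (x *m A))).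
  by rewrite expddE opprB.
by ring.
Qed.

Lemma chord_near1 x : on_sphere x -> `|chord x - 1| <= 6 * d.
Proof.
move=> sx; have sA := on_sphere_orth oA sx.
have d4 : d <= 4^-1 by move: ds; lra.
have h1 := nrmV_near1 cF Fd dsm.
have h2 := expdd_near1 d4 (Fd sx) (Fd sA).
have -> : chord x - 1 = ((nrm F)^-1 - 1) * (expdd (F x) (F (x *m A)) - 1) +
   (((nrm F)^-1 - 1) + (expdd (F x) (F (x *m A)) - 1)) by rewrite /chord; ring.
apply: le_trans (ler_normD _ _) _.
apply: (@le_trans _ _ (3 * d * (2 * d) + (3 * d + 2 * d))).
  apply: lerD; first by rewrite normrM ler_pM.
  by apply: le_trans (ler_normD _ _) _; exact: lerD.
have : 0 <= (1 / 1000 - d) * d by apply: mulr_ge0; [rewrite subr_ge0; exact: ds|exact: d0].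
by move: d0; lra.
Qed.

Lemma dif_eq h : (forall x, on_sphere x -> qform F x - qform F (x *m A) = sg * h x) ->
  forall x, on_sphere x ->
  lam * dif x = - quad_coef R * h x + E (fun q => remker (dot x q) * ddif q).
Proof.
move=> qh x sx; have sA := on_sphere_orth oA sx.
have e1 := solution_eq dsm sol sx; have e2 := solution_eq dsm sol sA.
have cd := cts_dens cF; have cdA : continuous (fun q : 'rV[R]_3 => dens F (q *m A)) by exact: cts_actmx.
have e3 : E (fun q => remker (dot (x *m A) q) * dens F q) =
    E (fun q => remker (dot x q) * dens F (q *m A)).
  rewrite -(E_rot oA); last exact: cts_rem_mul.
  by apply: eq_E => q _; rewrite orthogonal_dot.
rewrite (@eq_E _ _ (fun q => sg^-1 * (remker (dot x q) * dens F q - remker (dot x q) * dens F (q *m A)))); last first.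
  by move=> q _; rewrite /ddif; ring.
rewrite EZ; last by apply: ctsB; exact: cts_rem_mul.
rewrite EB; [|exact: cts_rem_mul|exact: cts_rem_mul].
rewrite -e3 /dif mulrA mulrBr e1 e2.
have -> : h x = (qform F x - qform F (x *m A)) / sg by rewrite qh// mulrAC mulfV// mul1r.
by ring.
Qed.
End secant.

(** * Comparison of two secants *)
Section comparison.
Variable R : realType.
Implicit Types h v G : 'rV[R]_3 -> R.

Definition sqdif (i j : 'I_3) (x : 'rV[R]_3) : R := x 0 i ^+ 2 - x 0 j ^+ 2.

Lemma cts_sqdif i j : continuous (sqdif i j).
Proof. by apply: ctsB; apply: ctsX; exact: cts_crd. Qed.

Lemma coord_sq_le1 (x : 'rV[R]_3) i : on_sphere x -> 0 <= x 0 i ^+ 2 <= 1.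
Proof.
move=> sx; rewrite sqr_ge0 /=; have : \sum_(j < 3) x 0 j * x 0 j = 1 := sx.
by rewrite (bigD1 i)//= => <-; rewrite expr2 lerDl sumr_ge0// => j _; rewrite -expr2 sqr_ge0.
Qed.

Lemma sqdif_le1 i j (x : 'rV[R]_3) : on_sphere x -> `|sqdif i j x| <= 1.
Proof.
move=> sx; have := coord_sq_le1 i sx; have := coord_sq_le1 j sx.
rewrite /sqdif ler_norml => /andP[? ?] /andP[? ?]; apply/andP; split; lra.
Qed.

Lemma E_rem_sqdif i j (x : 'rV[R]_3) : on_sphere x ->
  E (fun q => remker (dot x q) * sqdif i j q) = 0.
Proof.
move=> sx; rewrite (@eq_E _ _ (fun q => remker (dot x q) * q 0 i ^+ 2 - remker (dot x q) * q 0 j ^+ 2)).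
  rewrite EB ?E_rem_coord2 ?subr0//; apply: cts_rem_mul; apply: ctsX; exact: cts_crd.
by move=> q _; rewrite /sqdif mulrBr.
Qed.

Lemma moment_gap (b d : R) : 10 ^+ 4 * d <= 1 -> 5 <= b ->
  `|b * b / 2 * (16 / 105)| <= 2500 * d -> False.
Proof.
move=> d4 b5; have : 0 <= (b - 5) * (b - 5) by rewrite -expr2 sqr_ge0.
have b0 : 0 <= b * b / 2 * (16 / 105) by rewrite !mulr_ge0//; lra.
rewrite ger0_norm//; lra.
Qed.

(** Two functions [v] and [vh] solve the same linear equation, up to the
    coefficients [m] and [mh] that link them to [G] and [Gh]. If these
    coefficients differ by about [D] times [mu0], then the projections of [G] and
    [Gh] on [h] must differ by a quantity of order [D], given by the moment
    [E_cubic_moment]. They are however both equal to 2. *)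
Section core.
Variables (lam d b D : R).
Hypothesis dsm : 10 ^+ 4 * d <= 1.
Hypothesis (d0 : 0 <= d).
Hypotheses (lam_lo : 97 / 1000 <= lam) (b5 : 5 <= b) (b10 : b <= 97 / 10).
Hypothesis D0 : D != 0.
Variables v G vh Gh m mh : 'rV[R]_3 -> R.
Let h := sqdif 0 2%:R.
Hypotheses (cv : continuous v) (cG : continuous G) (cvh : continuous vh) (cGh : continuous Gh).
Hypothesis veq : forall x, on_sphere x ->
  lam * v x = - quad_coef R * h x + E (fun q => remker (dot x q) * G q).
Hypothesis vheq : forall x, on_sphere x ->
  lam * vh x = - quad_coef R * h x + E (fun q => remker (dot x q) * Gh q).
Hypotheses (GE : forall x, on_sphere x -> G x = - m x * v x)
  (GhE : forall x, on_sphere x -> Gh x = - mh x * vh x).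
Hypothesis m1 : forall x, on_sphere x -> `|m x - 1| <= 6 * d.
Hypothesis vhb : forall x, on_sphere x -> `|vh x + b * h x| <= 60 * d.
(** The first-order value of (m - mh) / D. *)
Let mu0 (x : 'rV[R]_3) := b / 2 * (3 * x 0 1 ^+ 2 - 1).
Hypothesis mub : forall x, on_sphere x -> `|(m x - mh x) / D - mu0 x| <= 130 * d.
Hypotheses (hG : E (fun x => h x * G x) = 2) (hGh : E (fun x => h x * Gh x) = 2).

Let ds : d <= 1 / 1000. Proof. by move: dsm; lra. Qed.
Let u x := (v x - vh x) / D.
Let T x := (G x - Gh x) / D.
Let cu : continuous u.
Proof. by apply: ctsM; [exact: ctsB|exact: ctsC]. Qed.
Let cT : continuous T.
Proof. by apply: ctsM; [exact: ctsB|exact: ctsC]. Qed.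
Let ch : continuous h. Proof. exact: cts_sqdif. Qed.

Let TE x : on_sphere x -> T x = - m x * u x - (m x - mh x) / D * vh x.
Proof. by move=> sx; rewrite /T /u GE// GhE//; field. Qed.

Let ueq x : on_sphere x -> lam * u x = E (fun q => remker (dot x q) * T q).
Proof.
move=> sx; rewrite (@eq_E _ _ (fun q => D^-1 * (remker (dot x q) * G q - remker (dot x q) * Gh q))).
  rewrite EZ; last by apply: ctsB; exact: cts_rem_mul.
  rewrite EB; try exact: cts_rem_mul.
  by rewrite /u mulrA mulrBr veq// vheq//; ring.
by move=> q _; rewrite /T; ring.
Qed.

Let mu0b x : on_sphere x -> `|mu0 x| <= 97 / 10.
Proof.
move=> sx; have /andP[x0 x1] := coord_sq_le1 1 sx.
rewrite /mu0 ler_norml; move: (x 0 1 ^+ 2) x0 x1 => t t0 t1.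
have p1 : 0 <= b * t by apply: mulr_ge0 => //; move: b5; lra.
have p2 : 0 <= b * (1 - t) by apply: mulr_ge0; move: b5; lra.
by apply/andP; split; move: b10; lra.
Qed.

Let bnd (z y k l : R) : `|z - y| <= k -> `|y| <= l -> `|z| <= l + k.
Proof.
move=> zy yl; rewrite -(subrK y z) addrC; apply: le_trans (ler_normD _ _) _.
exact: lerD.
Qed.

Let mu10 x : on_sphere x -> `|(m x - mh x) / D| <= 10.
Proof.
move=> sx; apply: le_trans (bnd (mub sx) (mu0b sx)) _.
by move: dsm; lra.
Qed.

Let vh10 x : on_sphere x -> `|vh x| <= 10.
Proof.
move=> sx; have hb : `|- (b * h x)| <= 97 / 10.
  rewrite normrN normrM ger0_norm; last by move: b5; lra.
  rewrite -[leRHS]mulr1; apply: ler_pM => //; [by move: b5; lra|exact: sqdif_le1].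
have := vhb sx; rewrite -[b * h x]opprK => h1; apply: le_trans (bnd h1 hb) _.
by move: dsm; lra.
Qed.

(** The equation for [u] is contracting, with a source of size at most 10 * 10. *)
Let u100 x : on_sphere x -> `|u x| <= 100.
Proof.
have [W [W0 uW Wmin]] := sphere_sup cu.
have l0 : 0 < lam by move: lam_lo; lra.
have Tb y : on_sphere y -> `|T y| <= (1 + 6 * d) * W + 100.
  move=> sy; rewrite TE//; apply: le_trans (ler_normB _ _) _.
  apply: lerD.
    rewrite mulNr normrN normrM; apply: ler_pM => //; last exact: uW.
    by apply: bnd (m1 sy) _; rewrite normr1.
  have -> : 100 = 10 * 10 :> R by ring.
  by rewrite normrM; apply: ler_pM => //; [exact: mu10|exact: vh10].
have c0 : 0 <= (1 + 6 * d) * W + 100.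
  by apply: addr_ge0 => //; apply: mulr_ge0 => //; move: d0; lra.
have step : lam * W <= 482 / 10000 * ((1 + 6 * d) * W + 100).
  rewrite mulrC -ler_pdivlMr//; apply: Wmin => y sy; rewrite ler_pdivlMr//.
  rewrite mulrC -{1}(gtr0_norm l0) -normrM ueq//; exact: E_rem_bound.
have W100 : W <= 100.
  have p1 : 0 <= (lam - 97 / 1000) * W by apply: mulr_ge0; [rewrite subr_ge0|].
  have p2 : 0 <= (1 - 10 ^+ 4 * d) * W by apply: mulr_ge0; [rewrite subr_ge0|].
  by move: step; lra.
by move=> sx; exact: le_trans (uW _ sx) W100.
Qed.

Let hT0 : E (fun x => h x * T x) = 0.
Proof.
rewrite (@eq_E _ _ (fun x => D^-1 * (h x * G x - h x * Gh x))); last first.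
  by move=> x _; rewrite /T; ring.
rewrite EZ; last by apply: ctsB; exact: ctsM.
by rewrite EB ?hG ?hGh ?subrr ?mulr0//; exact: ctsM.
Qed.

(** By symmetry of the remainder operator, which annihilates [h]. *)
Let hu0 : E (fun x => h x * u x) = 0.
Proof.
have l0 : lam != 0 by rewrite gt_eqF//; move: lam_lo; lra.
apply: (mulfI l0); rewrite mulr0 -EZ; last exact: ctsM.
rewrite (@eq_E _ _ (fun p => h p * E (fun q => remker (dot p q) * T q))); last first.
  by move=> p sp; rewrite -ueq//; ring.
rewrite E_fubini//; last exact: cts_rem.
rewrite -[RHS](E_cst 0); apply: eq_E => q sq; rewrite -[RHS](mulr0 (T q)); congr (_ * _).
rewrite -[RHS](E_rem_sqdif 0 2%:R sq); apply: eq_E => p _.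
by congr (remker _ * _); apply: eq_bigr => i _; rewrite mulrC.
Qed.

(** T = - m u - ((m - mh) / D) vh is close to - u + mu0 * (b * h), and both T and
    u are orthogonal to h; testing against h leaves a nonzero multiple of
    [E_cubic_moment]. *)
Lemma secants_absurd : False.
Proof.
have c0 : continuous (fun x => mu0 x * (b * h x)).
  apply: ctsM; last by apply: ctsM => //; exact: ctsC.
  apply: ctsM; first exact: ctsC.
  apply: ctsB; last exact: ctsC.
  by apply: ctsM; [exact: ctsC|apply: ctsX; exact: cts_crd].
pose err x := (T x + u x) - mu0 x * (b * h x).
have cerr : continuous err by apply: ctsB => //; exact: ctsD.
have errb x : on_sphere x -> `|err x| <= 2500 * d.
  move=> sx; have -> : err x = - ((m x - 1) * u x) - (((m x - mh x) / D - mu0 x) * vh x +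
      mu0 x * (vh x + b * h x)) by rewrite /err TE//; ring.
  apply: le_trans (ler_normB _ _) _; rewrite normrN normrM.
  apply: (@le_trans _ _ (6 * d * 100 + (130 * d * 10 + 97 / 10 * (60 * d)))).
    apply: lerD; first by apply: ler_pM => //; [exact: m1|exact: u100].
    apply: le_trans (ler_normD _ _) _.
    rewrite (normrM (_ - mu0 x)) (normrM (mu0 x)); apply: lerD.
      by apply: ler_pM => //; [exact: mub|exact: vh10].
    by apply: ler_pM => //; [exact: mu0b|exact: vhb].
  by move: d0; lra.
have e1 : E (fun x => h x * err x) = b * b / 2 * (16 / 105).
  rewrite (@eq_E _ _ (fun x => (h x * T x + h x * u x) -
    (b * b / 2) * ((x 0 0 ^+ 2 - x 0 2%:R ^+ 2) ^+ 2 * (3 * x 0 1 ^+ 2 - 1)))); last first.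
    by move=> x _; rewrite /err /mu0 /h /sqdif; ring.
  have cc : continuous (fun x : 'rV[R]_3 => (x 0 0 ^+ 2 - x 0 2%:R ^+ 2) ^+ 2 * (3 * x 0 1 ^+ 2 - 1)).
    have cx i := @cts_crd R i.
    apply: ctsM; first by apply: ctsX; exact: ch.
    by apply: ctsB; [apply: ctsM; [exact: ctsC|exact: ctsX]|exact: ctsC].
  rewrite EB; [|by apply: ctsD; exact: ctsM|by apply: ctsM => //; exact: ctsC].
  rewrite ED; try exact: ctsM.
  by rewrite EZ// hT0 hu0 E_cubic_moment; ring.
apply: (moment_gap (d := d) (b := b)) => //.
rewrite -e1; apply: E_bound; first exact: ctsM.
move=> x sx; rewrite normrM -[leRHS]mul1r; apply: ler_pM => //; [exact: sqdif_le1|exact: errb].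
Qed.
End core.
End comparison.

(** * Two of the three second moments coincide *)
(** [M] is a difference of values of [expdd] whose arguments differ by [D] times
    [v1] and [v2], and [i] is the normalising factor; the quantity estimated is
    the difference of two chords divided by [D]. *)
Lemma chord_difference (R : realType) (i M D b v1 v2 h1 h2 d : R) : 10 ^+ 4 * d <= 1 -> 0 <= d ->
  D != 0 -> 0 <= b -> b <= 97 / 10 ->
  `|M + (D * v1 + D * v2) / 2| <= 2 * d * (`|D * v1| + `|D * v2|) ->
  `|v1 + b * h1| <= 60 * d -> `|v2 + b * h2| <= 60 * d -> `|h1| <= 1 -> `|h2| <= 1 ->
  `|i - 1| <= 3 * d ->
  `|i * M / D - b / 2 * (h1 + h2)| <= 130 * d.
Proof.
move=> d4 d0 D0 b0 b1 MD v1b v2b h1b h2b i1.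
have bh (h : R) : `|h| <= 1 -> `|b * h| <= 97 / 10.
  by move=> hb; rewrite normrM (ger0_norm b0) -[leRHS]mulr1; apply: ler_pM.
have vb (v h : R) : `|v + b * h| <= 60 * d -> `|h| <= 1 -> `|v| <= 98 / 10.
  move=> vh /bh hb; rewrite -(addrK (b * h) v); apply: le_trans (ler_normB _ _) _.
  by move: vh hb; lra.
have w1 := vb _ _ v1b h1b; have w2 := vb _ _ v2b h2b.
have X1 : `|M / D + (v1 + v2) / 2| <= 40 * d.
  have -> : M / D + (v1 + v2) / 2 = (M + (D * v1 + D * v2) / 2) / D by field.
  rewrite normrM normfV ler_pdivrMr ?normr_gt0//; apply: le_trans MD _.
  rewrite !normrM -mulrDr mulrCA [leRHS]mulrC; apply: ler_wpM2l => //.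
  have : 0 <= d * (196 / 10 - (`|v1| + `|v2|)) by apply: mulr_ge0 => //; lra.
  by lra.
have X2 : `|M / D - b / 2 * (h1 + h2)| <= 100 * d.
  have -> : M / D - b / 2 * (h1 + h2) =
    (M / D + (v1 + v2) / 2) - ((v1 + b * h1) + (v2 + b * h2)) / 2 by field.
  apply: le_trans (ler_normB _ _) _; rewrite [X in _ + X]normrM (ger0_norm (_ : 0 <= 2^-1))//.
  have := ler_normD (v1 + b * h1) (v2 + b * h2); lra.
have X3 : `|M / D| <= 98 / 10.
  rewrite -(subrK (b / 2 * (h1 + h2)) (M / D)); apply: le_trans (ler_normD _ _) _.
  have -> : b / 2 * (h1 + h2) = (b * h1 + b * h2) / 2 by field.
  rewrite [X in _ + X]normrM (ger0_norm (_ : 0 <= 2^-1))//.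
  have := ler_normD (b * h1) (b * h2); have := bh _ h1b; have := bh _ h2b.
  have -> : (b * h1 + b * h2) / 2 = b / 2 * (h1 + h2) by field.
  lra.
have -> : i * M / D - b / 2 * (h1 + h2) = (i - 1) * (M / D) + (M / D - b / 2 * (h1 + h2)).
  by field.
apply: le_trans (ler_normD _ _) _; rewrite normrM.
have : `|i - 1| * `|M / D| <= 3 * d * (98 / 10) by apply: ler_pM.
lra.
Qed.

Section distinct.
Variable R : realType.
Variables (F : 'rV[R]_3 -> R) (lam d : R).
Hypothesis dsm : 10 ^+ 4 * d <= 1.
Hypotheses (lam_lo : 97 / 1000 <= lam) (lam_hi : lam <= 14 / 100).
Hypothesis sol : small_solution lam d F.
Variables s0 s1 s2 : R.
Hypothesis qF : forall x, on_sphere x ->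
  qform F x = s0 * x 0 0 ^+ 2 + s1 * x 0 1 ^+ 2 + s2 * x 0 2%:R ^+ 2.

Let cF : continuous F. Proof. by case: sol. Qed.
Let Fd x : on_sphere x -> `|F x| <= d. Proof. by case: sol => _ + _; exact. Qed.
Let d0 : 0 <= d. Proof. exact: sphere_bound_ge0 Fd. Qed.
Let ds : d <= 1 / 1000. Proof. by move: dsm; lra. Qed.
Let cd : continuous (dens F). Proof. exact: cts_dens. Qed.

Let mom0 : E (fun q => q 0 0 ^+ 2 * dens F q) = s0.
Proof.
have sx : on_sphere (vec 1 0 0 : 'rV[R]_3) by rewrite /on_sphere vec_dot; ring.
have := qF sx; rewrite /qform !vec0 !vec1 !vec2 !expr0n expr1n !mulr0 !addr0 mulr1 => <-.
by apply: eq_E => q _; rewrite dotE vec0 vec1 vec2; congr (_ ^+ 2 * _); ring.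
Qed.

Let mom1 : E (fun q => q 0 1 ^+ 2 * dens F q) = s1.
Proof.
have sx : on_sphere (vec 0 1 0 : 'rV[R]_3) by rewrite /on_sphere vec_dot; ring.
have := qF sx; rewrite /qform !vec0 !vec1 !vec2 !expr0n expr1n !mulr0 !addr0 add0r mulr1 => <-.
by apply: eq_E => q _; rewrite dotE vec0 vec1 vec2; congr (_ ^+ 2 * _); ring.
Qed.

Let mom2 : E (fun q => q 0 2%:R ^+ 2 * dens F q) = s2.
Proof.
have sx : on_sphere (vec 0 0 1 : 'rV[R]_3) by rewrite /on_sphere vec_dot; ring.
have := qF sx; rewrite /qform !vec0 !vec1 !vec2 !expr0n expr1n !mulr0 !add0r mulr1 => <-.
by apply: eq_E => q _; rewrite dotE vec0 vec1 vec2; congr (_ ^+ 2 * _); ring.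
Qed.

(** A test function that is odd under [A] sees the moment twice, once from the
    density and once from its transform. *)
Let antisym (h : 'rV[R]_3 -> R) A sg : continuous h -> orthogonal_mx A -> sg != 0 ->
  A *m A = 1%:M -> (forall x, h (x *m A) = - h x) -> E (fun x => h x * dens F x) = sg ->
  E (fun x => h x * ddif F A sg x) = 2.
Proof.
move=> ch oA sg0 AA hA hE.
have chd : continuous (fun x => h x * dens F x) by exact: ctsM.
have e : E (fun x => h x * dens F (x *m A)) = - sg.
  rewrite -hE -EN// -(E_rot oA); last by apply: ctsM => //; exact: cts_actmx.
  by apply: eq_E => x _; rewrite hA -mulmxA AA mulmx1 mulNr.
rewrite (@eq_E _ _ (fun x => sg^-1 * (h x * dens F x - h x * dens F (x *m A)))); last first.
  by move=> x _; rewrite /ddif; ring.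
have chA : continuous (fun x => h x * dens F (x *m A)).
  by apply: ctsM => //; exact: cts_actmx.
by rewrite EZ ?EB// ?e ?hE; [field|exact: ctsB].
Qed.

Let oXY : orthogonal_mx (swpXY R). Proof. by have [] := orthogonal_swp R. Qed.
Let oXZ : orthogonal_mx (swpXZ R). Proof. by have [] := orthogonal_swp R. Qed.
Let oYZ : orthogonal_mx (swpYZ R). Proof. by have [] := orthogonal_swp R. Qed.

Let swp_sq : [/\ swpXY R *m swpXY R = 1%:M, swpXZ R *m swpXZ R = 1%:M &
  swpYZ R *m swpYZ R = 1%:M].
Proof.
by split; rewrite mx3_1 mx3M !vecM !scale_vec !add_vec;
  congr (mx3 (vec _ _ _) (vec _ _ _) (vec _ _ _)); ring.
Qed.

(** The secant for the exchange of x and z, and the secant for the exchange of x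
    and y seen after exchanging y and z, both have h = x^2 - z^2 as their
    principal part and both have moment 2 against h. Their chords differ by the
    secant for the exchange of y and z, hence by s1 - s2 times an expression in
    y^2 - z^2 and y^2 - x^2, whose sum is 3 y^2 - 1 on the sphere. *)
Lemma two_moments_equal : s0 != s1 -> s0 != s2 -> s1 = s2.
Proof.
move=> n01 n02; apply/eqP/negPn/negP => n12.
have n01' : s0 - s1 != 0 by rewrite subr_eq0.
have n02' : s0 - s2 != 0 by rewrite subr_eq0.
have n12' : s1 - s2 != 0 by rewrite subr_eq0.
have [AXY AXZ AYZ] := swp_sq.
have q13 x : on_sphere x -> qform F x - qform F (x *m swpXZ R) = (s0 - s2) * sqdif 0 2%:R x.
  move=> sx; have sA := on_sphere_orth oXZ sx.
  by rewrite !qF// mul_swpXZ vec0 vec1 vec2 /sqdif; ring.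
have q12 x : on_sphere x -> qform F x - qform F (x *m swpXY R) = (s0 - s1) * sqdif 0 1 x.
  move=> sx; have sA := on_sphere_orth oXY sx.
  by rewrite !qF// mul_swpXY vec0 vec1 vec2 /sqdif; ring.
have q23 x : on_sphere x -> qform F x - qform F (x *m swpYZ R) = (s1 - s2) * sqdif 1 2%:R x.
  move=> sx; have sA := on_sphere_orth oYZ sx.
  by rewrite !qF// mul_swpYZ vec0 vec1 vec2 /sqdif; ring.
have bound A sg i j (oA : orthogonal_mx A) (n : sg != 0)
    (qq : forall x, on_sphere x -> qform F x - qform F (x *m A) = sg * sqdif i j x) x :
    on_sphere x -> `|dif F A sg x + slope lam * sqdif i j x| <= 60 * d.
  apply: (@secant_bound R F lam d dsm lam_lo lam_hi sol (dif F A sg) (ddif F A sg)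
    (sqdif i j) (chord F A)).
  - exact: (cts_dif sol).
  - exact: (cts_ddif sol).
  - exact: cts_sqdif.
  - exact: (dif_eq dsm sol oA n qq).
  - by move=> y _; exact: ddifE.
  - exact: (chord_near1 dsm sol oA).
  - exact: sqdif_le1.
  - exact: E_rem_sqdif.
have /andP[b5 b10] := slope_bounds lam_lo lam_hi.
have b12 := bound _ _ _ _ oXY n01' q12.
have b23 := bound _ _ _ _ oYZ n12' q23.
have cv12 := @cts_dif _ _ _ _ sol (swpXY R) (s0 - s1).
have cG12 := @cts_ddif _ _ _ _ sol (swpXY R) (s0 - s1).
have sYZ x : sqdif 0 1 (x *m swpYZ R) = sqdif 0 2%:R x.
  by rewrite /sqdif mul_swpYZ vec0 vec1.
apply: (@secants_absurd R lam d (slope lam) (s1 - s2) dsm d0 lam_lo b5 b10 n12'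
  (dif F (swpXZ R) (s0 - s2)) (ddif F (swpXZ R) (s0 - s2))
  (fun x => dif F (swpXY R) (s0 - s1) (x *m swpYZ R))
  (fun x => ddif F (swpXY R) (s0 - s1) (x *m swpYZ R))
  (chord F (swpXZ R)) (fun x => chord F (swpXY R) (x *m swpYZ R))).
- exact: (cts_dif sol).
- exact: (cts_ddif sol).
- exact: cts_actmx.
- exact: cts_actmx.
- exact: (dif_eq dsm sol oXZ n02' q13).
- move=> x sx; have sA := on_sphere_orth oYZ sx.
  have -> := dif_eq dsm sol oXY n01' q12 sA; rewrite sYZ; congr (_ + _).
  rewrite -(E_rot oYZ); last exact: cts_rem_mul.
  by apply: eq_E => q _; rewrite orthogonal_dot.
- by move=> x _; exact: ddifE.
- by move=> x _; exact: ddifE.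
- exact: (chord_near1 dsm sol oXZ).
- by move=> x sx; rewrite -sYZ; apply: b12; exact: on_sphere_orth.
- move=> x sx; have s13 := on_sphere_orth oXZ sx; have sY := on_sphere_orth oYZ sx.
  have sYX := on_sphere_orth oXY sY.
  have e : x *m swpYZ R *m swpXY R = x *m swpXZ R *m swpYZ R.
    by rewrite mul_swpXY !mul_swpYZ mul_swpXZ !vec0 !vec1 !vec2.
  have eT : 3 * x 0 1 ^+ 2 - 1 = sqdif 1 2%:R x + sqdif 1 2%:R (x *m swpXZ R).
    by have := on_sphereE sx; rewrite /sqdif mul_swpXZ vec1 vec2; lra.
  rewrite eT /chord -mulrBr.
  have dD y : (s1 - s2) * dif F (swpYZ R) (s1 - s2) y = F y - F (y *m swpYZ R).
    by rewrite /dif mulrC divfK.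
  have d4 : d <= 4^-1 by move: ds; lra.
  apply: (chord_difference dsm d0 n12' _ b10 _ (b23 _ sx) (b23 _ s13)).
  + by move: b5; lra.
  + rewrite !dD -e; apply: (expdd_diff d4); exact: Fd.
  + exact: sqdif_le1.
  + exact: sqdif_le1.
  + exact: (nrmV_near1 cF Fd dsm).
- apply: (antisym (@cts_sqdif R 0 2%:R) oXZ n02' AXZ).
    by move=> x; rewrite /sqdif mul_swpXZ vec0 vec2; ring.
  rewrite -mom0 -mom2 -EB; [|by apply: ctsM => //; apply: ctsX; exact: cts_crd..].
  by apply: eq_E => q _; rewrite /sqdif mulrBl.
- transitivity (E (fun x => sqdif 0 1 x * ddif F (swpXY R) (s0 - s1) x)).
    rewrite -[RHS](E_rot oYZ); last by apply: ctsM => //; exact: cts_sqdif.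
    by apply: eq_E => x _; rewrite sYZ.
  apply: (antisym (@cts_sqdif R 0 1) oXY n01' AXY).
    by move=> x; rewrite /sqdif mul_swpXY vec0 vec1; ring.
  rewrite -mom0 -mom1 -EB; [|by apply: ctsM => //; apply: ctsX; exact: cts_crd..].
  by apply: eq_E => q _; rewrite /sqdif mulrBl.
Qed.

End distinct.

(** * Diagonalisation and the axis of symmetry *)
Section diagonal.
Variable R : realType.
Implicit Types F : 'rV[R]_3 -> R.

Definition quad (a b c p q r : R) (x : 'rV[R]_3) : R :=
  a * x 0 0 ^+ 2 + b * x 0 1 ^+ 2 + c * x 0 2%:R ^+ 2 +
  2 * (p * x 0 0 * x 0 1 + q * x 0 0 * x 0 2%:R + r * x 0 1 * x 0 2%:R).

Lemma qform_quad F : continuous F -> exists a b c p q r, forall x, qform F x = quad a b c p q r x.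
Proof.
move=> cF; have cd := cts_dens cF; have cx := @cts_crd R.
pose S i j := E (fun y => y 0 i * y 0 j * dens F y).
have cS i j : continuous (fun y : 'rV[R]_3 => y 0 i * y 0 j * dens F y).
  by apply: ctsM => //; exact: ctsM.
exists (S 0 0), (S 1 1), (S 2%:R 2%:R), (S 0 1), (S 0 2%:R), (S 1 2%:R) => x.
have cZ (k : R) i j : continuous (fun y : 'rV[R]_3 => k * (y 0 i * y 0 j * dens F y)).
  by apply: ctsM => //; exact: ctsC.
rewrite /qform (@eq_E _ _ (fun y => x 0 0 ^+ 2 * (y 0 0 * y 0 0 * dens F y) +
   (x 0 1 ^+ 2 * (y 0 1 * y 0 1 * dens F y) +
   (x 0 2%:R ^+ 2 * (y 0 2%:R * y 0 2%:R * dens F y) +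
   ((2 * x 0 0 * x 0 1) * (y 0 0 * y 0 1 * dens F y) +
   ((2 * x 0 0 * x 0 2%:R) * (y 0 0 * y 0 2%:R * dens F y) +
   (2 * x 0 1 * x 0 2%:R) * (y 0 1 * y 0 2%:R * dens F y))))))); last first.
  by move=> y _; rewrite dotE; ring.
do 5 (rewrite ED; [|exact: cZ|by repeat first [exact: cZ | apply: ctsD]]).
by rewrite !EZ// /quad /S; ring.
Qed.

(** The first-order condition at a maximum of a quadratic form. *)
Lemma quad_max0 (a b p : R) : (forall t : R, a + 2 * p * t + b * t ^+ 2 <= a * (1 + t ^+ 2)) -> p = 0.
Proof.
move=> h; set K := `|b - a| + 1.
have K0 : 0 < K by rewrite ltr_wpDl.
(* For t = p / K the gain 2 p t exceeds the loss of second order. *)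
have := h (p / K); have Kb : `|b - a| < K by rewrite ltrDl.
have : a - b <= `|b - a| by rewrite distrC ler_norm.
move=> h1 h2; have : p ^+ 2 * (2 * K - (a - b)) <= 0.
  have -> : p ^+ 2 * (2 * K - (a - b)) =
     K ^+ 2 * (a + 2 * p * (p / K) + b * (p / K) ^+ 2 - a * (1 + (p / K) ^+ 2)).
    by field; rewrite gt_eqF.
  by rewrite pmulr_rle0 ?exprn_gt0// subr_le0.
have k2 : 0 < 2 * K - (a - b) by rewrite subr_gt0; lra.
rewrite pmulr_lle0// => p0; apply/eqP; rewrite -sqrf_eq0 eq_le p0 sqr_ge0//.
Qed.

Lemma half_angle (c s : R) : c ^+ 2 + s ^+ 2 = 1 ->
  exists c' s', [/\ c' ^+ 2 + s' ^+ 2 = 1, c = c' ^+ 2 - s' ^+ 2 & s = 2 * s' * c'].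
Proof.
move=> /cos_sin_surj[t _ [-> ->]]; exists (cos (t / 2)), (sin (t / 2)).
have e : t = t / 2 + t / 2 by field.
split; first exact: cos2Dsin2.
  by rewrite {1}e cosD -!expr2.
by rewrite {1}e sinD; ring.
Qed.

Definition diag_form F := exists a b c, forall x, on_sphere x ->
  qform F x = a * x 0 0 ^+ 2 + b * x 0 1 ^+ 2 + c * x 0 2%:R ^+ 2.

(** A maximum of the form on the sphere is moved to the x-axis; there maximality
    cancels the mixed terms that involve x. A rotation about that axis by half of
    the Givens angle removes the last one. *)
Lemma diagonalize F : continuous F ->
  exists A, orthogonal_mx A /\ diag_form (fun x => F (x *m A)).
Proof.
move=> cF; have [a [b [c [p [q [r qE]]]]]] := qform_quad cF.
have cq : continuous (qform F).
  have -> : qform F = quad a b c p q r by apply: funext.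
  have cx := @cts_crd R.
  have cZ (k : R) f : continuous f -> continuous (fun y : 'rV[R]_3 => k * f y).
    by move=> cf; apply: ctsM => //; exact: ctsC.
  have cS i : continuous (fun y : 'rV[R]_3 => y 0 i ^+ 2) by apply: ctsX.
  apply: ctsD; first by apply: ctsD; [apply: ctsD|]; exact: cZ.
  apply: (cZ 2); apply: ctsD; first by apply: ctsD; apply: ctsM => //; exact: (cZ _ _ (cx _)).
  by apply: ctsM => //; exact: (cZ _ _ (cx _)).
have s0 : on_sphere (vec 1 0 0 : 'rV[R]_3) by rewrite /on_sphere vec_dot; ring.
have [u su umax] : exists2 u, on_sphere u & forall x, on_sphere x -> qform F x <= qform F u.
  have [|u] := @EVT_max_rV R 3 (qform F) (@on_sphere R) _ (@compact_sphere R) (continuous_subspaceT cq).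
    by exists (vec 1 0 0).
  by rewrite inE => su um; exists u => // x sx; apply: um; rewrite inE.
have [B [_ oB uB]] := to_pole su.
have oBt : orthogonal_mx B^T by rewrite /orthogonal_mx trmxK; exact: mulmx1C.
pose F1 x := F (x *m B^T); have cF1 : continuous F1 by exact: cts_actmx.
have e0B : vec 1 0 0 *m B^T = u by rewrite -uB -mulmxA oB mulmx1.
have max1 x : on_sphere x -> qform F1 x <= qform F1 (vec 1 0 0).
  by move=> sx; rewrite !qform_rot// e0B; apply: umax; exact: on_sphere_orth.
have [a1 [b1 [c1 [p1 [q1 [r1 q1E]]]]]] := qform_quad cF1.
have q0 : qform F1 (vec 1 0 0) = a1.
  by rewrite q1E /quad vec0 vec1 vec2; ring.
have hom y z : a1 + b1 * y ^+ 2 + c1 * z ^+ 2 + 2 * (p1 * y + q1 * z + r1 * y * z) <=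
    a1 * (1 + y ^+ 2 + z ^+ 2).
  set n2 := 1 + y ^+ 2 + z ^+ 2; have n0 : 0 < n2.
    by rewrite /n2 -addrA ltr_pwDl// addr_ge0// sqr_ge0.
  have [w [nn nz]] : exists w, w ^+ 2 = n2 /\ w != 0.
    by exists (Num.sqrt n2); rewrite sqr_sqrtr ?(ltW n0)// gt_eqF// sqrtr_gt0.
  have sv : on_sphere (vec (1 / w) (y / w) (z / w)).
    rewrite /on_sphere vec_dot.
    have -> : 1 / w * (1 / w) + y / w * (y / w) + z / w * (z / w) = (1 + y ^+ 2 + z ^+ 2) / w ^+ 2.
      by field.
    by rewrite nn mulfV// gt_eqF.
  have := max1 _ sv; rewrite q0 q1E /quad vec0 vec1 vec2.
  have -> : a1 * (1 / w) ^+ 2 + b1 * (y / w) ^+ 2 + c1 * (z / w) ^+ 2 +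
    2 * (p1 * (1 / w) * (y / w) + q1 * (1 / w) * (z / w) + r1 * (y / w) * (z / w)) =
    (a1 + b1 * y ^+ 2 + c1 * z ^+ 2 + 2 * (p1 * y + q1 * z + r1 * y * z)) / w ^+ 2 by field.
  by rewrite nn ler_pdivrMr.
have p10 : p1 = 0.
  apply: (@quad_max0 a1 b1) => t; have := hom t 0; rewrite !expr0n /=; lra.
have q10 : q1 = 0.
  apply: (@quad_max0 a1 c1) => t; have := hom 0 t; rewrite !expr0n /=; lra.
have [c2 [s2 [cs2 [_ e2]]]] := givens ((b1 - c1) / 2) r1.
have [cc [ss [cs ecc ess]]] := half_angle cs2.
have [_ oX] := rotX_inv_orthogonal cs.
exists (rotX cc ss *m B^T); split; first exact: orthogonal_mxM.
have -> : (fun x => F (x *m (rotX cc ss *m B^T))) = (fun x => F1 (x *m rotX cc ss)).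
  by apply: funext => x; rewrite /F1 mulmxA.
exists a1, (b1 * cc ^+ 2 + c1 * ss ^+ 2 - 2 * r1 * cc * ss), (b1 * ss ^+ 2 + c1 * cc ^+ 2 + 2 * r1 * cc * ss) => x sx.
have -> : qform (fun x => F1 (x *m rotX cc ss)) x = qform F1 (x *m rotX cc ss) by exact: qform_rot.
have -> : x *m rotX cc ss = vec (x 0 0) (x 0 2%:R * ss + x 0 1 * cc) (x 0 2%:R * cc - x 0 1 * ss).
  by rewrite {1}(vec_eta x) vec_rotX.
rewrite q1E /quad !vec0 !vec1 !vec2 p10 q10.
apply/eqP; rewrite -subr_eq0 [X in X == 0](_ : _ = 2 * x 0 1 * x 0 2%:R *
  ((b1 - c1) / 2 * (2 * ss * cc) + r1 * (cc ^+ 2 - ss ^+ 2))); last by field.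
by rewrite -ecc -ess e2 mulr0.
Qed.

End diagonal.

Section final.
Variable R : realType.

Lemma qform_axis (F : 'rV[R]_3 -> R) (a b : R) (i : 'I_3) (B : 'M[R]_3) :
  continuous F ->
  (forall x, on_sphere x -> qform F x = a + b * x 0 i ^+ 2) ->
  orthogonal_mx B -> delta_mx 0 i *m B = delta_mx 0 i :> 'rV[R]_3 ->
  forall x, on_sphere x -> qform (fun x => F (x *m B)) x = qform F x.
Proof.
move=> cF qF oB eB x sx; rewrite qform_rot// !qF//; last exact: on_sphere_orth.
have dotd (y : 'rV[R]_3) : dot y (delta_mx 0 i) = y 0 i.
  rewrite /dot (bigD1 i)//= big1 => [|j ji]; first by rewrite mxE !eqxx mulr1 addr0.
  by rewrite mxE eqxx (negbTE ji) mulr0.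
by rewrite -[(x *m B) 0 i]dotd -{1}eB orthogonal_dot// dotd.
Qed.

Lemma qform_axial (F : 'rV[R]_3 -> R) (lam d : R) :
  10 ^+ 4 * d <= 1 -> 97 / 1000 <= lam -> lam <= 14 / 100 ->
  small_solution lam d F -> diag_form F ->
  exists i a b, forall x, on_sphere x -> qform F x = a + b * x 0 i ^+ 2.
Proof.
move=> dsm l0 l1 sol [a [b [c qF]]].
have sE (x : 'rV[R]_3) := @on_sphereE R x.
have [ab|ab] := eqVneq a b.
  exists 2%:R, a, (c - a) => x sx; rewrite qF// -ab.
  have -> : a * x 0 0 ^+ 2 + a * x 0 1 ^+ 2 + c * x 0 2%:R ^+ 2 =
    a * (x 0 0 ^+ 2 + x 0 1 ^+ 2 + x 0 2%:R ^+ 2) + (c - a) * x 0 2%:R ^+ 2 by ring.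
  by rewrite sE// mulr1.
have [ac|ac] := eqVneq a c.
  exists 1, a, (b - a) => x sx; rewrite qF// -ac.
  have -> : a * x 0 0 ^+ 2 + b * x 0 1 ^+ 2 + a * x 0 2%:R ^+ 2 =
    a * (x 0 0 ^+ 2 + x 0 1 ^+ 2 + x 0 2%:R ^+ 2) + (b - a) * x 0 1 ^+ 2 by ring.
  by rewrite sE// mulr1.
have bc := two_moments_equal dsm l0 l1 sol qF ab ac.
exists 0, b, (a - b) => x sx; rewrite qF// -bc.
have -> : a * x 0 0 ^+ 2 + b * x 0 1 ^+ 2 + b * x 0 2%:R ^+ 2 =
  b * (x 0 0 ^+ 2 + x 0 1 ^+ 2 + x 0 2%:R ^+ 2) + (a - b) * x 0 0 ^+ 2 by ring.
by rewrite sE// mulr1.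
Qed.

(** A moment form with two equal eigenvalues is fixed by the isometries that fix
    the third axis; a solution and its transform by such an isometry have
    the same second moments, so they coincide. *)
Lemma solution_axis (F : 'rV[R]_3 -> R) (lam d : R) :
  10 ^+ 4 * d <= 1 -> 97 / 1000 <= lam -> lam <= 14 / 100 -> small_solution lam d F ->
  exists2 n, on_sphere n & forall C, orthogonal_mx C -> n *m C = n ->
    forall x, on_sphere x -> F (x *m C) = F x.
Proof.
move=> dsm l0 l1 sol; have [cF _ _] := sol.
have [A [oA dA]] := diagonalize cF.
have solA := solution_rot oA sol.
have [i [a [b qA]]] := qform_axial dsm l0 l1 solA dA.
have AtA : A^T *m A = 1%:M by exact: mulmx1C.
have oAt : orthogonal_mx A^T by rewrite /orthogonal_mx trmxK.
have si : on_sphere (delta_mx 0 i : 'rV[R]_3).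
  rewrite /on_sphere /dot (bigD1 i)//= big1 => [|j ji]; first by rewrite mxE !eqxx mulr1 addr0.
  by rewrite mxE eqxx (negbTE ji) mulr0.
exists (delta_mx 0 i *m A); first exact: on_sphere_orth.
move=> C oC nC x sx.
pose B := A *m C *m A^T.
have oB : orthogonal_mx B by do 2 (apply: orthogonal_mxM => //).
have eB : delta_mx 0 i *m B = delta_mx 0 i :> 'rV[R]_3.
  by rewrite /B !mulmxA nC -mulmxA oA mulmx1.
have solB := solution_rot oB solA.
have cFA : continuous (fun x : 'rV[R]_3 => F (x *m A)) by exact: cts_actmx.
have := solution_unique dsm l0 solB solA (qform_axis cFA qA oB eB) (on_sphere_orth oAt sx).
rewrite /B -!mulmxA AtA mulmx1 !mulmxA -[x *m A^T *m A]mulmxA AtA mulmx1.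
by [].
Qed.

End final.

Theorem theorem28 (R : realType) :
  exists2 eps : R, 0 < eps &
    forall (phi : S2 R -> R) (lambda : R),
      H2 phi -> H2norm phi < eps -> `|lambda - pi / 32| < eps ->
      euler_lagrange lambda phi ->
      axially_symmetric phi.
Proof.
have [d d0 dsm] : exists2 d : R, 0 < d & 10 ^+ 4 * d <= 1.
  by exists (10 ^- 4); rewrite ?invr_gt0 ?exprn_gt0// mulfV// expf_neq0.
have [eps /andP[e0 e1] ext] := solution_extends d0.
exists eps => // phi lam Hphi nphi lame EL.
have [F sol phiF] := ext phi lam Hphi nphi lame EL.
have p1 := pi_gt314 R; have p2 := pihalf_lt2 R.
have [l0 l1] : 97 / 1000 <= lam /\ lam <= 14 / 100.
  by move: lame; rewrite ltr_norml => /andP[? ?]; split; lra.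
have [n sn nsym] := solution_axis dsm l0 l1 sol.
exists (sphere_point sn) => A [oA _]; rewrite coords_sphere_point => nA p q qp.
by have := nsym A oA nA _ (coords_on_sphere p); rewrite -qp -!phiF.
Qed.
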